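(* Let $p\in\{1,2\}$, let $f(x)=\mathbb{E}_\xi[F(x,\xi)]$ satisfy the assumptions listed in the context and in addition be $\mu_p$-strongly convex w.r.t. $\|\cdot\|_p$, and let the ARDDsc method (described in the context) be applied to the problem $\min_{x\in\mathbb{R}^n}f(x)$ with $K\ge 1$ outer iterations. Then its output $u_K$ satisfies $$\mathbb{E}f(u_K)-f^*\le\frac{\mu_pR_p^2}{2}\cdot2^{-K}+2\Delta,$$ where $$\Delta=\frac{61N_0}{24L_2}\Delta_\zeta+\frac{122N_0}{3L_2}\Delta_\eta^2+\frac{12\sqrt{2nR_p^2\Omega_p}}{N_0^2}\left(\frac{\sqrt{\Delta_\zeta}}{2}+2\Delta_\eta\right)+\frac{N_0^2}{12n\rho_nL_2}\left(\frac{\sqrt{\Delta_\zeta}}{2}+2\Delta_\eta\right)^2 .$$ Moreover, for a target accuracy $\varepsilon>0$, under an appropriate choice of $\Delta_\zeta$ and $\Delta_\eta$ such that $2\Delta\le\varepsilon/2$, the oracle complexity (total number of evaluations of the noisy directional derivative $\tilde f'$) to achieve $\varepsilon$-accuracy of the solution, $\mathbb{E}f(u_K)-f^*\le\varepsilon$, is $$\widetilde O\left(\max\left\{n^{\frac12+\frac1q}\sqrt{\frac{L_2\Omega_p}{\mu_p}}\log_2\frac{\mu_pR_p^2}{\varepsilon},\ \frac{n^{\frac2q}\sigma^2\Omega_p}{\mu_p\varepsilon}\right\}\right).$$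
   Context: Problem. $n\ge 8$; $\xi$ is a random vector with distribution $P$ on $\mathcal{X}$; for $P$-almost every $\xi$ the function $F(\cdot,\xi):\mathbb{R}^n\to\mathbb{R}$ is closed and convex and has gradient $g(x,\xi)$ that is $L(\xi)$-Lipschitz in the Euclidean norm, with $\sqrt{\mathbb{E}_\xi L(\xi)^2}\le L_2<+\infty$, $L_2>0$. Then $\mathbb{E}_\xi g(x,\xi)=\nabla f(x)$ and $\nabla f$ is $L_2$-Lipschitz in the Euclidean norm. Also $\mathbb{E}_\xi\|g(x,\xi)-\nabla f(x)\|_2^2\le\sigma^2$ for all $x$. $x_*$ denotes the minimizer of $f$ and $f^*=f(x_* )$. $\mu_p$-strong convexity ($\mu_p>0$): $f(y)\ge f(x)+\langle\nabla f(x),y-x\rangle+\frac{\mu_p}2\|y-x\|_p^2$. Oracle. Let $S_2(1)$ be the unit Euclidean sphere centered at $0$ in $\mathbb{R}^n$, and write $e\in RS_2(1)$ for $e$ uniformly distributed on $S_2(1)$. For $x\in\mathbb{R}^n$, $e\in S_2(1)$ and $\xi$ drawn independently from $P$, the oracle returns $\tilde f'(x,\xi,e)=\langle g(x,\xi),e\rangle+\zeta(x,\xi,e)+\eta(x,\xi,e)$, where $\mathbb{E}_\xi(\zeta(x,\xi,e))^2\le\Delta_\zeta$ for all $x,e$, and $|\eta(x,\xi,e)|\le\Delta_\eta$ for all $x,e$ and almost surely in $\xi$; $\Delta_\zeta,\Delta_\eta$ are controlled and can be made as small as desired. Proximal setup. $\frac1p+\frac1q=1$ (so $q=\infty$ for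 $p=1$, $q=2$ for $p=2$). For $p=1$: $d(x)=\frac{\Omega_1}{2}\|x\|_\kappa^2$ with $\kappa=1+\frac1{\ln n}$, $\Omega_1=\mathrm{e}\,n^{(\kappa-1)(2-\kappa)/\kappa}\ln n$. For $p=2$: $d(x)=\frac12\|x\|_2^2$, $\Omega_2=1$. In both cases $d$ is 1-strongly convex w.r.t. $\|\cdot\|_p$. For a prox-function $d$, the Bregman divergence is $V[z](x)=d(x)-d(z)-\langle\nabla d(z),x-z\rangle$. Put $\rho_n=\min\{q-1,\,16\ln n-8\}\,n^{\frac2q-1}$ (for $q=\infty$: $q-1=\infty$, $2/q=0$). ARDD method (input: starting point $x_0$, prox-function, number of iterations $N$, batch size $m$). Set $y_0=z_0=x_0$. For $k=0,\dots,N-1$: put $\alpha_{k+1}=\frac{k+2}{96n^2\rho_nL_2}$, $\tau_k=\frac2{k+2}$; set $x_{k+1}=\tau_kz_k+(1-\tau_k)y_k$; draw $e_{k+1}\in RS_2(1)$ and independent realizations $\xi_1,\dots,\xi_m$ of $\xi$, independently of everything drawn before; compute $\widetilde\nabla^mf(x_{k+1})=\frac1m\sum_{i=1}^m\tilde f'(x_{k+1},\xi_i,e_{k+1})\,e_{k+1}$; set $y_{k+1}=x_{k+1}-\frac1{2L_2}\widetilde\nabla^mf(x_{k+1})$ and $z_{k+1}=\arg\min_{z\in\mathbb{R}^n}\{\alpha_{k+1}n\langle\widetilde\nabla^mf(x_{k+1}),z-z_k\rangle+V[z_k](z)\}$. Output $y_N$. ARDDsc method (input: $x_0$ with $\|x_0-x_*\|_p^2\le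 R_p^2$, $K\ge1$, $\mu_p$). Put $a=384n^2\rho_n$, $b=\frac4n$, $N_0=\left\lceil\sqrt{8aL_2\Omega_p/\mu_p}\right\rceil$, $u_0=x_0$. For $k=0,\dots,K-1$: put $m_k=\max\left\{1,\left\lceil\frac{8b\sigma^2N_02^k}{L_2\mu_pR_p^2}\right\rceil\right\}$, $R_k^2=R_p^22^{-k}+\frac{4\Delta}{\mu_p}(1-2^{-k})$ ($\Delta$ as in the claim), $d_k(x)=R_k^2\,d\left(\frac{x-u_k}{R_k}\right)$; run ARDD from starting point $u_k$ with prox-function $d_k$ (and its Bregman divergence) for $N_0$ steps with batch size $m_k$; let $u_{k+1}=y_{N_0}$ be its output. Output $u_K$. $\mathbb{E}$ is the expectation over all randomness. $\widetilde O$ hides polylogarithmic factors $(\ln n)^c$, $c>0$, and absolute constants.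
   Formalization: The oracle complexity bound is asserted for ε ≤ μ_p R_p²/2; with no such restriction it fails, since for σ = 0 and ε ≥ μ_p R_p² the displayed maximum is ≤ 0 while K ≥ 1 forces at least one oracle call. The accuracy claim holds for every ε > 0. *)

(* Defs.v *)
From HB Require Import structures.
From mathcomp Require Import all_boot all_order all_algebra.
From mathcomp Require Import all_classical all_reals all_analysis.

Set Implicit Arguments.
Unset Strict Implicit.
Unset Printing Implicit Defensive.

Import Order.TTheory GRing.Theory Num.Theory.
Import numFieldNormedType.Exports.

Local Open Scope classical_set_scope.
Local Open Scope ring_scope.

(* Matrices, in particular the row vectors ['rV[R]_n] that stand for $R^n$,   *)
(* carry their Borel sigma-algebra.                                           *)
Section borel_matrix.
Variables (R : realType) (m n : nat).

Definition mx_open : set (set 'M[R]_(m, n)) := open.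

Let borel_mx0 : <<s mx_open >> set0.
Proof. exact: sigma_algebra0. Qed.

Let borel_mxC A : <<s mx_open >> A -> <<s mx_open >> (~` A).
Proof. exact: sigma_algebraC. Qed.

Let borel_mx_bigcup (A : (set 'M[R]_(m, n))^nat) :
  (forall i, <<s mx_open >> (A i)) -> <<s mx_open >> (\bigcup_i A i).
Proof. exact: sigma_algebra_bigcup. Qed.

HB.instance Definition _ := @isMeasurable.Build (sigma_display mx_open)
  'M[R]_(m, n) <<s mx_open >> borel_mx0 borel_mxC borel_mx_bigcup.

End borel_matrix.

Section vectors.
Context {R : realType} {n : nat}.
Implicit Types (x y z : 'rV[R]_n) (h : 'rV[R]_n -> R).

Definition dotv x y : R := \sum_i x 0 i * y 0 i.

Definition lnorm (r : R) x : R := (\sum_i `|x 0 i| `^ r) `^ r^-1.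

Definition sphere : set 'rV[R]_n := [set e | lnorm 2 e = 1].

Definition grad h x : 'rV[R]_n := \row_i 'D_(delta_mx 0 i) h x.

(* The epigraph of [h] is closed. *)
Definition closed_function h := closed [set xt : 'rV[R]_n * R | h xt.1 <= xt.2].

Definition strongly_convex (r mu : R) h := forall x y,
  h x + dotv (grad h x) (y - x) + mu / 2 * lnorm r (y - x) ^+ 2 <= h y.

Definition minimizer h x := forall y, h x <= h y.

(* An arbitrary point when there is no minimizer. *)
Definition argmin h : 'rV[R]_n := get [set z | minimizer h z].

(* Bregman divergence V[z](x) of the prox-function [d]. *)
Definition bregman (d : 'rV[R]_n -> R) z x : R :=
  d x - d z - dotv (grad d z) (x - z).

End vectors.
Arguments sphere {R} n.

Section random.
Context {R : realType} {d : measure_display} {T : measurableType d}.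
Variable Pr : probability T R.

(* [C i] is the class of events (a sigma-algebra) attached to the index [i]. *)
Definition mutually_independent (I : choiceType) (C : I -> set (set T)) :=
  forall (s : seq I) (A : I -> set T), uniq s ->
    (forall i, i \in s -> C i (A i)) ->
    Pr (\big[setI/setT]_(i <- s) A i) = (\prod_(i <- s) Pr (A i))%E.

End random.

(* The uniform distribution on the Euclidean unit sphere is the Borel         *)
(* probability carried by the sphere and invariant under the orthogonal group.*)
Definition uniform_on_sphere (R : realType) (n : nat)
    (U : set 'rV[R]_n -> \bar R) :=
  U (sphere n) = 1%E /\
  forall (Q : 'M[R]_n) (A : set 'rV[R]_n), Q *m Q^T = 1%:M -> measurable A ->
    U ((fun x => x *m Q) @^-1` A) = U A.

Section problem.
Context {R : realType} {n : nat} {d : measure_display} {X : measurableType d}.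
Variable P : probability X R.
Implicit Types (F : 'rV[R]_n -> X -> R) (g : 'rV[R]_n -> X -> 'rV[R]_n).

Definition objective F (x : 'rV[R]_n) : R := fine 'E_P[F x].

(* The measurability and integrability fields express that all the            *)
(* expectations of the problem are meaningful.                                *)
Record stochastic_problem F g (L : X -> R) (L2 sigma : R) : Prop := {
  sp_integrable : forall x, P.-integrable setT (EFin \o F x) ;
  sp_measurable_g :
    measurable_fun setT (fun w : 'rV[R]_n * X => g w.1 w.2) ;
  sp_measurable_L : measurable_fun setT L ;
  sp_closed : {ae P, forall xi, closed_function (F ^~ xi)} ;
  sp_convex : {ae P, forall xi, convex_function setT (F ^~ xi)} ;
  sp_gradient : {ae P, forall xi, forall x,
    differentiable (F ^~ xi) x /\ grad (F ^~ xi) x = g x xi} ;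
  sp_lipschitz : {ae P, forall xi, forall x y,
    lnorm 2 (g x xi - g y xi) <= L xi * lnorm 2 (x - y)} ;
  sp_L2 : (sqrte 'E_P[(fun xi => L xi ^+ 2)%R] <= L2%:E)%E ;
  sp_variance : forall x,
    ('E_P[(fun xi => lnorm 2 (g x xi - grad (objective F) x) ^+ 2)%R]
       <= (sigma ^+ 2)%:E)%E }.

Implicit Types zeta eta : 'rV[R]_n -> X -> 'rV[R]_n -> R.

Definition oracle g zeta eta (x : 'rV[R]_n) (xi : X) (e : 'rV[R]_n) : R :=
  dotv (g x xi) e + zeta x xi e + eta x xi e.

Record oracle_noise zeta eta (Dzeta Deta : R) : Prop := {
  on_measurable_zeta : measurable_fun setT
    (fun w : 'rV[R]_n * X * 'rV[R]_n => zeta w.1.1 w.1.2 w.2) ;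
  on_measurable_eta : measurable_fun setT
    (fun w : 'rV[R]_n * X * 'rV[R]_n => eta w.1.1 w.1.2 w.2) ;
  on_zeta : forall x e, sphere n e ->
    ('E_P[(fun xi => zeta x xi e ^+ 2)%R] <= Dzeta%:E)%E ;
  on_eta : forall x e, sphere n e ->
    {ae P, forall xi, `|eta x xi e| <= Deta} }.

(* All the randomness of a run: in the inner iteration [j] of the outer       *)
(* iteration [k], the direction [e k j] and the realizations [xi k j i].      *)
Record random_draws {d' : measure_display} {T : measurableType d'}
    (Pr : probability T R) (e : nat -> nat -> {RV Pr >-> 'rV[R]_n})
    (xi : nat -> nat -> nat -> {RV Pr >-> X}) : Prop := {
  rd_e : forall k j, uniform_on_sphere (distribution Pr (e k j)) ;
  rd_xi : forall k j i (A : set X), measurable A ->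
    distribution Pr (xi k j i) A = P A ;
  rd_independent : mutually_independent Pr
    (fun a : (nat * nat) + (nat * nat * nat) =>
       match a with
       | inl (k, j) => preimage_set_system setT (e k j) measurable
       | inr (k, j, i) => preimage_set_system setT (xi k j i) measurable
       end) }.

End problem.

(* The ceiling of a nonnegative real. *)
Definition nat_ceil {R : realType} (x : R) : nat := `|Num.ceil x|%N.

Definition log2 {R : realType} (x : R) : R := ln x / ln 2.

Section setup.
Context {R : realType}.
Variables n p : nat.

Definition kappa : R := 1 + (ln n%:R)^-1.

Definition Omega : R :=
  if p == 1%N
  then expR 1 * n%:R `^ ((kappa - 1) * (2 - kappa) / kappa) * ln n%:R
  else 1.

Definition prox (x : 'rV[R]_n) : R :=
  if p == 1%N then Omega / 2 * lnorm kappa x ^+ 2 else 2^-1 * lnorm 2 x ^+ 2.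

Definition conj_exp : \bar R := hoelder_conjugate p%:R%:E.

(* 1 / q, equal to 0 when q = +oo. *)
Definition inv_q : R := fine (conj_exp^-1)%E.

Definition rho : R :=
  fine (Order.min (conj_exp - 1) (16 * ln n%:R - 8)%:E)%E
    * n%:R `^ (2 * inv_q - 1).

End setup.
Arguments kappa {R} n.
Arguments Omega {R} n p.
Arguments conj_exp {R} p.
Arguments inv_q {R} p.
Arguments rho {R} n p.

Section ardd.
Context {R : realType} {n : nat} {X : Type}.
Variables (p : nat) (L2 : R).
Variable orc : 'rV[R]_n -> X -> 'rV[R]_n -> R.

Definition batch_gradient (m : nat) (x e : 'rV[R]_n) (xi : nat -> X) :
    'rV[R]_n :=
  (m%:R^-1 * \sum_(i < m) orc x (xi i) e) *: e.

(* The step sizes alpha_{k+1} and tau_k of the iteration k. *)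
Definition alpha (k : nat) : R := k.+2%:R / (96 * n%:R ^+ 2 * rho n p * L2).

Definition tau (k : nat) : R := 2 / k.+2%:R.

Variables (pf : 'rV[R]_n -> R) (m : nat) (x0 : 'rV[R]_n).
Variables (e : nat -> 'rV[R]_n) (xi : nat -> nat -> X).

(* The pair (y_k, z_k). *)
Fixpoint ardd_state (k : nat) : 'rV[R]_n * 'rV[R]_n :=
  if k is j.+1 then
    let: (y, z) := ardd_state j in
    let x := tau j *: z + (1 - tau j) *: y in
    let G := batch_gradient m x (e j) (xi j) in
    (x - (2 * L2)^-1 *: G,
     argmin (fun w => alpha j * n%:R * dotv G (w - z) + bregman pf z w))
  else (x0, x0).

Definition ardd (N : nat) : 'rV[R]_n := (ardd_state N).1.

End ardd.

Section arddsc.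
Context {R : realType}.
Variables (n p : nat) (L2 mu sigma Rp : R).

Definition inner_steps : nat :=
  nat_ceil (Num.sqrt (8 * (384 * n%:R ^+ 2 * rho n p) * L2 * Omega n p / mu)).

Definition batch_size (k : nat) : nat :=
  maxn 1 (nat_ceil (8 * (4 / n%:R) * sigma ^+ 2 * inner_steps%:R * 2 ^+ k
                      / (L2 * mu * Rp ^+ 2))).

Definition noise_level (Dzeta Deta : R) : R :=
  let N0 := inner_steps%:R in
  let s := Num.sqrt Dzeta / 2 + 2 * Deta in
  61 * N0 / (24 * L2) * Dzeta
  + 122 * N0 / (3 * L2) * Deta ^+ 2
  + 12 * Num.sqrt (2 * n%:R * Rp ^+ 2 * Omega n p) / N0 ^+ 2 * s
  + N0 ^+ 2 / (12 * n%:R * rho n p * L2) * s ^+ 2.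

(* Every inner iteration of the outer iteration [k] evaluates the oracle      *)
(* [batch_size k] times.                                                      *)
Definition oracle_calls (K : nat) : nat :=
  \sum_(k < K) inner_steps * batch_size k.

Variable Delta : R.

(* The square of the radius R_k of the outer iteration [k]. *)
Definition radius2 (k : nat) : R :=
  Rp ^+ 2 * 2 ^- k + 4 * Delta / mu * (1 - 2 ^- k).

Definition restart_prox (k : nat) (u x : 'rV[R]_n) : R :=
  radius2 k * prox p ((Num.sqrt (radius2 k))^-1 *: (x - u)).

Context {X : Type}.
Variables (orc : 'rV[R]_n -> X -> 'rV[R]_n -> R) (x0 : 'rV[R]_n).
Variables (e : nat -> nat -> 'rV[R]_n) (xi : nat -> nat -> nat -> X).

Fixpoint arddsc (K : nat) : 'rV[R]_n :=
  if K is k.+1 then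
    let u := arddsc k in
    ardd p L2 orc (restart_prox k u) (batch_size k) u (e k) (xi k) inner_steps
  else x0.

End arddsc.

(* Main.v *)
Require Import Defs.
From HB Require Import structures.
From mathcomp Require Import all_boot all_order all_algebra.
From mathcomp Require Import all_classical all_reals all_analysis.
From mathcomp Require Import perm measurable_realfun lebesgue_Rintegral ring lra.

Set Implicit Arguments.
Unset Strict Implicit.
Unset Printing Implicit Defensive.

Import Order.TTheory GRing.Theory Num.Theory.
Import numFieldNormedType.Exports.

Local Open Scope classical_set_scope.
Local Open Scope ring_scope.

(** One iteration is analysed for a frozen past.  With [s], [a], [delta] the
    components along the random direction [e] of the gradient, of the batch
    error and of the oracle noise, the gradient step and the mirror step along
    [(s + a + delta) e] decrease a weighted sum of the primal gap and of the
    Bregman divergence; averaging over the batch kills the terms linear in [a],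
    and averaging over [e] uses that coordinate reflections and permutations
    preserve the uniform distribution, so that the second moments are [1 / n]
    times a scalar product and the dual norm of [e] satisfies
    [E N(e) <= rho].  For p = 1 the latter follows from a sub-Gaussian bound for
    the coordinates of [e], itself obtained from sign flips.  The term
    [<delta e, z - xstar>] is absorbed by Young's inequality with the parameter
    [lam = 2 sum_j alpha_j]; the resulting factors [1 + alpha_j / lam] at most
    double the error over a run, so no bound on the iterates is needed.
    Independence turns the frozen past into a Fubini argument.  With
    [N_0 >= 13], which holds since [mu <= 2 L_2], a run maps the bound
    [E |u_k - xstar|^2 <= R_k^2] to [E f(u_(k+1)) - f^* <= mu R_(k+1)^2 / 2],
    and strong convexity closes the induction. *)

(** * Vectors and Borel measurability *)

(** No iterate is known in advance to have a finite second moment. Expectations are therefore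
    handled as extended-real integrals of nonnegative functions, and this is why scalar products of
    indefinite sign are polarized into squares: the squares are integrated on both sides and
    cancelled once their integrals are known to be finite. Freezing the past requires that each
    iterate be measurable for the sigma-algebra of its own draws. An [argmin] given by choice offers
    no such property, so it is first computed in closed form through the duality map between
    conjugate norms. All that is used of the prox-function follows by Fenchel duality from the
    smoothness of half the squared dual norm. The quadratic upper bound for the objective carries
    [L2] and not [L2 / 2], since it is drawn from convexity and the Lipschitz gradient alone; the
    step [1 / (2 L2)] is exactly the one that minimizes it. The step sizes [alpha] make the
    quadratic error of the mirror step one twelfth of the decrease of the gradient step. The
    relation [mu <= 2 L2] compares strong convexity with the upper bound along a coordinate axis at
    the minimizer. *)

Lemma cvg_sumr {R : realType} {T I : Type} {F : set_system T} {FF : Filter F}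
    (s : seq I) (u : I -> T -> R) (l : I -> R) :
  (forall i, u i x @[x --> F] --> l i) ->
  \sum_(i <- s) u i x @[x --> F] --> \sum_(i <- s) l i.
Proof.
move=> ul; elim: s => [|i s IH].
  by rewrite big_nil; under eq_fun do rewrite big_nil; exact: cvg_cst.
by rewrite big_cons; under eq_fun do rewrite big_cons; exact: cvgD.
Qed.

Section vectors.
Context {R : realType} {n : nat}.
Implicit Types x y z : 'rV[R]_n.

Lemma dotvC x y : dotv x y = dotv y x.
Proof. by apply: eq_bigr => i _; rewrite mulrC. Qed.

Lemma dotvDr x y z : dotv x (y + z) = dotv x y + dotv x z.
Proof. by rewrite -big_split; apply: eq_bigr => i _; rewrite mxE mulrDr. Qed.

Lemma dotvDl x y z : dotv (y + z) x = dotv y x + dotv z x.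
Proof. by rewrite dotvC dotvDr !(dotvC x). Qed.

Lemma dotvZr x a y : dotv x (a *: y) = a * dotv x y.
Proof. by rewrite mulr_sumr; apply: eq_bigr => i _; rewrite mxE mulrCA. Qed.

Lemma dotvZl x a y : dotv (a *: y) x = a * dotv y x.
Proof. by rewrite dotvC dotvZr dotvC. Qed.

Lemma dotvNr x y : dotv x (- y) = - dotv x y.
Proof. by rewrite -scaleN1r dotvZr mulN1r. Qed.

Lemma dotvNl x y : dotv (- y) x = - dotv y x.
Proof. by rewrite dotvC dotvNr dotvC. Qed.

Lemma dotvBr x y z : dotv x (y - z) = dotv x y - dotv x z.
Proof. by rewrite dotvDr dotvNr. Qed.

Lemma dotvBl x y z : dotv (y - z) x = dotv y x - dotv z x.
Proof. by rewrite dotvDl dotvNl. Qed.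

Lemma dotv_sqrD x y :
  dotv (x + y) (x + y) = dotv x x + 2 * dotv x y + dotv y y.
Proof. by rewrite dotvDr !dotvDl (dotvC y x); ring. Qed.

Lemma dotv0r x : dotv x 0 = 0.
Proof. by rewrite /dotv big1// => i _; rewrite mxE mulr0. Qed.

Lemma dotv0l x : dotv 0 x = 0.
Proof. by rewrite dotvC dotv0r. Qed.

Lemma dotv_ge0 x : 0 <= dotv x x.
Proof. by apply: sumr_ge0 => i _; rewrite -expr2 sqr_ge0. Qed.

Lemma dotv_delta x i : dotv x (delta_mx 0 i) = x 0 i.
Proof.
rewrite /dotv (bigD1 i)//= big1 => [|j ji]; rewrite mxE eqxx/=.
  by rewrite eqxx mulr1 addr0.
by rewrite (negbTE ji) mulr0.
Qed.

Lemma dotv_eq0 x : dotv x x = 0 -> x = 0.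
Proof.
move=> /eqP; rewrite psumr_eq0 => [|i _]; last by rewrite -expr2 sqr_ge0.
move=> /allP x0; apply/rowP => i; rewrite mxE.
have := x0 i; rewrite mem_index_enum => /(_ isT) /=.
by rewrite mulf_eq0 orbb => /eqP.
Qed.

Lemma dotv_young (c : R) x y : 0 < c ->
  dotv x y <= c / 2 * dotv x x + (2 * c)^-1 * dotv y y.
Proof.
move=> c0; have := dotv_ge0 (c *: x - y).
rewrite !(dotvBl, dotvBr, dotvZl, dotvZr) (dotvC y x) => h.
rewrite -subr_ge0; have c0' : c != 0 by rewrite gt_eqF.
suff -> : c / 2 * dotv x x + (2 * c)^-1 * dotv y y - dotv x y = (2 * c)^-1 *
   (c * (c * dotv x x - dotv x y) - (c * dotv x y - dotv y y)).
  apply: mulr_ge0 h; by rewrite invr_ge0 mulr_ge0// ltW.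
by field.
Qed.

Lemma CauchySchwarz_dotv x y : dotv x y ^+ 2 <= dotv x x * dotv y y.
Proof.
have [y0|y0] := eqVneq (dotv y y) 0.
  by rewrite (dotv_eq0 y0) !dotv0r mulr0 expr0n.
have yp : 0 < dotv y y by rewrite lt_def y0 dotv_ge0.
have := dotv_ge0 (dotv y y *: x - dotv x y *: y).
rewrite !(dotvBl, dotvBr, dotvZl, dotvZr) (dotvC y x) => h.
rewrite -subr_ge0 -(pmulr_rge0 _ yp); apply: le_trans h _.
by rewrite le_eqVlt; apply/orP; left; apply/eqP; ring.
Qed.

Lemma lnorm_ge0 r x : 0 <= lnorm r x.
Proof. exact: powR_ge0. Qed.

Lemma lnorm2_sqr x : lnorm 2 x ^+ 2 = dotv x x.
Proof.
have e : \sum_i `|x 0 i| `^ 2 = dotv x x.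
  apply: eq_bigr => i _; rewrite -[2]/(2%:R) powR_mulrn//.
  by rewrite -expr2 real_normK// num_real.
rewrite /lnorm e -powR_mulrn ?powR_ge0// -powRrM mulVf//.
by rewrite powRr1// dotv_ge0.
Qed.

Lemma lnorm2E x : lnorm 2 x = Num.sqrt (dotv x x).
Proof. by rewrite -lnorm2_sqr sqrtr_sqr ger0_norm// lnorm_ge0. Qed.

Lemma sphereE x : sphere n x <-> dotv x x = 1.
Proof.
rewrite /sphere/= lnorm2E; split=> [h|->]; last by rewrite sqrtr1.
by rewrite -(sqr_sqrtr (dotv_ge0 x)) h expr1n.
Qed.

Lemma continuous_dotvl x : continuous (dotv x).
Proof.
move=> y; apply: (@cvg_sumr _ _ _ (nbhs y)) => i; apply: cvgM; first exact: cvg_cst.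
exact: coord_continuous.
Qed.

End vectors.

Section borel.
Context {R : realType} {n : nat}.

Lemma measurable_coord i : measurable_fun setT (fun x : 'rV[R]_n => x 0 i).
Proof.
apply: (measurability (@RGenOpens.G R)); first exact: RGenOpens.measurableE.
move=> _ [_ [a [b ->]] <-]; rewrite setTI; apply: sub_sigma_algebra.
rewrite /mx_open/=; apply: open_comp; last exact: interval_open.
by move=> x _; exact: coord_continuous.
Qed.

Lemma continuous_measurable_rV (f : 'rV[R]_n -> R) :
  continuous f -> measurable_fun setT f.
Proof.
move=> cf; apply: (measurability (@RGenOpens.G R)); first exact: RGenOpens.measurableE.
move=> _ [_ [a [b ->]] <-]; rewrite setTI; apply: sub_sigma_algebra.
rewrite /mx_open/=; apply: open_comp; last exact: interval_open.
by move=> x _; exact: cf.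
Qed.

Let box (q : 'rV[rat]_n) (k : nat) : set 'rV[R]_n :=
  [set v | forall i, `|v 0 i - ratr (q 0 i)| < k.+1%:R^-1].

(** An open set is the countable union of the rational boxes that it contains, and the preimage of a
    box is a finite intersection of preimages under the coordinates. So coordinatewise measurability
    suffices. *)
Lemma measurable_rV d (T : measurableType d) (f : T -> 'rV[R]_n) :
  (forall i, measurable_fun setT (fun t => f t 0 i)) -> measurable_fun setT f.
Proof.
move=> mf; apply: (@measurability _ _ _ _ _ _ (@mx_open R 1 n)) => //.
move=> _ [U oU <-]; rewrite setTI.
have mbox q k : measurable (f @^-1` box q k).
  have -> : f @^-1` box q k =
      \bigcap_(i in [set: 'I_n]) ((fun t => f t 0 i) @^-1`
         [set r | `|r - ratr (q 0 i)| < k.+1%:R^-1]).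
    by apply/seteqP; split=> t h i //; [move=> _|]; exact: h.
  apply: fin_bigcap_measurable => [|i _]; first exact: finite_finset.
  rewrite -[X in measurable X]setTI; apply: mf => //.
  rewrite (_ : [set r | _] = `]ratr (q 0 i) - k.+1%:R^-1, ratr (q 0 i) + k.+1%:R^-1[%classic).
    exact: measurable_itv.
  by apply/seteqP; split=> r /=; rewrite in_itv/= ltr_distl.
have -> : f @^-1` U = \bigcup_(qk in [set qk : 'rV[rat]_n * nat | box qk.1 qk.2 `<=` U])
    (f @^-1` box qk.1 qk.2).
  apply/seteqP; split=> [t Ut|t [qk/= qkU]]; last exact: qkU.
  have /nbhs_ballP[e /= e0 eU] : nbhs (f t) U.
    by move: oU; rewrite /mx_open/= openE => /(_ _ Ut).
  have [k ke] : exists k, k.+1%:R^-1 < e / 2.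
    by have [k _ /(_ k (leqnn k)) ke] := near_infty_natSinv_lt (PosNum (divr_gt0 e0 (ltr0Sn R 1)));
      exists k.
  have hq i : exists q : rat, `|f t 0 i - ratr q| < k.+1%:R^-1.
    have [|q] := @rat_in_itvoo R (f t 0 i - k.+1%:R^-1) (f t 0 i + k.+1%:R^-1).
      by rewrite ltrBlDr -addrA ltrDl addr_gt0// invr_gt0.
    rewrite in_itv/= => /andP[h1 h2]; exists q.
    by rewrite distrC ltr_distl h1 h2.
  pose q := \row_i (projT1 (cid (hq i))).
  have tq : box q k (f t) by move=> i; rewrite mxE; case: cid.
  exists (q, k) => //= v vq; apply: eU; rewrite /ball/=; split=> //.
  move=> i j; rewrite ord1; have := vq j; have := tq j.
  rewrite /ball/= => h1 h2.
  have -> : f t 0 j - v 0 j = f t 0 j - ratr (q 0 j) - (v 0 j - ratr (q 0 j)).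
    by ring.
  apply: le_lt_trans (ler_normB _ _) _.
  by rewrite [e]splitr; apply: ltrD; exact: lt_trans ke.
rewrite bigcup_mkcond; apply: countable_bigcupT_measurable => // qk.
by case: ifPn.
Qed.

Context {d : measure_display} {T : measurableType d}.
Implicit Types f g : T -> 'rV[R]_n.

Lemma measurable_coordT f i : measurable_fun setT f ->
  measurable_fun setT (fun t => f t 0 i).
Proof. by move=> mf; exact: measurableT_comp (measurable_coord i) mf. Qed.

Lemma measurable_dotv f g : measurable_fun setT f -> measurable_fun setT g ->
  measurable_fun setT (fun t => dotv (f t) (g t)).
Proof.
move=> mf mg; rewrite /dotv; apply: measurable_sum => i.
by apply: measurable_funM; exact: measurable_coordT.
Qed.

Lemma measurable_addv f g : measurable_fun setT f -> measurable_fun setT g ->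
  measurable_fun setT (fun t => f t + g t).
Proof.
move=> mf mg; apply: measurable_rV => i; under eq_fun do rewrite mxE.
by apply: measurable_funD; exact: measurable_coordT.
Qed.

Lemma measurable_scalev (a : T -> R) f : measurable_fun setT a ->
  measurable_fun setT f -> measurable_fun setT (fun t => a t *: f t).
Proof.
move=> mf mg; apply: measurable_rV => i; under eq_fun do rewrite mxE.
by apply: measurable_funM => //; exact: measurable_coordT.
Qed.

Lemma measurable_oppv f : measurable_fun setT f ->
  measurable_fun setT (fun t => - f t).
Proof.
move=> mf; under eq_fun do rewrite -scaleN1r.
by apply: measurable_scalev => //; exact: measurable_cst.
Qed.

Lemma measurable_subv f g : measurable_fun setT f -> measurable_fun setT g ->
  measurable_fun setT (fun t => f t - g t).
Proof. by move=> mf mg; apply: measurable_addv => //; exact: measurable_oppv. Qed.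

End borel.

(** * Independent blocks of draws *)

Section independent_blocks.
Context {R : realType} {d : measure_display} {T : measurableType d}.
Variable Pr : probability T R.
Context {I : choiceType} (C : I -> set (set T)).
Hypothesis mC : forall i, C i `<=` measurable.
Hypothesis CT : forall i, C i setT.
Hypothesis CI : forall i, setI_closed (C i).
Hypothesis indC : mutually_independent Pr C.
Implicit Types (S : set I) (s : seq I).

(** The finite intersections of events attached to indices of [S]: a pi-system that generates the
    sigma-algebra of the whole block [S]. *)
Definition cylinders S : set (set T) :=
  [set A | exists s (B : I -> set T), [/\ uniq s,
     forall i, i \in s -> S i /\ C i (B i) &
     A = \big[setI/setT]_(i <- s) B i]].

Lemma measurable_cylinders S : cylinders S `<=` measurable.
Proof.
move=> _ [s [B [_ sB ->]]]; rewrite big_seq.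
elim/big_ind : _ => // [A1 A2|i /sB[_ /mC//]]; exact: measurableI.
Qed.

Lemma cylindersT S : cylinders S setT.
Proof. by exists [::], (fun=> setT); split => //; rewrite big_nil. Qed.

Let big_subseq s s' (B : I -> set T) : uniq s -> uniq s' -> {subset s <= s'} ->
  \big[setI/setT]_(i <- s') (if i \in s then B i else setT) =
  \big[setI/setT]_(i <- s) B i.
Proof.
move=> us us' ss'; rewrite -(big_mkcond (mem s)) -big_filter.
apply: perm_big; apply: uniq_perm => //; first exact: filter_uniq.
by move=> i; rewrite mem_filter; apply/andP/idP => [[]//|si]; split => //; exact: ss'.
Qed.

Lemma cylinders_setI S : setI_closed (cylinders S).
Proof.
move=> _ _ [s1 [B1 [u1 sB1 ->]]] [s2 [B2 [u2 sB2 ->]]].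
pose s := undup (s1 ++ s2).
(* Both families are padded with [setT], so that they run over the common list of indices. *)
exists s, (fun i => (if i \in s1 then B1 i else setT)
                 `&` (if i \in s2 then B2 i else setT)); split.
- exact: undup_uniq.
- move=> i; rewrite mem_undup mem_cat => /orP si; split.
    by case: si => [/sB1[]|/sB2[]].
  apply: CI.
    by case: ifPn => // /sB1[].
  by case: ifPn => // /sB2[].
- rewrite big_split/=; congr (_ `&` _); symmetry.
    by apply: big_subseq; rewrite ?undup_uniq// => i i1; rewrite mem_undup mem_cat i1.
  by apply: big_subseq; rewrite ?undup_uniq// => i i2; rewrite mem_undup mem_cat i2 orbT.
Qed.

(** The two families have disjoint indices and are glued into a single family [B]. Mutual
    independence is then used on each list and on their concatenation. *)
Lemma cylinders_indep S1 S2 A1 A2 : S1 `&` S2 `<=` set0 ->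
  cylinders S1 A1 -> cylinders S2 A2 -> Pr (A1 `&` A2) = (Pr A1 * Pr A2)%E.
Proof.
move=> S12 [s1 [B1 [u1 sB1 ->]]] [s2 [B2 [u2 sB2 ->]]].
have dis i : i \in s1 -> i \notin s2.
  move=> /sB1[Si _]; apply/negP => /sB2[Si2 _]; exact: (S12 i).
pose B i := if i \in s1 then B1 i else B2 i.
have e1 : \big[setI/setT]_(i <- s1) B1 i = \big[setI/setT]_(i <- s1) B i.
  by apply: eq_big_seq => i si; rewrite /B si.
have e2 : \big[setI/setT]_(i <- s2) B2 i = \big[setI/setT]_(i <- s2) B i.
  apply: eq_big_seq => i si; rewrite /B ifF//; apply/negP => /dis.
  by rewrite si.
have CB i : i \in s1 ++ s2 -> C i (B i).
  rewrite mem_cat /B => /orP[i1|i2]; first by rewrite i1; have [] := sB1 _ i1.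
  case: ifPn => i1; first by have [] := sB1 _ i1.
  by have [] := sB2 _ i2.
rewrite e1 e2 -big_cat/= !indC//= ?big_cat//.
- by move=> i i2; apply: CB; rewrite mem_cat i2 orbT.
- by move=> i i1; apply: CB; rewrite mem_cat i1.
- rewrite cat_uniq u1 u2/= andbT; apply/hasPn => i i2; apply/negP => /dis.
  by rewrite i2.
Qed.

(** For a fixed event [A], the measures [Pr (A & B)] and [Pr A * Pr B] of [B] agree as soon as they
    agree on a pi-system. This uniqueness is applied twice: it extends the product formula from
    cylinders to the generated sigma-algebra in one argument, then in the other. *)
Lemma block_indep S1 S2 A1 A2 : S1 `&` S2 `<=` set0 ->
  <<s cylinders S1 >> A1 -> <<s cylinders S2 >> A2 ->
  Pr (A1 `&` A2) = (Pr A1 * Pr A2)%E.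
Proof.
move=> S12 sA1 sA2.
have sub S A : <<s cylinders S >> A -> measurable A.
  apply: smallest_sub; first exact: sigma_algebra_measurable.
  exact: measurable_cylinders.
have key (A : set T) (mA : measurable A) S :
    (forall B, cylinders S B -> Pr (A `&` B) = (Pr A * Pr B)%E) ->
    forall B, <<s cylinders S >> B -> Pr (A `&` B) = (Pr A * Pr B)%E.
  move=> h B sB.
  have PA0 : 0 <= fine (Pr A) by rewrite fine_ge0.
  pose m2 : {measure set T -> \bar R} := mscale (NngNum PA0) Pr.
  have E2 D : m2 D = (Pr A * Pr D)%E.
    by rewrite /m2/= /mscale/= fineK// fin_num_measure.
  suff E : mrestr Pr mA B = m2 B by rewrite -E2 -E setIC.
  apply: (@g_sigma_algebra_measure_unique _ R T (cylinders S)
    (measurable_cylinders (S := S)) (fun=> setT) (fun=> cylindersT S) _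
    (mrestr Pr mA) m2 (@cylinders_setI S) _ _ B sB).
  - by rewrite bigcup_const.
  - by move=> D SD; rewrite E2 -h// setIC.
  - move=> _; apply: (@le_lt_trans _ _ 1%E); last exact: ltry.
    by rewrite /= /mrestr setTI; exact: probability_le1.
apply: (key _ (sub _ _ sA1) _ _ _ sA2) => B cB.
rewrite setIC muleC.
apply: (key _ (measurable_cylinders cB) _ _ _ sA1) => D cD.
by rewrite setIC muleC (cylinders_indep S12).
Qed.

Lemma measurable_block d' (Y : measurableType d') S i (f : T -> Y) : S i ->
  (forall A, measurable A -> C i (f @^-1` A)) ->
  measurable_fun setT (f : g_sigma_algebraType (cylinders S) -> Y).
Proof.
move=> Si fC _ A mA; rewrite setTI; apply: sub_sigma_algebra.
exists [:: i], (fun=> f @^-1` A); split => //; last by rewrite big_seq1.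
by move=> j; rewrite inE => /eqP ->; split => //; exact: fC.
Qed.

Let sub S : (<<s cylinders S >> : set (set T)) `<=` measurable.
Proof.
apply: smallest_sub; first exact: sigma_algebra_measurable.
exact: measurable_cylinders.
Qed.

Let mid S : measurable_fun setT (idfun : T -> g_sigma_algebraType (cylinders S)).
Proof. by move=> _ A mA; rewrite setTI; exact: sub mA. Qed.

(* Two disjoint blocks of draws may be sampled from independent copies of the *)
(* probability space.                                                         *)
Lemma block_fubini S1 S2 (H : T * T -> \bar R) : S1 `&` S2 `<=` set0 ->
  @measurable_fun _ _ (g_sigma_algebraType (cylinders S1) *
    g_sigma_algebraType (cylinders S2))%type (\bar R) setT H ->
  (forall w, (0 <= H w)%E) ->
  (\int[Pr]_w H (w, w) = \int[Pr]_w \int[Pr]_w' H (w, w'))%E.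
Proof.
move=> S12 mH H0.
pose T1 := g_sigma_algebraType (cylinders S1).
pose T2 := g_sigma_algebraType (cylinders S2).
pose f1 := (@isMeasurableFun.Build _ _ _ _ _ (mid (S := S1))).
pose g1 : {mfun T >-> T1} := HB.pack (idfun : T -> T1) f1.
pose f2 := (@isMeasurableFun.Build _ _ _ _ _ (mid (S := S2))).
pose g2 : {mfun T >-> T2} := HB.pack (idfun : T -> T2) f2.
pose P1 := distribution Pr g1.
pose P2 := distribution Pr g2.
have mdiag : measurable_fun setT (fun w : T => (w : T1, w : T2)).
  by apply/measurable_fun_pairP; split; exact: mid.
pose f3 := (@isMeasurableFun.Build _ _ _ _ _ mdiag).
pose g3 : {mfun T >-> (T1 * T2)%type} := HB.pack (fun w : T => (w : T1, w : T2)) f3.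
transitivity (\int[distribution Pr g3]_w H w)%E.
  by rewrite ge0_integral_distribution.
(* The law of the diagonal map equals the product of its marginals on rectangles, by independence of
   the blocks, hence everywhere. *)
transitivity (\int[P1 \x P2]_w H w)%E.
  apply: eq_measure_integral => A mA _; apply/esym.
  apply: product_measure_unique => // B1 B2 mB1 mB2.
  exact: (block_indep S12).
rewrite fubini_tonelli1// ge0_integral_distribution//=; last 2 first.
- exact: measurable_fun_fubini_tonelli_F.
- by move=> y; apply: integral_ge0.
apply: eq_integral => w _; rewrite /fubini_F ge0_integral_distribution//.
exact: (measurableT_comp mH (measurable_pair1 _)).
Qed.

End independent_blocks.

(** * Smoothness of the squared dual norm *)

Section signed_power.
Context {R : realType}.
Implicit Types (r t : R).

(** The odd power function. It is the derivative of an absolute power up to a factor, and it is the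
    coordinate map of the duality map below. *)
Definition sgnpow r t : R := Num.sg t * `|t| `^ r.

Lemma sgnpow0 r : sgnpow r 0 = 0.
Proof. by rewrite /sgnpow sgr0 mul0r. Qed.

Lemma norm_sgnpow r t : r != 0 -> `|sgnpow r t| = `|t| `^ r.
Proof.
move=> r0; have [->|t0] := eqVneq t 0.
  by rewrite sgnpow0 normr0 powR0.
by rewrite /sgnpow normrM normr_sg t0 mul1r ger0_norm ?powR_ge0.
Qed.

Lemma mul_sgnpow r t : 1 < r -> sgnpow (r - 1) t * t = `|t| `^ r.
Proof.
move=> r1; rewrite /sgnpow mulrAC -normrEsg mulr_powRB1//; exact: lt_trans r1.
Qed.

Lemma mul_normpow r t : 1 < r -> `|t| `^ (r - 1) * t = sgnpow r t.
Proof.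
move=> r1; rewrite {2}[t]numEsg mulrCA [X in _ * X]mulrC mulr_powRB1//.
exact: lt_trans r1.
Qed.

Lemma continuous_normpow r : 0 < r -> continuous (fun t => `|t| `^ r).
Proof.
move=> r0 t; have [->|t0] := eqVneq t 0.
  rewrite /continuous_at normr0 powR0 ?gt_eqF//.
  apply/cvgrPdist_lt => e e0; near=> u.
  rewrite sub0r normrN ger0_norm ?powR_ge0//.
  (* Writing [e] as [(e ^ (1 / r)) ^ r] reduces the claim to [u] being closer to 0 than
     [e ^ (1 / r)]. *)
  rewrite -[e](@powRr1 _ e) ?ltW// -(@mulVf _ r) ?gt_eqF// powRrM.
  apply: gt0_ltr_powR => //; rewrite ?nnegrE ?powR_ge0//.
  near: u; apply: (@nbhs0_lt R R); exact: powR_gt0.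
apply: (@cvg_comp _ _ _ (fun t : R => `|t|) (@powR R ^~ r) (nbhs t) (nbhs `|t|)).
  exact: (@norm_continuous R R).
suff : {for `|t|, continuous (@powR R ^~ r)} by [].
apply/differentiable_continuous/derivable1_diffP/derivable_powR.
by rewrite in_itv/= andbT normr_gt0.
Unshelve. all: by end_near. Qed.

Lemma continuous_sgnpow r : 0 < r -> continuous (sgnpow r).
Proof.
move=> r0 t; have [->|t0] := eqVneq t 0.
  rewrite /continuous_at sgnpow0; apply/cvgr0Pnorm_lt => e e0.
  have := continuous_normpow r0 (x := 0).
  rewrite /continuous_at normr0 powR0 ?gt_eqF// => /cvgr0Pnorm_lt/(_ _ e0).
  apply: filterS => u; rewrite norm_sgnpow ?gt_eqF//.
  by rewrite (ger0_norm (powR_ge0 _ _)).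
apply: (@cvg_trans _ ((Num.sg t * `|u| `^ r) @[u --> t])); last first.
  exact: (@cvgM _ _ (nbhs t) _ (fun=> Num.sg t) (fun u => `|u| `^ r) _ _
    (cvg_cst _) (@continuous_normpow r r0 t)).
apply: near_eq_cvg.
have [tp|tn] := ltP 0 t.
  near=> u; rewrite /sgnpow; congr (_ * _).
  by rewrite (gtr0_sg tp) gtr0_sg//; near: u; exact: lt_nbhsr.
have {}tn : t < 0 by rewrite lt_neqAle t0.
near=> u; rewrite /sgnpow; congr (_ * _).
by rewrite (ltr0_sg tn) ltr0_sg//; near: u; exact: lt_nbhsl.
Unshelve. all: by end_near. Qed.

(** Away from 0 the function coincides locally with a power of [t] or of [- t]. At 0 the
    factorization of [|u| ^ r] as [sgnpow (r - 1) u * u] is a continuous slope in the sense of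
    Caratheodory. *)
Lemma is_derive_normpow r t : 1 < r ->
  is_derive t 1 (fun u => `|u| `^ r) (r * sgnpow (r - 1) t).
Proof.
move=> r1; have r0 : 0 < r by exact: lt_trans r1.
have [->|t0] := eqVneq t 0.
  rewrite sgnpow0 mulr0; apply/is_derive1_caratheodory.
  exists (sgnpow (r - 1)); split.
  - by move=> z; rewrite normr0 powR0 ?gt_eqF// !subr0 mul_sgnpow.
  - by apply: continuous_sgnpow; rewrite subr_gt0.
  - exact: sgnpow0.
have [tp|tn] := ltP 0 t.
  rewrite /sgnpow gtr0_sg// mul1r gtr0_norm//.
  apply: (@near_eq_is_derive _ _ _ (@powR R ^~ r)).
    by near=> u; rewrite gtr0_norm//; near: u; exact: lt_nbhsr.
  exact: is_derive1_powR.
have {}tn : t < 0 by rewrite lt_neqAle t0.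
rewrite /sgnpow ltr0_sg// ltr0_norm//.
have -> : r * (-1 * (- t) `^ (r - 1)) = r * (- t) `^ (r - 1) * -1.
  by rewrite mulrCA mulrC.
apply: (@near_eq_is_derive _ _ _ ((@powR R ^~ r) \o -%R)).
  by near=> u; rewrite /= ltr0_norm//; near: u; exact: lt_nbhsl.
apply: is_derive1_comp.
by apply: is_derive1_powR; rewrite oppr_gt0.
Unshelve. all: by end_near. Qed.

Lemma is_derive_sgnpow r t : 1 < r ->
  is_derive t 1 (sgnpow r) (r * `|t| `^ (r - 1)).
Proof.
move=> r1; have r0 : 0 < r by exact: lt_trans r1.
have [->|t0] := eqVneq t 0.
  rewrite normr0 powR0 ?subr_eq0 ?gt_eqF// mulr0; apply/is_derive1_caratheodory.
  exists (fun u => `|u| `^ (r - 1)); split.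
  - by move=> z; rewrite sgnpow0 !subr0 mul_normpow.
  - by apply: continuous_normpow; rewrite subr_gt0.
  - by rewrite normr0 powR0// subr_eq0 gt_eqF.
have [tp|tn] := ltP 0 t.
  rewrite gtr0_norm//.
  apply: (@near_eq_is_derive _ _ _ (@powR R ^~ r)).
    near=> u; have u0 : 0 < u by near: u; exact: lt_nbhsr.
    by rewrite /sgnpow gtr0_sg ?mul1r ?gtr0_norm.
  exact: is_derive1_powR.
have {}tn : t < 0 by rewrite lt_neqAle t0.
rewrite ltr0_norm//.
apply: (@near_eq_is_derive _ _ _ (- ((@powR R ^~ r) \o -%R))).
  near=> u; rewrite /sgnpow fctE/=.
  have u0 : u < 0 by near: u; exact: lt_nbhsl.
  by rewrite ltr0_sg ?mulN1r ?ltr0_norm.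
have -> : r * (- t) `^ (r - 1) = - (r * (- t) `^ (r - 1) * -1) by rewrite mulrN1 opprK.
apply: is_deriveN; apply: is_derive1_comp.
by apply: is_derive1_powR; rewrite oppr_gt0.
Unshelve. all: by end_near. Qed.

End signed_power.

Lemma powR_div {R : realType} (t u v : R) : 0 <= u -> 0 < v ->
  (u / v) `^ t = u `^ t / v `^ t.
Proof.
move=> u0 v0; have v0' : 0 <= v by exact: ltW.
have vi0 : 0 <= v^-1 by rewrite invr_ge0.
by rewrite (powRM _ u0 vi0) -[in LHS](powR_inv1 v0') -powRrM mulN1r powRN.
Qed.

Section hoelder.
Context {R : realType} {n : nat}.

(** Young's inequality is summed over the terms normalized by the two norms; the cases of a
    vanishing norm are settled before dividing. *)
Lemma hoelder_sum (a b : 'I_n -> R) r s : (forall i, 0 <= a i) ->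
  (forall i, 0 <= b i) -> 0 < r -> 0 < s -> r^-1 + s^-1 = 1 ->
  \sum_i a i * b i <=
  (\sum_i a i `^ r) `^ r^-1 * (\sum_i b i `^ s) `^ s^-1.
Proof.
move=> a0 b0 r0 s0 rs.
set A := \sum_i a i `^ r; set B := \sum_i b i `^ s.
have A0 : 0 <= A by apply: sumr_ge0 => i _; exact: powR_ge0.
have B0 : 0 <= B by apply: sumr_ge0 => i _; exact: powR_ge0.
have zero (c : 'I_n -> R) t : (forall i, 0 <= c i) ->
    \sum_i c i `^ t = 0 -> forall i, c i = 0.
  move=> c0 /eqP; rewrite psumr_eq0 => [|i _]; last exact: powR_ge0.
  move=> /allP h i; apply: (@powR_eq0_eq0 _ _ t); apply/eqP.
  by have := h i; rewrite mem_index_enum; apply.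
have [A00|An0] := eqVneq A 0.
  rewrite big1 ?mulr_ge0 ?powR_ge0// => i _.
  by rewrite (zero _ _ a0 A00) mul0r.
have [B00|Bn0] := eqVneq B 0.
  rewrite big1 ?mulr_ge0 ?powR_ge0// => i _.
  by rewrite (zero _ _ b0 B00) mulr0.
have Ap : 0 < A by rewrite lt_def An0.
have Bp : 0 < B by rewrite lt_def Bn0.
set al := A `^ r^-1; set be := B `^ s^-1.
have alp : 0 < al by rewrite powR_gt0.
have bep : 0 < be by rewrite powR_gt0.
have alr : al `^ r = A by rewrite -powRrM mulVf ?gt_eqF// powRr1.
have bes : be `^ s = B by rewrite -powRrM mulVf ?gt_eqF// powRr1.
move: (al) (be) alp bep alr bes => {}al {}be alp bep alr bes.
suff : \sum_i (a i / al) * (b i / be) <= 1.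
  have -> : \sum_i (a i / al) * (b i / be) = (\sum_i a i * b i) / (al * be).
    by rewrite mulr_suml; apply: eq_bigr => i _; rewrite mulf_div.
  by rewrite (ler_pdivrMr _ _ (mulr_gt0 alp bep)) mul1r.
apply: (@le_trans _ _ (\sum_i (a i `^ r / A / r + b i `^ s / B / s))).
  apply: ler_sum => i _.
  apply: le_trans (conjugate_powR (divr_ge0 (a0 i) (ltW alp))
    (divr_ge0 (b0 i) (ltW bep)) r0 s0 rs) _.
  by rewrite (powR_div _ (a0 i) alp) (powR_div _ (b0 i) bep) alr bes.
rewrite big_split/= -!mulr_suml -/A -/B !divff//; lra.
Qed.

End hoelder.

(** * The duality map of an [l_r] norm *)

Section duality_map.
Context {R : realType} {n : nat}.
Implicit Types (x y : 'rV[R]_n) (r s : R).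

(* The gradient of x |-> |x|_r^2 / 2. *)
Definition dmap r x : 'rV[R]_n :=
  \row_i (lnorm r x `^ (2 - r) * sgnpow (r - 1) (x 0 i)).

Lemma lnorm_powR r x : r != 0 -> lnorm r x `^ r = \sum_i `|x 0 i| `^ r.
Proof.
move=> r0; rewrite -powRrM mulVf// powRr1//.
by apply: sumr_ge0 => i _; exact: powR_ge0.
Qed.

Lemma lnorm_eq0 r x : lnorm r x = 0 -> x = 0.
Proof.
move=> /powR_eq0_eq0/eqP; rewrite psumr_eq0 => [|i _]; last exact: powR_ge0.
move=> /allP h; apply/rowP => i; rewrite mxE.
by have := h i; rewrite mem_index_enum => /(_ isT)/eqP/powR_eq0_eq0/normr0_eq0.
Qed.

Lemma lnorm0 r : r != 0 -> lnorm r (0 : 'rV[R]_n) = 0.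
Proof.
move=> r0; rewrite /lnorm big1 ?powR0 ?invr_neq0// => i _.
by rewrite mxE normr0 powR0.
Qed.

Lemma lnorm_gt0 r x : x != 0 -> 0 < lnorm r x.
Proof.
by move=> x0; rewrite lt_def lnorm_ge0 andbT; apply: contra_neq x0 => /lnorm_eq0.
Qed.

Lemma lnormZ r a x : r != 0 -> lnorm r (a *: x) = `|a| * lnorm r x.
Proof.
move=> r0; rewrite /lnorm.
under eq_bigr do rewrite mxE normrM powRM//.
rewrite -mulr_sumr powRM ?powR_ge0//; last by apply: sumr_ge0 => i _; exact: powR_ge0.
by rewrite -powRrM mulfV// powRr1.
Qed.

Lemma le_coord_lnorm r x i : 0 < r -> `|x 0 i| <= lnorm r x.
Proof.
move=> r0; rewrite -[leLHS](@powRr1 _ `|x 0 i|)// -(@mulfV _ r) ?gt_eqF// powRrM.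
apply: ge0_ler_powR; rewrite ?invr_ge0 ?nnegrE ?powR_ge0 ?(ltW r0)//.
  by apply: sumr_ge0 => j _; exact: powR_ge0.
rewrite (bigD1 i)//= lerDl; apply: sumr_ge0 => j _; exact: powR_ge0.
Qed.

Lemma dmap0 r : dmap r 0 = 0.
Proof. by apply/rowP => i; rewrite !mxE sgnpow0 mulr0. Qed.

Lemma dmapZ r a x : 1 < r -> 0 < a -> dmap r (a *: x) = a *: dmap r x.
Proof.
move=> r1 a0; have r0 : r != 0 by rewrite gt_eqF// (lt_trans _ r1).
apply/rowP => i; rewrite !mxE lnormZ// gtr0_norm// powRM ?lnorm_ge0 ?ltW//.
rewrite /sgnpow sgrM gtr0_sg// mul1r normrM powRM// gtr0_norm//.
have e : a `^ (2 - r) * a `^ (r - 1) = a.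
  rewrite -powRD; last by rewrite (gt_eqF a0) implybT.
  by rewrite addrA subrK (_ : 2 - 1 = 1) ?powRr1 ?ltW//; ring.
rewrite -[in RHS]e; move: (a `^ _) (a `^ _) (lnorm _ _ `^ _) (`|_| `^ _) => *.
by ring.
Qed.

Lemma dotv_dmap r x : 1 < r -> dotv (dmap r x) x = lnorm r x ^+ 2.
Proof.
move=> r1; have r0 : r != 0 by rewrite gt_eqF// (lt_trans _ r1).
have [->|x0] := eqVneq x 0; first by rewrite dotv0r lnorm0// expr0n.
rewrite /dotv; under eq_bigr do rewrite mxE -mulrA mul_sgnpow//.
rewrite -mulr_sumr -lnorm_powR// -powRD; last by rewrite (gt_eqF (lnorm_gt0 r x0)) implybT.
by rewrite subrK -powR_mulrn// lnorm_ge0.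
Qed.

Lemma continuous_lnorm r : 0 < r -> continuous (lnorm r : 'rV[R]_n -> R).
Proof.
move=> r0 x; rewrite /lnorm.
have S0 (y : 'rV[R]_n) : 0 <= \sum_i `|y 0 i| `^ r.
  by apply: sumr_ge0 => i _; exact: powR_ge0.
rewrite [X in continuous_at _ X](_ : _ = fun y : 'rV[R]_n =>
    (fun t => `|t| `^ r^-1) (\sum_i `|y 0 i| `^ r)); last first.
  by apply/funext => y; rewrite ger0_norm.
apply: (@cvg_comp _ _ _ (fun y : 'rV[R]_n => \sum_i `|y 0 i| `^ r)
  (fun t => `|t| `^ r^-1) (nbhs x) (nbhs (\sum_i `|x 0 i| `^ r))).
  apply: (@cvg_sumr _ _ _ (nbhs x)) => i.
  apply: (@cvg_comp _ _ _ (fun y : 'rV[R]_n => y 0 i)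
    (fun t => `|t| `^ r) (nbhs x) (nbhs (x 0 i))).
    exact: coord_continuous.
  exact: continuous_normpow.
by apply: continuous_normpow; rewrite invr_gt0.
Qed.

Section conjugate.
Variables r s : R.
Hypotheses (r1 : 1 < r) (s1 : 1 < s) (rs : (r - 1) * (s - 1) = 1).

Let r0 : r != 0. Proof. by rewrite gt_eqF// (lt_trans _ r1). Qed.
Let s0 : s != 0. Proof. by rewrite gt_eqF// (lt_trans _ s1). Qed.

(** Conjugacy of the exponents, in the form [(r - 1) * (s - 1) = 1], amounts to [(r - 1) * s = r]
    and to [(2 - r) * s + r = s]; these two identities collapse the powers. *)
Lemma lnorm_dmap x : lnorm s (dmap r x) = lnorm r x.
Proof.
have [->|x0] := eqVneq x 0; first by rewrite dmap0 !lnorm0.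
have Np := lnorm_gt0 r x0.
rewrite {1}/lnorm.
have -> : \sum_i `|dmap r x 0 i| `^ s = lnorm r x `^ s.
  rewrite (eq_bigr (fun i => lnorm r x `^ ((2 - r) * s) * `|x 0 i| `^ r)).
    rewrite -mulr_sumr -lnorm_powR// -powRD ?(gt_eqF Np) ?implybT//.
    by congr (_ `^ _); move: rs; nra.
  move=> i _; rewrite mxE normrM norm_sgnpow ?subr_eq0 ?gt_eqF//.
  rewrite (ger0_norm (powR_ge0 _ _)) powRM ?powR_ge0// -!powRrM.
  by congr (_ * _ `^ _); move: rs; nra.
by rewrite -powRrM mulfV// powRr1// ltW.
Qed.

(** The duality maps of conjugate exponents are inverse to each other. This is what makes the mirror
    step explicit. *)
Lemma dmapK x : dmap s (dmap r x) = x.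
Proof.
have [->|x0] := eqVneq x 0; first by rewrite !dmap0.
have Np := lnorm_gt0 r x0.
apply/rowP => i; rewrite mxE lnorm_dmap [in sgnpow _ _]mxE /sgnpow.
rewrite !sgrM (gtr0_sg (powR_gt0 _ Np)) mul1r.
have [->|xi0] := eqVneq (x 0 i) 0; first by rewrite !sgr0 !mul0r mulr0.
have -> : Num.sg (`|x 0 i| `^ (r - 1)) = 1 by apply: gtr0_sg; rewrite powR_gt0 ?normr_gt0.
rewrite mulr1 sgr_id normrM (ger0_norm (powR_ge0 _ _)) normrM normr_sg xi0 mul1r.
rewrite (ger0_norm (powR_ge0 _ _)) powRM ?powR_ge0//.
rewrite -(powRrM (lnorm r x)) -(powRrM `|x 0 i|) rs powRr1//.
rewrite mulrCA [X in _ * X]mulrA -powRD ?(gt_eqF Np) ?implybT//.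
have -> : 2 - s + (2 - r) * (s - 1) = 0 by move: rs; lra.
by rewrite powRr0 mul1r -numEsg.
Qed.

Lemma hoelder_lnorm x y : dotv x y <= lnorm r x * lnorm s y.
Proof.
apply: (@le_trans _ _ (\sum_i `|x 0 i| * `|y 0 i|)).
  by apply: ler_sum => i _; rewrite -normrM ler_norm.
apply: hoelder_sum => //; rewrite ?(lt_trans ltr01)//.
have -> : r^-1 + s^-1 = (r + s) / (r * s) by field; rewrite r0 s0.
rewrite (_ : r + s = r * s) ?divff ?mulf_neq0//; move: rs; nra.
Qed.

(** At the origin the factor [lnorm r x ^ (2 - r)] is of no help; there each coordinate is dominated
    by the dual norm of the image, which equals the norm of the argument. *)
Lemma continuous_dmap i : continuous (fun x : 'rV[R]_n => dmap r x 0 i).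
Proof.
have rp : 0 < r by exact: lt_trans r1.
have sp : 0 < s by exact: lt_trans s1.
move=> x; have [->|x0] := eqVneq x 0.
  rewrite /continuous_at dmap0 mxE; apply/(@cvgr0Pnorm_lt _ _ _ (nbhs (0 : 'rV[R]_n)) _) => e e0.
  have := @continuous_lnorm r rp 0.
  rewrite /continuous_at lnorm0//.
  move=> /(@cvgr0Pnorm_lt _ _ _ (nbhs (0 : 'rV[R]_n)) _)/(_ _ e0).
  apply: filterS => y; rewrite (ger0_norm (lnorm_ge0 _ _)); apply: le_lt_trans.
  by rewrite -lnorm_dmap; exact: le_coord_lnorm.
rewrite [X in continuous_at _ X](_ : _ = fun y : 'rV[R]_n =>
   lnorm r y `^ (2 - r) * sgnpow (r - 1) (y 0 i)); last first.
  by apply/funext => y; rewrite mxE.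
apply: (@cvgM _ _ (nbhs x) _ (fun y : 'rV[R]_n => lnorm r y `^ (2 - r))).
  apply: (@cvg_comp _ _ _ (lnorm r) (@powR R ^~ (2 - r)) (nbhs x) (nbhs (lnorm r x))).
    exact: continuous_lnorm.
  suff : {for lnorm r x, continuous (@powR R ^~ (2 - r))} by [].
  apply/differentiable_continuous/derivable1_diffP/derivable_powR.
  by rewrite in_itv/= andbT lnorm_gt0.
apply: (@cvg_comp _ _ _ (fun y : 'rV[R]_n => y 0 i)
    (sgnpow (r - 1)) (nbhs x) (nbhs (x 0 i))).
  exact: coord_continuous.
by apply: continuous_sgnpow; rewrite subr_gt0.
Qed.

End conjugate.

End duality_map.

Section smoothness.
Context {R : realType} {n : nat}.
Implicit Types (x y : 'rV[R]_n) (q : R).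

Lemma dmap2 x : dmap 2 x = x.
Proof.
apply/rowP => i; rewrite mxE subrr powRr0 mul1r /sgnpow (_ : 2 - 1 = 1).
  by rewrite powRr1// -numEsg.
by ring.
Qed.

Let is_derive_sum_fun (t : R) (h : 'I_n -> R -> R) (dh : 'I_n -> R) :
  (forall i, is_derive t 1 (h i) (dh i)) ->
  is_derive t 1 (fun u => \sum_i h i u) (\sum_i dh i).
Proof.
move=> H; have -> : (fun u => \sum_i h i u) = \sum_i h i.
  by apply/funext => u; rewrite fct_sumE.
exact: is_derive_sum.
Qed.

Let is_derive_line (a b t : R) : is_derive t 1 (fun u : R => a + u * b) b.
Proof.
apply/is_derive1_caratheodory; exists (fun=> b); split => //.
  by move=> z; ring.
exact: cvg_cst.
Qed.

Let is_derive_quadratic (a b t : R) :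
  is_derive t 1 (fun u : R => u * a + b * u ^+ 2) (a + 2 * b * t).
Proof.
apply/is_derive1_caratheodory; exists (fun z => a + b * (z + t)); split.
- by move=> z; ring.
- apply: cvgD; first exact: cvg_cst.
  apply: cvgM; first exact: cvg_cst.
  by apply: cvgD; [exact: cvg_id|exact: cvg_cst].
- by ring.
Qed.

(** The function [phi t = |x + t y|_q^2 / 2] has second derivative at most [(q - 1) |y|_q^2], and
    the claim is its Taylor bound at 1. The case [q = 2] is an identity and is treated apart because
    the Hoelder exponent [q / (q - 2)] degenerates. *)
Lemma lnorm_sqr_smooth q x y : 2 <= q ->
  lnorm q (x + y) ^+ 2 / 2 <=
  lnorm q x ^+ 2 / 2 + dotv (dmap q x) y + (q - 1) / 2 * lnorm q y ^+ 2.
Proof.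
move=> q2'; have [->|q2] : q = 2 \/ 2 < q.
    by move: q2'; rewrite le_eqVlt => /predU1P[<-|]; [left|right].
  have key (N : 'rV[R]_n -> R) : (forall z, N z ^+ 2 = dotv z z) ->
      N (x + y) ^+ 2 / 2 <= N x ^+ 2 / 2 + dotv x y + (2 - 1) / 2 * N y ^+ 2.
    by move=> NE; rewrite !NE dotv_sqrD; lra.
  by rewrite dmap2; exact: key lnorm2_sqr.
have q1 : 1 < q by lra.
have q0 : 0 < q by lra.
have [->|x0] := eqVneq x 0.
  rewrite add0r dmap0 dotv0l lnorm0 ?gt_eqF// expr0n mul0r !add0r mulrC.
  by rewrite ler_wpM2r ?sqr_ge0//; lra.
(* If [y] is collinear with [x], the line may meet the origin, where the power defining [phi] need
   not be differentiable; the inequality is then a scalar one. *)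
have [[c ->]|nc] := pselect (exists c, y = c *: x).
  rewrite dotvZr dotv_dmap// -{1}[x]scale1r -scalerDl !lnormZ ?gt_eqF//.
  rewrite !exprMn !real_normK ?num_real//.
  have := mulr_ge0 (sqr_ge0 c) (sqr_ge0 (lnorm q x)).
  move: (lnorm q x ^+ 2) => N cN.
  have : 0 <= (q - 2) * (c ^+ 2 * N) by rewrite mulr_ge0// subr_ge0 ltW.
  have -> : (1 + c) ^+ 2 * N = N + 2 * (c * N) + c ^+ 2 * N by ring.
  have -> : (q - 2) * (c ^+ 2 * N) = (q - 1) * (c ^+ 2 * N) - c ^+ 2 * N by ring.
  by rewrite (mulrAC (q - 1)); lra.
have u0 (t : R) : x + t *: y != 0.
  apply/eqP => h; have [t0|t0] := eqVneq t 0.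
    by move: h; rewrite t0 scale0r addr0 => /eqP; rewrite (negbTE x0).
  apply: nc; exists (- t^-1); apply: (@scalerI _ _ t) => //.
  rewrite scalerA mulrN divff// scaleN1r; apply/eqP; rewrite -addr_eq0 addrC.
  exact/eqP.
pose u t i := x 0 i + t * y 0 i.
have uE (t : R) i : (x + t *: y) 0 i = u t i by rewrite !mxE.
pose S t := \sum_i `|u t i| `^ q.
pose T t := \sum_i sgnpow (q - 1) (u t i) * y 0 i.
pose Q t := \sum_i `|u t i| `^ (q - 2) * y 0 i ^+ 2.
have SE t : S t = lnorm q (x + t *: y) `^ q.
  by rewrite lnorm_powR ?gt_eqF//; apply: eq_bigr => i _; rewrite uE.
have Sp t : 0 < S t by rewrite SE powR_gt0// lnorm_gt0.
have dS t : is_derive (t : R) 1 S (q * T t).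
  rewrite /T mulr_sumr; apply: is_derive_sum_fun => i.
  rewrite mulrA.
  apply: (@is_derive1_comp _ (fun v => `|v| `^ q) (fun t => u t i)).
    exact: is_derive_normpow.
  exact: is_derive_line.
have dT t : is_derive (t : R) 1 T ((q - 1) * Q t).
  rewrite /Q mulr_sumr; apply: is_derive_sum_fun => i.
  have -> : (q - 1) * (`|u t i| `^ (q - 2) * y 0 i ^+ 2) =
      y 0 i *: ((q - 1) * `|u t i| `^ (q - 1 - 1) * y 0 i).
    rewrite -addrA -opprD (_ : 1 + 1 = 2) // /GRing.scale/=; ring.
  rewrite (_ : (fun _ => _) = y 0 i \*: (sgnpow (q - 1) \o (fun t => u t i))); last first.
    by apply/funext => v; rewrite /= mulrC.
  apply: is_deriveZ.
  apply: (@is_derive1_comp _ (sgnpow (q - 1)) (fun t => u t i)).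
    by apply: is_derive_sgnpow; lra.
  exact: is_derive_line.
pose phi t := S t `^ (2 / q) / 2.
pose dphi t := S t `^ (2 / q - 1) * T t.
have dphiE t : is_derive (t : R) 1 phi (dphi t).
  rewrite /phi /dphi.
  have e (a c : R) : 2^-1 *: (2 / q * a * (q * c)) = a * c.
    by rewrite /GRing.scale/=; field; rewrite (gt_eqF q0).
  rewrite -[X in is_derive _ _ _ X]e.
  rewrite (_ : (fun _ => _) = 2^-1 \*: ((@powR R ^~ (2 / q)) \o S)); last first.
    by apply/funext => v; rewrite /= mulrC.
  by apply: is_deriveZ; apply: is_derive1_comp; exact: is_derive1_powR.
pose ddphi t := S t `^ (2 / q - 1) * ((q - 1) * Q t) +
    T t * ((2 / q - 1) * S t `^ (2 / q - 1 - 1) * (q * T t)).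
have ddphiE t : is_derive (t : R) 1 dphi (ddphi t).
  apply: (@is_deriveM _ _ ((@powR R ^~ (2 / q - 1)) \o S) T).
  by apply: is_derive1_comp; exact: is_derive1_powR.
pose B := lnorm q y ^+ 2.
(* Hoelder with the conjugate exponents [q / (q - 2)] and [q / 2] separates the powers of the point
   on the line from the direction [y]. *)
have QB t : Q t <= S t `^ (1 - 2 / q) * B.
  have h := @hoelder_sum R n (fun i => `|u t i| `^ (q - 2)) (fun i => y 0 i ^+ 2)
    (q / (q - 2)) (q / 2).
  apply: le_trans (h _ _ _ _ _) _.
  - by move=> i; exact: powR_ge0.
  - by move=> i; exact: sqr_ge0.
  - by rewrite divr_gt0// subr_gt0.
  - by rewrite divr_gt0.
  - by rewrite !invf_div -mulrDl subrK divff// gt_eqF.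
  rewrite !invf_div.
  have -> : \sum_i (`|u t i| `^ (q - 2)) `^ (q / (q - 2)) = S t.
    apply: eq_bigr => i _; rewrite -powRrM mulrCA divff ?mulr1//.
    by rewrite gt_eqF// subr_gt0.
  have -> : (q - 2) / q = 1 - 2 / q by rewrite mulrBl divff// gt_eqF.
  have -> : \sum_i (y 0 i ^+ 2) `^ (q / 2) = lnorm q y `^ q.
    rewrite lnorm_powR ?gt_eqF//; apply: eq_bigr => i _.
    rewrite -(real_normK (num_real _)) -powR_mulrn// -powRrM mulrCA.
    by rewrite divff ?mulr1.
  rewrite -powRrM mulrCA divff ?gt_eqF// mulr1.
  by rewrite -[2]/(2%:R) powR_mulrn// lnorm_ge0.
have ddB t : ddphi t <= (q - 1) * B.
  rewrite /ddphi -[leRHS]addr0; apply: lerD.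
    rewrite mulrCA ler_pM2l ?subr_gt0//.
    apply: (@le_trans _ _ (S t `^ (2 / q - 1) * (S t `^ (1 - 2 / q) * B))).
      by rewrite ler_wpM2l ?powR_ge0.
    rewrite mulrA -powRD ?(gt_eqF (Sp _)) ?implybT//.
    by rewrite (_ : _ - 1 + _ = 0) ?powRr0 ?mul1r//; ring.
  (* The other summand of the second derivative is a square times [2 / q - 1], which is negative, so
     it is bounded by 0. *)
  rewrite (_ : T t * _ = (2 / q - 1) * (S t `^ (2 / q - 1 - 1) * (q * T t ^+ 2))).
    apply: mulr_le0_ge0; last by rewrite mulr_ge0 ?powR_ge0// mulr_ge0 ?sqr_ge0// ltW.
    by rewrite subr_le0 ler_pdivrMr// mul1r ltW.
  by move: (S t `^ _) => z; ring.
have phiE t : phi t = lnorm q (x + t *: y) ^+ 2 / 2.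
  rewrite /phi SE -powRrM mulrCA divff ?gt_eqF// mulr1.
  by rewrite -[X in _ `^ X]/(2%:R) powR_mulrn// lnorm_ge0.
have dphi0 : dphi 0 = dotv (dmap q x) y.
  rewrite /dphi SE scale0r addr0 -powRrM /T /dotv mulr_sumr; apply: eq_bigr => i _.
  rewrite mxE /u mul0r addr0 mulrA; congr (_ `^ _ * _ * _).
  by field; rewrite gt_eqF.
clearbody phi dphi ddphi.
have cont (f df : R -> R) (a b : R) : (forall t : R, is_derive t 1 f (df t)) ->
    {within `[a, b], continuous f}.
  move=> H; apply/continuous_subspaceT => t.
  by apply/differentiable_continuous/derivable1_diffP; have [] := H t.
(* The quadratic Taylor bound is subtracted; the mean value theorem for [chi], then for [dphi],
   shows that [chi 1 <= chi 0]. *)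
pose chi t := phi t - (t * dphi 0 + (q - 1) / 2 * B * t ^+ 2).
have dchi t : is_derive (t : R) 1 chi (dphi t - (dphi 0 + (q - 1) * B * t)).
  apply: is_deriveB.
  have -> : (q - 1) * B * t = 2 * ((q - 1) / 2 * B) * t by field.
  exact: is_derive_quadratic.
have [c /andP[c0 c1] chi1] := MVT (@ltr01 R) (fun t _ => dchi t) (cont _ _ _ _ dchi).
have [c' /andP[c'0 c'1] dphic] := MVT (c0 : 0 < c) (fun t _ => ddphiE t) (cont _ _ _ _ ddphiE).
have : chi 1 - chi 0 <= 0.
  rewrite chi1 subr0 mulr1 opprD addrA dphic subr0 -mulrBl.
  by apply: mulr_le0_ge0; [rewrite subr_le0|exact: ltW].
have fin (n1 n2 b d : R) : n1 / 2 - (1 * d + (q - 1) / 2 * b * 1 ^+ 2) -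
    (n2 / 2 - (0 * d + (q - 1) / 2 * b * 0 ^+ 2)) <= 0 ->
    n1 / 2 <= n2 / 2 + d + (q - 1) / 2 * b by lra.
by rewrite /chi !phiE dphi0 scale0r addr0 scale1r; exact: fin.
Qed.

End smoothness.

(** * Mirror steps and their Bregman divergence *)

Lemma derive_shift {R : realType} {n : nat} (h : 'rV[R]_n -> R) (v u x : 'rV[R]_n) :
  'D_v (fun y => h (y - u)) x = 'D_v h (x - u).
Proof. by rewrite /derive; under eq_fun do rewrite /= -addrA. Qed.

Lemma grad_shift {R : realType} {n : nat} (h : 'rV[R]_n -> R) (u x : 'rV[R]_n) :
  grad (fun y => h (y - u)) x = grad h (x - u).
Proof. by apply/rowP => i; rewrite !mxE derive_shift. Qed.

Lemma bregman_shift {R : realType} {n : nat} (h : 'rV[R]_n -> R) (u z x : 'rV[R]_n) :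
  bregman (fun y => h (y - u)) z x = bregman h (z - u) (x - u).
Proof. by rewrite /bregman grad_shift opprB addrA subrK. Qed.

(** By the two subgradient inequalities the difference quotient lies between the components of [G]
    at the two end points, so continuity of [G] forces its limit. *)
Lemma grad_subgradient {R : realType} {n : nat} (h : 'rV[R]_n -> R)
    (G : 'rV[R]_n -> 'rV[R]_n) x :
  (forall y z, h y + dotv (G y) (z - y) <= h z) ->
  (forall i, {for x, continuous (fun y => G y 0 i)}) -> grad h x = G x.
Proof.
move=> sub cG; apply/rowP => i; rewrite mxE; set v := delta_mx 0 i.
apply/cvg_lim => //.
have cl : (G (t *: v + x)) 0 i @[t --> (0 : R)] --> G x 0 i.
  apply: (@cvg_comp _ _ _ (fun t : R => t *: v + x) (fun y => G y 0 i) (nbhs 0) (nbhs x)).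
    have : t *: v + x @[t --> (0 : R)] --> (0 : R) *: v + x.
      by apply: cvgD; [apply: cvgZr_tmp; exact: cvg_id|exact: cvg_cst].
    by rewrite scale0r add0r.
  exact: cG.
apply/cvgrPdist_le => e e0.
move/cvgrPdist_le : cl => /(_ _ e0) cl.
have [d /= d0 dP] := cl; exists d => //= t td t0.
have {dP} := dP t td.
have h1 := sub x (t *: v + x); have h2 := sub (t *: v + x) x.
move: h1 h2; rewrite addrK opprD addrCA subrr addr0 -scaleNr !dotvZr !dotv_delta.
set a := G x 0 i; set b := G (t *: v + x) 0 i => h1 h2 ab.
rewrite /GRing.scale/=; set q := h _ - h x in h1 h2 *.
have q1 : t * a <= q by rewrite /q; lra.
have q2 : q <= t * b by rewrite /q; lra.
apply: le_trans ab; have [tp|tn|tz] := ltgtP t 0; last by rewrite tz eqxx in t0.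
- have c1 : t^-1 * q <= a by rewrite ler_ndivrMl// mulrC.
  have c2 : b <= t^-1 * q by rewrite ler_ndivlMl// mulrC.
  by rewrite !ger0_norm ?subr_ge0//; [lra|exact: le_trans c1].
- have c1 : a <= t^-1 * q by rewrite ler_pdivlMl.
  have c2 : t^-1 * q <= b by rewrite ler_pdivrMl.
  by rewrite !ler0_norm ?subr_le0//; [lra|exact: le_trans c2].
Qed.

Section mirror.
Context {R : realType} {n : nat}.
Variables (k q w : R).
Hypotheses (k1 : 1 < k) (q2 : 2 <= q) (kq : (k - 1) * (q - 1) = 1) (w0 : 0 < w).
Implicit Types (x y z u v t G : 'rV[R]_n).

Definition mprox x : R := w / 2 * lnorm k x ^+ 2.
Definition mgrad x : 'rV[R]_n := w *: dmap k x.
(** The gradient of the conjugate function [mdual], which is the inverse of [mgrad]. *)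
Definition mgradV t : 'rV[R]_n := w^-1 *: dmap q t.
(** The squared dual norm, scaled so that half of it is the second-order remainder of [mdual]. *)
Definition dnorm2 v : R := (q - 1) / w * lnorm q v ^+ 2.
Definition mdual t : R := lnorm q t ^+ 2 / (2 * w).

Hypothesis dnorm2_le : forall v, dnorm2 v <= dotv v v.

Let q1 : 1 < q. Proof. by apply: lt_le_trans q2; rewrite ltr1n. Qed.
Let qk : (q - 1) * (k - 1) = 1. Proof. by rewrite mulrC. Qed.
Let wi0 : 0 < w^-1. Proof. by rewrite invr_gt0. Qed.
Let wn0 : w != 0. Proof. by rewrite gt_eqF. Qed.

Lemma mgradK x : mgradV (mgrad x) = x.
Proof. by rewrite /mgradV /mgrad dmapZ// dmapK// scalerA mulVf// scale1r. Qed.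

Lemma mgradVK t : mgrad (mgradV t) = t.
Proof. by rewrite /mgradV /mgrad dmapZ// dmapK// scalerA mulfV// scale1r. Qed.

Lemma mdual_smooth t v :
  mdual (t + v) <= mdual t + dotv v (mgradV t) + dnorm2 v / 2.
Proof.
have := lnorm_sqr_smooth t v q2; rewrite /mdual /dnorm2 /mgradV dotvZr (dotvC v).
move: (lnorm q (t + v)) (lnorm q t) (lnorm q v) (dotv _ _) => a b c d h.
have -> : a ^+ 2 / (2 * w) = w^-1 * (a ^+ 2 / 2) by field.
have -> : b ^+ 2 / (2 * w) + w^-1 * d + (q - 1) / w * c ^+ 2 / 2 =
  w^-1 * (b ^+ 2 / 2 + d + (q - 1) / 2 * c ^+ 2) by field.
by rewrite ler_pM2l.
Qed.

Lemma mprox_young t x : dotv t x <= mprox x + mdual t.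
Proof.
apply: le_trans (hoelder_lnorm q1 k1 qk t x) _.
rewrite /mprox /mdual; move: (lnorm q t) (lnorm k x) => a b.
rewrite -subr_ge0.
have -> : w / 2 * b ^+ 2 + a ^+ 2 / (2 * w) - a * b = (w * b - a) ^+ 2 / (2 * w).
  by field.
by rewrite divr_ge0 ?sqr_ge0// mulr_ge0// ltW.
Qed.

Lemma dotv_mgrad x : dotv (mgrad x) x = 2 * mprox x.
Proof. by rewrite /mgrad /mprox dotvZl dotv_dmap//; field. Qed.

Lemma mdual_mgrad x : mdual (mgrad x) = mprox x.
Proof.
have q0 : q != 0 by rewrite gt_eqF// (lt_trans _ q1).
by rewrite /mdual /mgrad lnormZ// (lnorm_dmap k1 q1 kq) gtr0_norm// /mprox; field.
Qed.

(** The Bregman divergence in its Fenchel-Young form. It depends on [z] only through the dual point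
    [mgrad z], in which a mirror step is a translation. *)
Definition mdiv z x := mprox x + mdual (mgrad z) - dotv (mgrad z) x.

Lemma mdivE z x : mdiv z x = mprox x - mprox z - dotv (mgrad z) (x - z).
Proof.
rewrite /mdiv mdual_mgrad dotvBr dotv_mgrad.
by move: (mprox x) (mprox z) (dotv _ _) => *; ring.
Qed.

(** Strong convexity as the dual of smoothness: the Fenchel-Young inequality is taken at the dual
    point [mgrad z + (x - z)] and [mdual] is expanded there. The Euclidean norm is the useful one,
    since the average over the direction produces Euclidean lengths. *)
Lemma mdiv_ge z x : dotv (x - z) (x - z) / 2 <= mdiv z x.
Proof.
have h1 := mprox_young (mgrad z + (x - z)) x.
have h2 := mdual_smooth (mgrad z) (x - z).
have h3 := dnorm2_le (x - z).
have := dotvBr (x - z) x z.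
move: h1 h2; rewrite mgradK /mdiv dotvDl.
move: (mprox x) (mdual (mgrad z)) (mdual _) (dnorm2 _) h3 => a b c d.
by move: (dotv (mgrad z) x) (dotv _ x) (dotv _ z) (dotv _ _) => *; lra.
Qed.

Lemma mdiv_ge0 z x : 0 <= mdiv z x.
Proof. by apply: le_trans (mdiv_ge z x); rewrite divr_ge0// dotv_ge0. Qed.

Lemma mdiv0 x : mdiv 0 x = mprox x.
Proof.
rewrite mdivE /mgrad dmap0 scaler0 dotv0l subr0 /mprox lnorm0.
  by rewrite expr0n mulr0 subr0.
by rewrite gt_eqF// (lt_trans _ k1).
Qed.

Lemma grad_mprox x : grad mprox x = mgrad x.
Proof.
apply: grad_subgradient => [y z|i].
  by have := mdiv_ge0 y z; rewrite mdivE; move: (dotv _ _) (mprox y) (mprox z) => *; lra.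
rewrite [X in {for _, continuous X}](_ : _ = fun y => w * dmap k y 0 i); last first.
  by apply/funext => y; rewrite /mgrad mxE.
apply: (@cvgM _ _ (nbhs x)); first exact: cvg_cst.
exact: (continuous_dmap k1 q1 kq).
Qed.

Lemma bregman_mprox z x : bregman mprox z x = mdiv z x.
Proof. by rewrite /bregman grad_mprox mdivE. Qed.

(** The step translates the dual point by [- c *: G], so the estimate is the smoothness of [mdual]
    with [mgradV (mgrad z) = z] as its gradient. *)
Lemma mdiv_step z c G x : mdiv (mgradV (mgrad z - c *: G)) x <=
  mdiv z x - c * dotv G (z - x) + c ^+ 2 / 2 * dnorm2 G.
Proof.
rewrite {1}/mdiv mgradVK; have := mdual_smooth (mgrad z) (- (c *: G)).
have q0 : q != 0 by rewrite gt_eqF// (lt_trans _ q1).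
rewrite mgradK /dnorm2 -scaleNr lnormZ// exprMn real_normK ?num_real//.
rewrite /mdiv !dotvDl !dotvZl dotvBr.
move: (dotv _ _) (dotv _ _) (dotv _ _) (lnorm q G) (mprox x) (mdual _) (mdual _).
move=> a b d e f l m; have -> : c ^+ 2 / 2 * ((q - 1) / w * e ^+ 2) =
  (q - 1) / w * (c ^+ 2 * e ^+ 2) / 2 by ring.
by rewrite sqrrN; move: (_ * (c ^+ 2 * _)) => *; lra.
Qed.

Lemma mdiv_three_point z z' c G y : mgrad z' = mgrad z - c *: G ->
  c * dotv G (y - z) + mdiv z y =
  c * dotv G (z' - z) + mdiv z z' + mdiv z' y.
Proof.
move=> h; have := dotv_mgrad z'; have := mdual_mgrad z'.
rewrite /mdiv h dotvBl dotvBl dotvZl dotvZl => ->; rewrite dotvBr dotvBr.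
move: (mprox y) (mprox z') (mdual _) (dotv _ z) => ? ? ? ?.
by move: (dotv G y) (dotv G z') (dotv _ y) (dotv _ z') => *; lra.
Qed.

(** By the three-point identity the minimized function is a constant plus the divergence from [z'],
    whose only zero is [z']. The value chosen by [argmin] is thereby an explicit function of the
    data, which gives access to its measurability. *)
Lemma argmin_mprox_shift u z c G :
  argmin (fun y => c * dotv G (y - z) + bregman (fun y => mprox (y - u)) z y) =
  u + mgradV (mgrad (z - u) - c *: G).
Proof.
move: (mgradVK (mgrad (z - u) - c *: G)); set z' := mgradV _ => z'E.
set phi := fun y => _.
have phiE y : phi y = c * dotv G (z' - (z - u)) + mdiv (z - u) z' + mdiv z' (y - u).
  rewrite -mdiv_three_point// /phi bregman_shift bregman_mprox.
  by rewrite (_ : y - u - (z - u) = y - z)// opprB addrA subrK.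
have mdiv_self v : mdiv v v = 0.
  by rewrite mdivE !subrr dotv0r subr0.
have phiz : phi (u + z') = c * dotv G (z' - (z - u)) + mdiv (z - u) z'.
  by rewrite phiE (addrC u) addrK mdiv_self addr0.
rewrite /argmin; apply: get_unique => [y|y ymin].
  by rewrite phiz (phiE y) lerDl mdiv_ge0.
have := ymin (u + z'); rewrite phiz (phiE y) gerDl => h.
have := le_trans (mdiv_ge z' (y - u)) h; rewrite pmulr_lle0// => h'.
apply/esym/eqP; rewrite eq_sym -subr_eq0 opprD addrA; apply/eqP/dotv_eq0/eqP.
by rewrite eq_le h' dotv_ge0.
Qed.

Lemma dnorm2_ge0 v : 0 <= dnorm2 v.
Proof. by rewrite mulr_ge0 ?sqr_ge0// divr_ge0 ?(ltW w0)// subr_ge0 ltW. Qed.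

Lemma dnorm2Z a v : dnorm2 (a *: v) = a ^+ 2 * dnorm2 v.
Proof.
have q0 : q != 0 by rewrite gt_eqF// (lt_trans _ q1).
by rewrite /dnorm2 lnormZ// exprMn real_normK ?num_real//; ring.
Qed.

End mirror.

(** * The exponents, the normalization [Omega] and the factor [rho] *)

Section parameters.
Context {R : realType}.

(** From [1 - 1/2 <= expR (- 1/2)] one gets [expR (1/2) <= 2], hence [expR (3/2) <= 8]. This bound
    carries the numerical comparisons for p = 1. *)
Lemma ln_ge_32 (n : nat) : (8 <= n)%N -> 3 / 2 <= ln n%:R :> R.
Proof.
move=> n8; have n0 : 0 < n%:R :> R by rewrite ltr0n; exact: leq_trans n8.
rewrite -[leLHS]expRK ler_ln ?posrE ?expR_gt0//.
apply: (@le_trans _ _ (8%:R : R)); last by rewrite ler_nat.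
have h : expR (2^-1) <= 2 :> R.
  have := expR_ge1Dx (- 2^-1 : R); rewrite expRN => h.
  rewrite -[leRHS]invrK -[leLHS]invrK lef_pV2 ?posrE ?invr_gt0 ?expR_gt0//.
  by lra.
rewrite expRM_natl; apply: (@le_trans _ _ (2 ^+ 3)); last by rewrite -natrX.
by rewrite lerXn2r ?nnegrE ?expR_ge0.
Qed.

Definition primal_exp (n p : nat) : R := if p == 1%N then kappa n else 2.
(** For p = 1 the dual exponent is the finite conjugate [1 + ln n] of [kappa], which stands in for
    the infinite exponent [q] of the statement. *)
Definition dual_exp (n p : nat) : R := if p == 1%N then 1 + ln n%:R else 2.

Variables n p : nat.
Hypotheses (n8 : (8 <= n)%N) (p12 : p \in [:: 1%N; 2%N]).

Local Notation L := (ln n%:R : R).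
Let L32 : 3 / 2 <= L. Proof. exact: ln_ge_32. Qed.
Let L0 : 0 < L. Proof. by apply: lt_le_trans L32; lra. Qed.
Let Ln0 : L != 0. Proof. by rewrite gt_eqF. Qed.
Let n0 : 0 < n%:R :> R. Proof. by rewrite ltr0n; exact: leq_trans n8. Qed.

Let p_cases : p = 1%N \/ p = 2%N.
Proof. by move: p12; rewrite !inE => /orP[]/eqP; [left|right]. Qed.

Lemma primal_exp_gt1 : 1 < primal_exp n p.
Proof.
rewrite /primal_exp; case: ifPn => _; last by lra.
by rewrite /kappa ltrDl invr_gt0.
Qed.

Lemma dual_exp_ge2 : 2 <= dual_exp n p.
Proof. by rewrite /dual_exp; case: ifPn => _ //; move: L32; lra. Qed.

Lemma primal_dual_exp : (primal_exp n p - 1) * (dual_exp n p - 1) = 1.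
Proof.
rewrite /primal_exp /dual_exp; case: ifPn => _; last by ring.
by rewrite /kappa; field.
Qed.

Let nL : n%:R `^ L^-1 = expR 1 :> R.
Proof. by rewrite /powR gt_eqF// mulVf. Qed.

Lemma Omega_ge1 : 1 <= Omega n p :> R.
Proof.
rewrite /Omega; case: ifPn => // _.
have e1 : 1 <= expR 1 :> R by rewrite -expR0 ler_expR.
have n1 : 1 <= n%:R :> R by rewrite ler1n; exact: leq_trans n8.
have h : 1 <= n%:R `^ ((kappa n - 1) * (2 - kappa n) / kappa n) :> R.
  rewrite -[leLHS](powRr0 (n%:R : R)); apply: ler_powR => //.
  have k1 : 0 <= kappa n - 1 :> R by rewrite /kappa addrC addKr invr_ge0 ltW.
  have k2 : kappa n <= 2 :> R.
    rewrite /kappa -lerBrDl (_ : 2 - 1 = 1); last by ring.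
    by rewrite invf_le1//; move: L32; lra.
  by rewrite divr_ge0 ?mulr_ge0 ?subr_ge0//; lra.
have L1 : 1 <= L by move: L32; lra.
rewrite -[leLHS]mulr1; apply: ler_pM => //.
by rewrite -[leLHS]mulr1; apply: ler_pM.
Qed.

Lemma proxE : @prox R n p = mprox (primal_exp n p) (Omega n p).
Proof.
apply/funext => x; rewrite /prox /mprox /primal_exp /Omega.
by have [|] := eqVneq p 1%N => // _; rewrite mul1r.
Qed.

Let dn := @dnorm2 R n (dual_exp n p) (Omega n p).

(** The [l_q] norm with [q = 1 + ln n] exceeds the largest coordinate by a factor at most
    [n ^ (1 / q)], and [Omega] is normalized precisely so that the square of this factor is
    cancelled. *)
Lemma dnorm2_le_max (v : 'rV[R]_n) M : p = 1%N -> (forall i, v 0 i ^+ 2 <= M) -> dn v <= M.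
Proof.
move=> p1 vM.
have M0 : 0 <= M.
  by apply: le_trans (vM (Ordinal (leq_trans (isT : 0 < 8)%N n8))); exact: sqr_ge0.
rewrite /dn /dnorm2 /dual_exp p1 eqxx addrC addKr.
have q0 : 0 < 1 + L by move: L32; lra.
have hs : lnorm (1 + L) v <= (n%:R * Num.sqrt M `^ (1 + L)) `^ (1 + L)^-1.
  apply: ge0_ler_powR; rewrite ?nnegrE ?invr_ge0 ?(ltW q0)//.
    by apply: sumr_ge0 => i _; exact: powR_ge0.
  have -> : n%:R * Num.sqrt M `^ (1 + L) = \sum_(i < n) Num.sqrt M `^ (1 + L).
    by rewrite sumr_const card_ord mulr_natl.
  apply: ler_sum => i _.
  apply: ge0_ler_powR; rewrite ?nnegrE ?sqrtr_ge0 ?(ltW q0)//.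
  by rewrite -sqrtr_sqr ler_sqrt.
have hs2 : lnorm (1 + L) v ^+ 2 <= n%:R `^ (2 / (1 + L)) * M.
  apply: (@le_trans _ _ (((n%:R * Num.sqrt M `^ (1 + L)) `^ (1 + L)^-1) ^+ 2)).
    by rewrite lerXn2r ?nnegrE ?lnorm_ge0 ?powR_ge0.
  rewrite powRM ?powR_ge0// -(powRrM (Num.sqrt M)) divff ?gt_eqF// powRr1 ?sqrtr_ge0//.
  by rewrite (mulrC 2) (powRrM n%:R) powR_mulrn ?powR_ge0// exprMn sqr_sqrtr.
have kE : kappa n = 1 + L^-1 :> R by [].
rewrite /Omega eqxx kE.
apply: (@le_trans _ _ (L / (expR 1 * n%:R `^ ((1 + L^-1 - 1) * (2 - (1 + L^-1)) / (1 + L^-1)) * L)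
   * (n%:R `^ (2 / (1 + L)) * M))).
  by apply: ler_wpM2l hs2; rewrite divr_ge0 ?mulr_ge0 ?powR_ge0 ?expR_ge0 ?ltW.
rewrite -nL.
(* The constant e in [Omega] is [n ^ (1 / ln n)]; its exponent and the explicit one of [Omega] add
   up to [2 / q]. *)
have -> : 2 / (1 + L) = L^-1 + ((1 + L^-1 - 1) * (2 - (1 + L^-1)) / (1 + L^-1)).
  have l1 : 1 + L != 0 by rewrite gt_eqF.
  have l2 : L + 1 != 0 by rewrite addrC.
  by field; rewrite ?Ln0 ?l1 ?l2.
rewrite powRD; last by rewrite (gt_eqF n0) implybT.
have a0 := powR_gt0 L^-1 n0.
have b0 := powR_gt0 ((1 + L^-1 - 1) * (2 - (1 + L^-1)) / (1 + L^-1)) n0.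
move: (n%:R `^ _) (n%:R `^ _) a0 b0 => a b a0 b0.
rewrite le_eqVlt; apply/orP; left; apply/eqP; field.
by rewrite Ln0 !gt_eqF.
Qed.

Lemma dnorm2_2 (v : 'rV[R]_n) : p = 2%N -> dn v = dotv v v.
Proof.
move=> p2; rewrite /dn /dnorm2 /dual_exp /Omega p2/= lnorm2_sqr.
by rewrite divr1 (_ : 2 - 1 = 1) ?mul1r//; ring.
Qed.

Lemma dnorm2_le_dotv (v : 'rV[R]_n) : dn v <= dotv v v.
Proof.
case: p_cases => p1; last by rewrite dnorm2_2.
apply: dnorm2_le_max => // i; rewrite /dotv (bigD1 i)//= -expr2 lerDl.
by apply: sumr_ge0 => j _; rewrite -expr2 sqr_ge0.
Qed.

(** The [l_kappa] norm is at most the [l_1] norm: [|x_i| ^ kappa <= |x_i| * s ^ (kappa - 1)] with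
    [s] the sum of all [|x_i|]. *)
Lemma prox_le (x : 'rV[R]_n) : prox p x <= Omega n p / 2 * lnorm p%:R x ^+ 2.
Proof.
rewrite proxE /mprox; apply: ler_wpM2l.
  by rewrite divr_ge0 ?(le_trans ler01 Omega_ge1).
suff h : lnorm (primal_exp n p) x <= lnorm p%:R x.
  move: (lnorm_ge0 (primal_exp n p) x) h; move: (lnorm _ x) (lnorm _ x).
  by move=> a b b0 ba; rewrite lerXn2r ?nnegrE// (le_trans b0).
rewrite /primal_exp; case: p_cases => ->; last by rewrite lexx.
rewrite eqxx /lnorm invr1 powRr1; last first.
  by apply: sumr_ge0 => j _; exact: powR_ge0.
under [leRHS]eq_bigr do rewrite powRr1//.
set s := \sum_i `|x 0 i|; have s0 : 0 <= s by exact: sumr_ge0.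
have k1 : 1 < kappa n :> R by rewrite /kappa ltrDl invr_gt0.
have k0 : 0 < kappa n :> R by exact: lt_trans k1.
rewrite -[leRHS](@powRr1 _ s)// -(@mulfV _ (kappa n)) ?gt_eqF// powRrM.
apply: ge0_ler_powR; rewrite ?nnegrE ?invr_ge0 ?powR_ge0 ?(ltW k0)//.
  by apply: sumr_ge0 => j _; exact: powR_ge0.
rewrite -(mulr_powRB1 s0 k0) {1}/s mulr_suml; apply: ler_sum => i _.
rewrite -(@mulr_powRB1 _ `|x 0 i|)// ler_wpM2l// ge0_ler_powR ?nnegrE//.
  by rewrite subr_ge0 ltW.
by rewrite /s (bigD1 i)//= lerDl; exact: sumr_ge0.
Qed.

Lemma rho1 : p = 1%N -> rho n p = (16 * ln n%:R - 8) / n%:R :> R.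
Proof.
move=> ->; rewrite /rho /inv_q /conj_exp hoelder_conjugate1 /=.
by rewrite mulr0 sub0r powR_inv1.
Qed.

Lemma rho2 : p = 2%N -> rho n p = 1 :> R.
Proof.
move=> ->; rewrite /rho /inv_q /conj_exp hoelder_conjugate2 /= inver/=.
rewrite pnatr_eq0/= mulfV// subrr powRr0 mulr1 -EFinB -EFin_min/=.
rewrite (_ : 2 - 1 = 1); last by ring.
by apply: min_l; move: L32; lra.
Qed.

Lemma rho_gt0 : 0 < rho n p :> R.
Proof.
case: p_cases => h; last by rewrite rho2.
by rewrite rho1// divr_gt0//; move: L32; lra.
Qed.

End parameters.

(** * Moments of the uniform distribution on the sphere *)

Section cosh.
Context {R : realType}.
Implicit Types x : R.

(** This is [cosh x <= expR (x ^ 2)]. It is checked for [|x| <= 1/4] and propagated by doubling: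
    with [a * b = 1] and [a + b <= 2 E] one has [a^2 + b^2 = (a + b)^2 - 2 <= 4 E^2 - 2 <= 2
    E^4]. *)
Lemma expR_add_oppr_le x : expR x + expR (- x) <= 2 * expR (x ^+ 2).
Proof.
(* Squaring [1 - y/2 <= expR (- y/2)] gives [(1 - y/2)^2 * expR y <= 1], and [1] is at most
   [(1 - y/2)^2 * (1 + y + y^2)] on this interval. *)
have base (y : R) : `|y| <= 4^-1 -> expR y <= 1 + y + y ^+ 2.
  rewrite ler_norml => /andP[y1 y2].
  have h : 1 - y / 2 <= expR (- (y / 2)) by have := expR_ge1Dx (- (y / 2)); lra.
  have yp : 0 < 1 - y / 2 by lra.
  have e2 : expR (- (y / 2)) ^+ 2 * expR y = 1.
    by rewrite expr2 -!expRD (_ : _ + y = 0) ?expR0//; field.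
  have h2 : (1 - y / 2) ^+ 2 * expR y <= 1.
    rewrite -[leRHS]e2 ler_wpM2r ?expR_ge0// lerXn2r ?nnegrE ?expR_ge0//.
    exact: ltW.
  have yp2 : 0 < (1 - y / 2) ^+ 2 by rewrite exprn_gt0.
  rewrite -(ler_pM2l yp2); apply: le_trans h2 _.
  rewrite -subr_ge0 (_ : _ - 1 = y ^+ 2 / 4 * (1 - 3 * y + y ^+ 2)); last by field.
  rewrite mulr_ge0 ?divr_ge0 ?sqr_ge0//; have := sqr_ge0 y; lra.
have [k] : exists k : nat, `|x| <= 2 ^+ k / 4.
  exists (Num.bound (4 * `|x|)); rewrite ler_pdivlMr// mulrC.
  apply: ltW; apply: lt_le_trans (archi_boundP _) _; first by rewrite mulr_ge0.
  by rewrite -natrX ler_nat ltnW// ltn_expl.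
elim: k x => [|k IH] x xk.
  have x4 : `|x| <= 4^-1 by rewrite expr0 mul1r in xk.
  have h1 := base x x4; have h2 := base (- x).
  rewrite normrN sqrrN in h2; have {}h2 := h2 x4.
  have := expR_ge1Dx (x ^+ 2); lra.
have := IH (x / 2); rewrite normrM (ger0_norm (_ : 0 <= 2^-1))//.
rewrite exprS in xk => /(_ _) h.
have {h} : expR (x / 2) + expR (- (x / 2)) <= 2 * expR ((x / 2) ^+ 2).
  by apply: h; move: xk; move: (2 ^+ k) => z; lra.
set a := expR (x / 2); set b := expR (- (x / 2)); set E := expR _ => abE.
have ab : a * b = 1 by rewrite /a /b expRN mulfV// gt_eqF ?expR_gt0.
have aa : expR x = a ^+ 2 by rewrite /a expr2 -expRD -splitr.
have bb : expR (- x) = b ^+ 2 by rewrite /b expr2 -expRD -opprD -splitr.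
have EE : expR (x ^+ 2) = E ^+ 4.
  by rewrite /E -expRM_natl; congr expR; field.
have a0 : 0 <= a by exact: expR_ge0.
have b0 : 0 <= b by exact: expR_ge0.
rewrite aa bb EE; clear aa bb EE; clearbody a b E.
have h : (a + b) ^+ 2 <= (2 * E) ^+ 2.
  by rewrite lerXn2r ?nnegrE ?addr_ge0// (le_trans _ abE)// addr_ge0.
have := sqr_ge0 (E ^+ 2 - 1).
move: h; have -> : (a + b) ^+ 2 = a ^+ 2 + b ^+ 2 + 2 * (a * b) by ring.
rewrite ab; have -> : (E ^+ 2 - 1) ^+ 2 = E ^+ 4 - 2 * E ^+ 2 + 1 by ring.
rewrite exprMn; move: (E ^+ 4) (E ^+ 2) (a ^+ 2) (b ^+ 2) => *; lra.
Qed.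

(* The tangent at [t = 2 l] of an exponential dominates the square beyond.     *)
Lemma sqr_le_expR (l t : R) : 1 <= l ->
  t ^+ 2 <= 4 * l ^+ 2 +
    4 * expR (- (2 * l ^+ 2)) * (expR (l * t) + expR (l * - t)).
Proof.
move=> l1.
have key u : 0 <= u -> u ^+ 2 <= 4 * l ^+ 2 + 4 * expR (- (2 * l ^+ 2)) * expR (l * u).
  move=> u0; have [ul|lu] := leP u (2 * l).
    apply: (@le_trans _ _ (4 * l ^+ 2)).
      rewrite (_ : 4 * l ^+ 2 = (2 * l) ^+ 2); last by ring.
      by rewrite lerXn2r ?nnegrE// mulr_ge0//; lra.
    by rewrite lerDl !mulr_ge0 ?expR_ge0.
  rewrite -mulrA -expRD.
  have -> : - (2 * l ^+ 2) + l * u = l * (u - 2 * l) / 2 + l * (u - 2 * l) / 2 by field.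
  rewrite expRD -expr2; set z := u - 2 * l.
  have z0 : 0 < z by rewrite /z subr_gt0.
  have uE : u = 2 * l + z by rewrite /z; ring.
  have h := expR_ge1Dx (l * z / 2).
  have lz0 : 0 < l * z by rewrite mulr_gt0//; lra.
  have h2 : (1 + l * z / 2) ^+ 2 <= expR (l * z / 2) ^+ 2.
    by rewrite lerXn2r ?nnegrE ?expR_ge0//; lra.
  have h3 : z ^+ 2 <= (l * z) ^+ 2 by rewrite lerXn2r ?nnegrE ?(ltW z0) ?(ltW lz0)// ler_peMl// ltW.
  rewrite uE; move: (expR _ ^+ 2) h2 => w; nra.
have p0 : 0 <= 4 * expR (- (2 * l ^+ 2)) by rewrite mulr_ge0 ?expR_ge0.
have e1 := expR_ge0 (l * t); have e2 := expR_ge0 (l * - t).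
have [t0|t0] := leP 0 t.
  apply: le_trans (key t t0) _; rewrite lerD2l ler_wpM2l// lerDl//.
have tn : 0 <= - t by rewrite oppr_ge0 ltW.
rewrite -sqrrN; apply: le_trans (key _ tn) _; rewrite lerD2l ler_wpM2l//.
by rewrite lerDr.
Qed.

End cosh.

(** * Householder reflections *)

Section reflection.
Context {R : realType} {n : nat}.
Implicit Types x v : 'rV[R]_n.

(** Sign flips, transpositions of coordinates and the exchange of a coordinate axis with the
    diagonal are all reflections in a hyperplane, so one invariance statement serves the three
    uses. *)
Definition reflect v x : 'rV[R]_n := x - (2 * dotv x v / dotv v v) *: v.

Lemma reflect_mulmx v x :
  reflect v x = x *m (1%:M - (2 / dotv v v) *: (v^T *m v)).
Proof.
rewrite mulmxBr mulmx1 -scalemxAr mulmxA /reflect; congr (_ - _).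
have -> : x *m v^T = (dotv x v)%:M.
  by apply/matrixP => i j; rewrite !mxE !ord1 eqxx mulr1n; apply: eq_bigr => l _; rewrite mxE.
by rewrite mul_scalar_mx scalerA; congr (_ *: _); rewrite mulrAC.
Qed.

Lemma reflectK v : dotv v v != 0 -> involutive (reflect v).
Proof.
move=> v0 x; rewrite {1}/reflect.
have -> : dotv (reflect v x) v = - dotv x v.
  by rewrite /reflect dotvBl dotvZl divfK//; ring.
by rewrite /reflect mulrN mulNr scaleNr opprK subrK.
Qed.

Lemma reflect_orthogonal v : dotv v v != 0 ->
  let Q := 1%:M - (2 / dotv v v) *: (v^T *m v) in Q *m Q^T = 1%:M.
Proof.
move=> v0 /=; set Q := _ - _.
have QT : Q^T = Q.
  by rewrite /Q linearB/= trmx1 linearZ/= trmx_mul trmxK.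
rewrite QT; apply/row_matrixP => i.
by rewrite row_mul [row i Q]rowE -!reflect_mulmx reflectK// rowE mulmx1.
Qed.

Lemma reflect_delta i x : reflect (delta_mx 0 i) x =
  \row_j (if j == i then - x 0 j else x 0 j).
Proof.
apply/rowP => j; rewrite /reflect !dotv_delta !mxE eqxx/= eqxx divr1.
case: eqP => [->|]; rewrite ?mulr1 ?mulr0 ?subr0//; ring.
Qed.

Lemma reflect_swap i j x : i != j ->
  reflect (delta_mx 0 i - delta_mx 0 j) x = \row_l x 0 (tperm i j l).
Proof.
move=> ij; apply/rowP => l; rewrite /reflect !dotvBr !dotv_delta !mxE !eqxx/=.
rewrite (negbTE ij) (eq_sym j) (negbTE ij)/= subr0 sub0r opprK.
rewrite (_ : 1%:R + 1%:R = 2 :> R); last by [].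
case: tpermP => [->|->|/eqP/negbTE -> /eqP/negbTE ->].
- by rewrite eqxx (negbTE ij) /= mulr1n mulr0n; field.
- by rewrite eqxx eq_sym (negbTE ij) /= mulr1n mulr0n; field.
- by rewrite subrr mulr0 subr0.
Qed.

End reflection.

Section nonneg_integral.
Context {R : realType} {d : measure_display} {T : measurableType d}.
Variable mu : {measure set T -> \bar R}.
Implicit Types f g : T -> R.
Local Open Scope ereal_scope.

Lemma ge0_integralDr f g : measurable_fun setT f -> measurable_fun setT g ->
  (forall x, 0 <= f x)%R -> (forall x, 0 <= g x)%R ->
  \int[mu]_x (f x + g x)%:E = \int[mu]_x (f x)%:E + \int[mu]_x (g x)%:E.
Proof.
move=> mf mg f0 g0; under eq_integral do rewrite EFinD.
by rewrite ge0_integralD//; [move=> x _; rewrite lee_fin|exact/measurable_EFinP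
  |move=> x _; rewrite lee_fin|exact/measurable_EFinP].
Qed.

Lemma ge0_integralZr (c : R) f : measurable_fun setT f ->
  (forall x, 0 <= f x)%R -> (0 <= c)%R ->
  \int[mu]_x (c * f x)%:E = c%:E * \int[mu]_x (f x)%:E.
Proof.
move=> mf f0 c0; under eq_integral do rewrite EFinM.
rewrite ge0_integralZl_EFin//; last exact/measurable_EFinP.
by move=> x _; rewrite lee_fin.
Qed.

Lemma ge0_integral_sumr (I : Type) (s : seq I) (f : I -> T -> R) :
  (forall i, measurable_fun setT (f i)) -> (forall i x, 0 <= f i x)%R ->
  \int[mu]_x (\sum_(i <- s) f i x)%:E = \sum_(i <- s) \int[mu]_x (f i x)%:E.
Proof.
move=> mf f0; under eq_integral do rewrite -sumEFin.
rewrite ge0_integral_sum//; first by move=> i; exact/measurable_EFinP.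
by move=> i x _; rewrite lee_fin.
Qed.

Lemma ge0_le_integralr f g : measurable_fun setT f -> measurable_fun setT g ->
  (forall x, 0 <= f x)%R -> (forall x, 0 <= g x)%R ->
  {ae mu, forall x, f x <= g x}%R ->
  \int[mu]_x (f x)%:E <= \int[mu]_x (g x)%:E.
Proof.
move=> mf mg f0 g0 fg; apply: ae_ge0_le_integral => //.
- by move=> x _; rewrite lee_fin.
- exact/measurable_EFinP.
- by move=> x _; rewrite lee_fin.
- exact/measurable_EFinP.
by apply: filterS fg => x fgx _; rewrite lee_fin.
Qed.

End nonneg_integral.

Section uniform_sphere.
Context {R : realType} {n : nat} (U : probability 'rV[R]_n R).
Hypothesis unifU : uniform_on_sphere U.
Implicit Types (e h v : 'rV[R]_n) (phi psi N : 'rV[R]_n -> R).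

Lemma measurable_reflect v : measurable_fun setT (reflect v).
Proof.
apply: measurable_subv => //; apply: measurable_scalev => //.
apply: measurable_funM; last exact: measurable_cst.
apply: measurable_funM; first exact: measurable_cst.
by apply: measurable_dotv => //; exact: measurable_cst.
Qed.

Lemma integral_reflect v phi : dotv v v != 0 -> measurable_fun setT phi ->
  (forall e, 0 <= phi e) ->
  (\int[U]_e (phi (reflect v e))%:E = \int[U]_e (phi e)%:E)%E.
Proof.
move=> v0 mphi phi0; pose Q := 1%:M - (2 / dotv v v) *: (v^T *m v).
have QE x : reflect v x = x *m Q by exact: reflect_mulmx.
pose f := @isMeasurableFun.Build _ _ _ _ _ (@measurable_reflect v).
pose g : {mfun 'rV[R]_n >-> 'rV[R]_n} := HB.pack (reflect v) f.
have mE : measurable_fun setT (EFin \o phi) by exact/measurable_EFinP.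
have E0 e : (0 <= (EFin \o phi) e)%E by rewrite lee_fin.
rewrite -[RHS](_ : (\int[distribution U g]_e (EFin \o phi) e = _)%E).
  by rewrite ge0_integral_distribution.
apply: eq_measure_integral => A mA _.
rewrite /distribution/= /pushforward/= -(unifU.2 Q A)//; last exact: reflect_orthogonal.
by congr (U _); apply/funext => x/=; rewrite QE.
Qed.

Lemma measurable_sphere : measurable (sphere n : set 'rV[R]_n).
Proof.
have -> : sphere n = (fun x : 'rV[R]_n => dotv x x) @^-1` [set 1].
  by apply/seteqP; split=> x /sphereE.
rewrite -[X in measurable X]setTI.
by have := @measurable_dotv R n _ _ (@id 'rV[R]_n) (@id 'rV[R]_n); apply.
Qed.

Lemma ae_sphere : {ae U, forall e, sphere n e}.
Proof.
exists (~` sphere n); split => //; first by apply: measurableC; exact: measurable_sphere.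
by rewrite probability_setC ?unifU.1 ?subee//; exact: measurable_sphere.
Qed.

Lemma ge0_eq_integral_sphere phi psi : measurable_fun setT phi ->
  measurable_fun setT psi -> (forall e, 0 <= phi e) -> (forall e, 0 <= psi e) ->
  (forall e, sphere n e -> phi e = psi e) ->
  (\int[U]_e (phi e)%:E = \int[U]_e (psi e)%:E)%E.
Proof.
move=> mphi mpsi phi0 psi0 h; apply: ge0_ae_eq_integral => //.
- exact/measurable_EFinP.
- exact/measurable_EFinP.
- by move=> x _; rewrite lee_fin.
- by move=> x _; rewrite lee_fin.
by apply: filterS ae_sphere => e /h -> _.
Qed.

Definition flip i e : 'rV[R]_n := \row_j (if j == i then - e 0 j else e 0 j).
Definition swap i j e : 'rV[R]_n := \row_l e 0 (tperm i j l).

Lemma measurable_flip i : measurable_fun setT (flip i).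
Proof.
apply: eq_measurable_fun (measurable_reflect (delta_mx 0 i)) => x _.
exact: reflect_delta.
Qed.

Lemma integral_flip i phi : measurable_fun setT phi -> (forall e, 0 <= phi e) ->
  (\int[U]_e (phi (flip i e))%:E = \int[U]_e (phi e)%:E)%E.
Proof.
move=> mphi phi0; under eq_integral do rewrite /flip -reflect_delta.
by apply: integral_reflect => //; rewrite dotv_delta mxE !eqxx oner_neq0.
Qed.

Lemma integral_swap i j phi : measurable_fun setT phi -> (forall e, 0 <= phi e) ->
  (\int[U]_e (phi (swap i j e))%:E = \int[U]_e (phi e)%:E)%E.
Proof.
move=> mphi phi0; have [<-|ij] := eqVneq i j.
  apply: eq_integral => e _; congr (phi _)%:E; apply/rowP => l.
  by rewrite mxE tperm1 perm1.
under eq_integral do rewrite /swap -(reflect_swap _ ij).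
apply: integral_reflect => //; rewrite dotvBr !dotv_delta !mxE !eqxx/=.
by rewrite (negbTE ij) (eq_sym j) (negbTE ij)/= subr0 sub0r opprK -[1 + 1]/(2%:R) pnatr_eq0.
Qed.

Lemma integral_flip_avg i phi : measurable_fun setT phi -> (forall e, 0 <= phi e) ->
  (\int[U]_e (phi e)%:E = \int[U]_e (2^-1 * (phi e + phi (flip i e)))%:E)%E.
Proof.
move=> mphi phi0.
have mf : measurable_fun setT (fun e => phi (flip i e)).
  by apply: measurableT_comp => //; exact: measurable_flip.
rewrite ge0_integralZr//; last first.
- by move=> e; rewrite addr_ge0.
- exact: measurable_funD.
rewrite ge0_integralDr// integral_flip//.
by rewrite -mule2n -mule_natl muleA -EFinM mulVf ?mul1e.
Qed.

Section invariant_weight.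
Variable N : 'rV[R]_n -> R.
Hypotheses (mN : measurable_fun setT N) (N0 : forall e, 0 <= N e)
  (N_flip : forall i e, N (flip i e) = N e)
  (N_swap : forall i j e, N (swap i j e) = N e).

Let mcoord i : measurable_fun setT (fun e : 'rV[R]_n => e 0 i).
Proof. exact: measurable_coord. Qed.

(** Averaging over the sign of one coordinate removes its products with the others and leaves the
    weight [N] unchanged; the list is treated one coordinate at a time. *)
Let quadratic_signs h (s : seq 'I_n) : uniq s ->
  (\int[U]_e ((\sum_(i <- s) h 0 i * e 0 i) ^+ 2 * N e)%:E =
   \int[U]_e (\sum_(i <- s) h 0 i ^+ 2 * e 0 i ^+ 2 * N e)%:E)%E.
Proof.
have mS s' : measurable_fun setT (fun e : 'rV[R]_n => \sum_(i <- s') h 0 i * e 0 i).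
  by apply: measurable_sum => i; apply: measurable_funM => //; exact: measurable_cst.
have mQ i : measurable_fun setT (fun e : 'rV[R]_n => h 0 i ^+ 2 * e 0 i ^+ 2 * N e).
  apply: measurable_funM => //; apply: measurable_funM; first exact: measurable_cst.
  exact: measurable_funX.
have Q0 i e : 0 <= h 0 i ^+ 2 * e 0 i ^+ 2 * N e.
  by apply: mulr_ge0 (N0 e); apply: mulr_ge0; exact: sqr_ge0.
have S0 s' e : 0 <= (\sum_(i <- s') h 0 i * e 0 i) ^+ 2 * N e.
  by apply: mulr_ge0 (N0 e); exact: sqr_ge0.
elim: s => [_|i s IH /= /andP[si us]].
  by apply: eq_integral => e _; rewrite !big_nil expr0n mul0r.
have mSN s' : measurable_fun setT
    (fun e : 'rV[R]_n => (\sum_(i <- s') h 0 i * e 0 i) ^+ 2 * N e).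
  by apply: measurable_funM => //; exact: measurable_funX.
rewrite (integral_flip_avg i) => [|//|e]; last by rewrite mulr_ge0 ?sqr_ge0.
transitivity (\int[U]_e (h 0 i ^+ 2 * e 0 i ^+ 2 * N e +
    (\sum_(j <- s) h 0 j * e 0 j) ^+ 2 * N e)%:E)%E.
  apply: eq_integral => e _; congr (_%:E); rewrite !big_cons N_flip.
  have -> : \sum_(j <- s) h 0 j * flip i e 0 j = \sum_(j <- s) h 0 j * e 0 j.
    apply: eq_big_seq => j js; rewrite mxE ifF//; apply/negbTE.
    by apply: contraNN si => /eqP <-.
  rewrite mxE eqxx.
  by move: (\sum_(j <- _) _) (N e) => *; field.
rewrite ge0_integralDr// IH// -ge0_integralDr//.
- by apply: eq_integral => e _; rewrite big_cons.
- exact: measurable_sum.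
- by move=> e; apply: sumr_ge0.
Qed.

(** Sign flips leave only the squares, transpositions give them equal weighted integrals, and these
    add up to the integral of [N] because [|e| = 1]. The weight is kept because the mirror step
    multiplies squared scalar products by the dual norm of [e]. *)
Lemma integral_sphere_quadratic h : (0 < n)%N ->
  (\int[U]_e (dotv h e ^+ 2 * N e)%:E =
   (dotv h h / n%:R)%:E * \int[U]_e (N e)%:E)%E.
Proof.
move=> n0; pose I i := (\int[U]_e (e 0 i ^+ 2 * N e)%:E)%E.
have mI i : measurable_fun setT (fun e : 'rV[R]_n => e 0 i ^+ 2 * N e).
  by apply: measurable_funM => //; exact: measurable_funX.
have I0 i (e : 'rV[R]_n) : 0 <= e 0 i ^+ 2 * N e by rewrite mulr_ge0 ?sqr_ge0.
have IE i j : I i = I j.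
  rewrite /I -(integral_swap i j (mI i)) => [|e]; last exact: I0.
  by apply: eq_integral => e _; rewrite N_swap mxE tpermL.
pose i0 := Ordinal n0.
have NI : (\int[U]_e (N e)%:E = n%:R%:E * I i0)%E.
  rewrite (@ge0_eq_integral_sphere N (fun e => \sum_i e 0 i ^+ 2 * N e)) //.
  - rewrite ge0_integral_sumr// (eq_bigr (fun=> I i0)) => [|i _]; last exact: IE.
    by rewrite sumr_const card_ord mule_natl.
  - exact: measurable_sum.
  - by move=> e; apply: sumr_ge0 => i _.
  move=> e /sphereE e1; rewrite -mulr_suml.
  by rewrite (_ : \sum_i _ = 1) ?mul1r// -e1; apply: eq_bigr => i _; rewrite expr2.
rewrite quadratic_signs; last exact: index_enum_uniq.
under eq_integral do under eq_bigr do rewrite -mulrA.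
rewrite ge0_integral_sumr; last 2 first.
- by move=> i; apply: measurable_funM => //; exact: measurable_cst.
- by move=> i e; rewrite mulr_ge0 ?sqr_ge0.
under eq_bigr do rewrite ge0_integralZr ?sqr_ge0//.
under eq_bigr => i _ do rewrite -/(I i) (IE i i0).
rewrite -ge0_sume_distrl => [|i _]; last by rewrite lee_fin sqr_ge0.
rewrite NI muleA -EFinM divfK ?pnatr_eq0 -?lt0n// sumEFin; congr (_%:E * _)%E.
Qed.

End invariant_weight.

Lemma integral_sphere_dotv2 h : (0 < n)%N ->
  (\int[U]_e (dotv h e ^+ 2)%:E = (dotv h h / n%:R)%:E)%E.
Proof.
move=> n0; have E1 : (\int[U]_e (1 : R)%:E = 1)%E.
  by rewrite integral_cst// mul1e; exact: probability_setT.
rewrite -[RHS]mule1 -[in RHS]E1 -(@integral_sphere_quadratic (fun=> 1))//.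
by apply: eq_integral => e _; rewrite mulr1.
Qed.

End uniform_sphere.

Section sphere_moments.
Context {R : realType} {n : nat} (U : probability 'rV[R]_n R).
Hypothesis unifU : uniform_on_sphere U.
Implicit Types (e : 'rV[R]_n) (c : R).

Let mcoord i : measurable_fun setT (fun e : 'rV[R]_n => e 0 i).
Proof. exact: measurable_coord. Qed.

Let msum c c' (s r : seq 'I_n) : measurable_fun setT (fun e : 'rV[R]_n =>
  expR (c * \sum_(i <- s) e 0 i + c' * \sum_(i <- r) e 0 i ^+ 2)).
Proof.
apply: measurableT_comp => //; apply: measurable_funD.
  by apply: measurable_funM; [exact: measurable_cst|exact: measurable_sum].
apply: measurable_funM; first exact: measurable_cst.
by apply: measurable_sum => i; exact: measurable_funX.
Qed.

(** Averaging over the sign of [e_i] replaces [expR (c * e_i)] by a hyperbolic cosine, at most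
    [expR (c^2 * e_i^2)]. The induction moves the coordinates one by one from the linear list [s] to
    the quadratic list [r]. *)
Let integral_exp_signs c (s r : seq 'I_n) : uniq s ->
  (\int[U]_e (expR (c * \sum_(i <- s) e 0 i + c ^+ 2 * \sum_(i <- r) e 0 i ^+ 2))%:E
   <= \int[U]_e (expR (c ^+ 2 * \sum_(i <- s ++ r) e 0 i ^+ 2))%:E)%E.
Proof.
elim: s r => [r _|i s IH r /= /andP[si us]].
  by under eq_integral do rewrite big_nil mulr0 add0r.
rewrite (integral_flip_avg unifU i); [|exact: msum|by move=> e; exact: expR_ge0].
apply: (@le_trans _ _ (\int[U]_e (expR (c * \sum_(j <- s) e 0 j +
    c ^+ 2 * \sum_(j <- i :: r) e 0 j ^+ 2))%:E)%E); last first.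
  apply: le_trans (IH _ us) _; rewrite le_eqVlt; apply/orP; left; apply/eqP.
  apply: eq_integral => e _; congr (expR (_ * _))%:E.
  by rewrite !(big_cons, big_cat)/= addrCA.
apply: ge0_le_integralr.
- apply: measurable_funM; first exact: measurable_cst.
  apply: measurable_funD; first exact: msum.
  exact: (measurableT_comp (msum c (c ^+ 2) (i :: s) r) (@measurable_flip _ _ i)).
- exact: msum.
- by move=> e; rewrite mulr_ge0 ?addr_ge0 ?expR_ge0.
- by move=> e; exact: expR_ge0.
apply: nearW => e; rewrite !big_cons.
have -> : \sum_(j <- s) flip i e 0 j = \sum_(j <- s) e 0 j.
  apply: eq_big_seq => j js; rewrite mxE ifF//; apply/negbTE.
  by apply: contraNN si => /eqP <-.
have -> : \sum_(j <- r) flip i e 0 j ^+ 2 = \sum_(j <- r) e 0 j ^+ 2.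
  by apply: eq_bigr => j _; rewrite mxE; case: ifP => // _; rewrite sqrrN.
rewrite mxE eqxx.
set X := \sum_(j <- s) _; set Y := \sum_(j <- r) _.
have -> : c * (e 0 i + X) + c ^+ 2 * Y = c * e 0 i + (c * X + c ^+ 2 * Y) by ring.
have -> : c * (- e 0 i + X) + c ^+ 2 * Y = - (c * e 0 i) + (c * X + c ^+ 2 * Y) by ring.
have -> : c * X + c ^+ 2 * (e 0 i ^+ 2 + Y) = (c * e 0 i) ^+ 2 + (c * X + c ^+ 2 * Y) by ring.
move: (c * X + _) => Z; rewrite !expRD -mulrDl mulrA ler_wpM2r ?expR_ge0//.
by have := expR_add_oppr_le (c * e 0 i); lra.
Qed.

(** A reflection exchanges the [i]-th axis with the diagonal, so [sqrt n * e_i] has the law of the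
    sum of all coordinates. The sign argument bounds the latter by the exponential of
    [c^2 |e|^2 = c^2]. For [n = 1] the reflecting vector [v] would vanish. *)
Lemma integral_exp_coord c i : (1 < n)%N ->
  (\int[U]_e (expR (c * (Num.sqrt n%:R * e 0 i)))%:E <= (expR (c ^+ 2))%:E)%E.
Proof.
move=> n1.
have n0 : 0 < n%:R :> R by rewrite ltr0n ltnW.
have sn0 : 0 < Num.sqrt n%:R :> R by rewrite sqrtr_gt0.
have sn1 : 1 < Num.sqrt n%:R :> R by rewrite -[ltLHS]sqrtr1 ltr_sqrt// ltr1n.
pose u : 'rV[R]_n := const_mx (Num.sqrt n%:R)^-1.
pose v := delta_mx 0 i - u.
have uu : dotv u u = 1.
  rewrite /dotv (eq_bigr (fun=> n%:R^-1)) => [|j _].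
    by rewrite sumr_const card_ord -[LHS]mulr_natl mulfV// gt_eqF.
  by rewrite !mxE -expr2 exprVn sqr_sqrtr// ltW.
have vv : dotv v v = 2 * (1 - (Num.sqrt n%:R)^-1).
  by rewrite /v !dotvBr !dotvBl !dotv_delta uu (dotvC _ u) dotv_delta !mxE !eqxx/=; ring.
have vv0 : dotv v v != 0.
  by rewrite vv mulf_neq0 ?subr_eq0// eq_sym lt_eqF// invf_lt1.
rewrite -(integral_reflect unifU vv0); last 2 first.
- apply: measurableT_comp => //; apply: measurable_funM; first exact: measurable_cst.
  by apply: measurable_funM => //; exact: measurable_cst.
- by move=> e; exact: expR_ge0.
have rE e : Num.sqrt n%:R * reflect v e 0 i = \sum_j e 0 j.
  have eu : dotv e u = (Num.sqrt n%:R)^-1 * \sum_j e 0 j.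
    by rewrite /dotv mulr_sumr; apply: eq_bigr => j _; rewrite mxE mulrC.
  rewrite /reflect /v mxE mxE mxE mxE -/v vv dotvBr dotv_delta eu !mxE !eqxx /= mulr1n.
  move: sn0 sn1; move: (Num.sqrt _) (\sum_j _) (e 0 i) => t a b t0 t1; field.
  by rewrite (gt_eqF t0) subr_eq0 (gt_eqF t1).
under eq_integral do rewrite rE.
apply: (@le_trans _ _ (\int[U]_e (expR (c ^+ 2 * \sum_i e 0 i ^+ 2))%:E)%E).
  have := @integral_exp_signs c (index_enum 'I_n) [::] (index_enum_uniq _).
  rewrite cats0; apply: le_trans; rewrite le_eqVlt; apply/orP; left; apply/eqP.
  by apply: eq_integral => e _; rewrite big_nil mulr0 addr0.
rewrite (@ge0_eq_integral_sphere _ _ _ unifU _ (fun=> expR (c ^+ 2))) //.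
- rewrite integral_cst// -[leRHS]mule1 lee_pmul2l ?lte_fin ?expR_gt0//.
  exact: probability_le1.
- have := @msum 0 (c ^+ 2) [::] (index_enum _).
  by under [X in measurable_fun _ X]eq_fun do rewrite mul0r add0r.
move=> e /sphereE e1; by rewrite (_ : \sum_i _ = 1) ?mulr1.
Qed.

Variable p : nat.
Hypotheses (n8 : (8 <= n)%N) (p12 : p \in [:: 1%N; 2%N]).

Let N := @dnorm2 R n (dual_exp n p) (Omega n p).

Let q0 : dual_exp n p != 0 :> R.
Proof. by rewrite gt_eqF// (lt_le_trans _ (dual_exp_ge2 p n8)). Qed.

Lemma measurable_lnorm r : measurable_fun setT (lnorm r : 'rV[R]_n -> R).
Proof.
have ms : measurable_fun setT (fun x : 'rV[R]_n => \sum_i `|x 0 i| `^ r).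
  apply: measurable_sum => i.
  have mn : measurable_fun setT (fun x : 'rV[R]_n => `|x 0 i|).
    exact: (measurableT_comp (@normr_measurable R setT) (mcoord i)).
  exact: (measurableT_comp (@measurable_powR R r) mn).
exact: (measurableT_comp (@measurable_powR R r^-1) ms).
Qed.

Lemma measurable_dnorm2 : measurable_fun setT N.
Proof.
apply: measurable_funM; first exact: measurable_cst.
by apply: measurable_funX; exact: measurable_lnorm.
Qed.

Lemma dnorm2_flip i e : N (flip i e) = N e.
Proof.
rewrite /N /dnorm2.
suff -> : lnorm (dual_exp n p) (flip i e) = lnorm (dual_exp n p) e by [].
rewrite /lnorm; congr (_ `^ _); apply: eq_bigr => j _.
by rewrite mxE; case: ifP => // _; rewrite normrN.
Qed.

Lemma dnorm2_swap i j e : N (swap i j e) = N e.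
Proof.
rewrite /N /dnorm2.
suff -> : lnorm (dual_exp n p) (swap i j e) = lnorm (dual_exp n p) e by [].
rewrite /lnorm; congr (_ `^ _); rewrite [RHS](reindex_inj (@perm_inj _ (tperm i j))).
by apply: eq_bigr => l _; rewrite mxE.
Qed.

Let N0 e : 0 <= N e.
Proof.
have w0 : 0 < Omega n p :> R by exact: lt_le_trans (Omega_ge1 p n8).
exact: dnorm2_ge0 (dual_exp_ge2 p n8) w0 e.
Qed.

(** For p = 1 the dual norm is at most the largest squared coordinate, whose exponential moments are
    bounded by the sum over all coordinates. For p = 2 it is 1 on the sphere. *)
Lemma integral_sphere_dnorm2 : (\int[U]_e (N e)%:E <= (rho n p)%:E)%E.
Proof.
have n0 : 0 < n%:R :> R by rewrite ltr0n; exact: leq_trans n8.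
have [p1|p2] : p = 1%N \/ p = 2%N.
  by move: p12; rewrite !inE => /orP[]/eqP; [left|right].
(* With [l^2 = ln n] each exponential moment is at most [n], and the prefactor [expR (- 2 l^2)] is
   [n^-2]: the sum of [2 n] such moments contributes only [8 / n]. *)
- pose l := Num.sqrt (ln n%:R) : R.
  have L32 := @ln_ge_32 R n n8.
  have l2 : l ^+ 2 = ln n%:R by rewrite sqr_sqrtr//; lra.
  have l1 : 1 <= l by rewrite -[leLHS]sqrtr1 ler_sqrt//; lra.
  have en : expR (l ^+ 2) = n%:R by rewrite l2 lnK ?posrE.
  have en2 : expR (- (2 * l ^+ 2)) = n%:R ^- 2.
    by rewrite expRN -en -expRM_natl.
  pose E c i e := expR (c * (Num.sqrt n%:R * e 0 i)).
  have mE c i : measurable_fun setT (E c i).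
    apply: measurableT_comp => //; apply: measurable_funM; first exact: measurable_cst.
    by apply: measurable_funM => //; exact: measurable_cst.
  have E0 c i e : 0 <= E c i e by exact: expR_ge0.
  pose M e := 4 * l ^+ 2 / n%:R + (4 * n%:R ^- 2 / n%:R) * \sum_i (E l i e + E (- l) i e).
  have S0 e : 0 <= \sum_i (E l i e + E (- l) i e).
    by apply: sumr_ge0 => i _; rewrite addr_ge0.
  have c0 : 0 <= 4 * n%:R ^- 2 / n%:R :> R by rewrite !mulr_ge0 ?invr_ge0 ?exprn_ge0 ?(ltW n0).
  have d0 : 0 <= 4 * l ^+ 2 / n%:R by rewrite divr_ge0 ?(ltW n0)// mulr_ge0 ?sqr_ge0.
  have NM e : N e <= M e.
    apply: dnorm2_le_max => // i.
    have := sqr_le_expR (Num.sqrt n%:R * e 0 i) l1.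
    rewrite mulrN -mulNr -/(E l i e) -/(E (- l) i e) en2 exprMn sqr_sqrtr ?(ltW n0)// => h.
    rewrite -(ler_pM2l n0); apply: le_trans h _.
    have -> : n%:R * M e = 4 * l ^+ 2 + 4 * n%:R ^- 2 * \sum_i (E l i e + E (- l) i e).
      by rewrite /M; move: (\sum_i _) => z; field; rewrite gt_eqF.
    rewrite lerD2l ler_wpM2l ?mulr_ge0 ?invr_ge0 ?exprn_ge0 ?(ltW n0)//.
    rewrite [leRHS](bigD1 i)//= lerDl; apply: sumr_ge0 => j _; exact: addr_ge0.
  have mS : measurable_fun setT (fun e => \sum_i (E l i e + E (- l) i e)).
    by apply: measurable_sum => i; exact: measurable_funD.
  apply: (@le_trans _ _ (\int[U]_e (M e)%:E)%E).
    apply: ge0_le_integralr => //; first exact: measurable_dnorm2.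
    - apply: measurable_funD; first exact: measurable_cst.
      by apply: measurable_funM => //; exact: measurable_cst.
    - by move=> e; rewrite addr_ge0// mulr_ge0.
    exact: nearW.
  rewrite ge0_integralDr//; last 2 first.
  - by apply: measurable_funM => //; exact: measurable_cst.
  - by move=> e; rewrite mulr_ge0.
  rewrite (ge0_integralZr U mS S0 c0) ge0_integral_sumr; last 2 first.
  - by move=> i; exact: measurable_funD.
  - by move=> i e; exact: addr_ge0.
  have Sle : (\sum_i \int[U]_e (E l i e + E (- l) i e)%:E <= (n%:R * (2 * n%:R) : R)%:E)%E.
    rewrite [leRHS](_ : _ = (\sum_(i < n) (2 * n%:R : R)%:E)%E); last first.
      by rewrite sumEFin sumr_const card_ord mulr_natl.
    apply: lee_sum => i _; rewrite ge0_integralDr// mulr2n mulrDl mul1r EFinD.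
    have n1 : (1 < n)%N by exact: leq_trans n8.
    have h1 := integral_exp_coord l i n1; have h2 := integral_exp_coord (- l) i n1.
    by rewrite sqrrN en in h2; rewrite en in h1; exact: leeD.
  apply: (@le_trans _ _ ((4 * l ^+ 2 / n%:R)%:E +
      (4 * n%:R ^- 2 / n%:R)%:E * (n%:R * (2 * n%:R))%:E)%E).
    apply: leeD; last by apply: lee_wpmul2l => //; rewrite lee_fin.
    rewrite integral_cst// -[leRHS]mule1 lee_wpmul2l ?lee_fin//.
    exact: probability_le1.
  rewrite -EFinM -EFinD lee_fin rho1// l2 -subr_ge0.
  (* The bound obtained is [(4 ln n + 8) / n]; it is below [rho] because [12 ln n >= 18 > 16]. *)
  have -> : (16 * ln n%:R - 8) / n%:R - (4 * ln n%:R / n%:R + 4 * n%:R ^- 2 / n%:R * (n%:R * (2 * n%:R)))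
    = (12 * ln n%:R - 16) / n%:R :> R by field; rewrite gt_eqF.
  by rewrite divr_ge0 ?(ltW n0)//; lra.
- rewrite rho2// (@ge0_eq_integral_sphere _ _ _ unifU _ (fun=> 1))//.
  + by rewrite integral_cst// mul1e; exact: probability_le1.
  + exact: measurable_dnorm2.
  by move=> e /sphereE e1; rewrite /N dnorm2_2.
Qed.

End sphere_moments.

(** * The objective and its gradient *)

Lemma le_1Dsqr {R : realType} (a : R) : a <= 1 + a ^+ 2.
Proof. by have := sqr_ge0 (a - 1); have := sqr_ge0 a; nra. Qed.

Section real_integrable.
Context {R : realType} {d : measure_display} {T : measurableType d}.
Variable P : probability T R.
Implicit Types f g : T -> R.

Definition rintegrable f := P.-integrable setT (EFin \o f).

Lemma rintegrable_measurable f : rintegrable f -> measurable_fun setT f.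
Proof. by move=> /integrableP[/measurable_EFinP]. Qed.

Lemma rintegrable_cst c : rintegrable (fun=> c).
Proof. exact: finite_measure_integrable_cst. Qed.

Lemma rintegrableD f g : rintegrable f -> rintegrable g ->
  rintegrable (fun x => f x + g x).
Proof. by move=> If Ig; have := integrableD measurableT If Ig. Qed.

Lemma rintegrableZ c f : rintegrable f -> rintegrable (fun x => c * f x).
Proof. by move=> If; have := integrableZl measurableT c If. Qed.

Lemma rintegrableB f g : rintegrable f -> rintegrable g ->
  rintegrable (fun x => f x - g x).
Proof.
move=> If Ig; have := rintegrableD If (rintegrableZ (-1) Ig).
by under eq_fun do rewrite mulN1r.
Qed.

Lemma rintegrable_dom f g : measurable_fun setT f ->
  (forall x, `|f x| <= g x) -> rintegrable g -> rintegrable f.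
Proof.
move=> mf fg; apply: le_integrable => //; first exact/measurable_EFinP.
move=> x _ /=; rewrite lee_fin (le_trans (fg x))//; exact: ler_norm.
Qed.

Lemma rintegrable_norm f : rintegrable f -> rintegrable (fun x => `|f x|).
Proof. by move=> If; have := integrable_abse If. Qed.

Lemma rintegrable_sqr_le f (c : R) : measurable_fun setT f ->
  (\int[P]_x (f x ^+ 2)%:E <= c%:E)%E -> rintegrable (fun x => f x ^+ 2).
Proof.
move=> mf fc; apply/integrableP; split.
  by apply/measurable_EFinP; exact: measurable_funX.
apply: le_lt_trans (ltry c); apply: le_trans fc; rewrite le_eqVlt; apply/orP; left.
by apply/eqP; apply: eq_integral => x _ /=; rewrite ger0_norm ?sqr_ge0.
Qed.

Lemma rintegrable_of_sqr f : measurable_fun setT f ->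
  rintegrable (fun x => f x ^+ 2) -> rintegrable f.
Proof.
move=> mf If; apply: (rintegrable_dom mf) (rintegrableD (rintegrable_cst 1) If) => x.
by have := le_1Dsqr `|f x|; rewrite real_normK ?num_real.
Qed.

Lemma EFin_Rintegral f : rintegrable f ->
  (\int[P]_x (f x)%:E = (\int[P]_x f x)%:E)%E.
Proof. by move=> If; rewrite /Rintegral fineK//; exact: integrable_fin_num. Qed.

(** Replacing [g] by the maximum of [f] and [g] changes it only on a null set and makes the
    comparison hold everywhere. *)
Lemma ae_le_Rintegral f g : rintegrable f -> rintegrable g ->
  {ae P, forall x, f x <= g x} -> \int[P]_x f x <= \int[P]_x g x.
Proof.
move=> If Ig fg.
have mf := rintegrable_measurable If; have mg := rintegrable_measurable Ig.
have mM : measurable_fun setT (fun x => Num.max (f x) (g x)) by exact: measurable_maxr.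
have -> : \int[P]_x g x = \int[P]_x Num.max (f x) (g x).
  congr fine; apply: ae_eq_integral => //.
  - exact/measurable_EFinP.
  - exact/measurable_EFinP.
  by apply: filterS fg => x fgx _; rewrite max_r.
apply: le_Rintegral => //; last by move=> x _; rewrite le_max lexx.
apply: (rintegrable_dom mM) (rintegrableD (rintegrable_norm If) (rintegrable_norm Ig)).
by move=> x; case: (leP (f x) (g x)) => _; rewrite ?lerDl ?lerDr.
Qed.

Lemma RintegralDr f g : rintegrable f -> rintegrable g ->
  \int[P]_x (f x + g x) = \int[P]_x f x + \int[P]_x g x.
Proof. by move=> If Ig; exact: RintegralD. Qed.

Lemma RintegralBr f g : rintegrable f -> rintegrable g ->
  \int[P]_x (f x - g x) = \int[P]_x f x - \int[P]_x g x.
Proof. by move=> If Ig; exact: RintegralB. Qed.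

Lemma RintegralZr c f : rintegrable f -> \int[P]_x (c * f x) = c * \int[P]_x f x.
Proof. by move=> If; exact: RintegralZl. Qed.

Lemma Rintegral_cstr c : \int[P]_x c = c.
Proof.
have P1 : fine (P setT) = 1 by rewrite probability_setT.
by apply: etrans (Rintegral_cst _ measurableT c) _; rewrite -[RHS]mulr1 -P1.
Qed.

Lemma rintegrable_sum (I : Type) (s : seq I) (f : I -> T -> R) :
  (forall i, rintegrable (f i)) -> rintegrable (fun x => \sum_(i <- s) f i x).
Proof.
move=> If; elim: s => [|i s IH].
  by under eq_fun do rewrite big_nil; exact: rintegrable_cst.
by under eq_fun do rewrite big_cons; exact: rintegrableD.
Qed.

Lemma Rintegral_sum (I : Type) (s : seq I) (f : I -> T -> R) :
  (forall i, rintegrable (f i)) ->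
  \int[P]_x (\sum_(i <- s) f i x) = \sum_(i <- s) \int[P]_x f i x.
Proof.
move=> If; elim: s => [|i s IH].
  by rewrite big_nil; under eq_Rintegral do rewrite big_nil; exact: Rintegral_cstr.
rewrite big_cons -IH -RintegralDr//; last exact: rintegrable_sum.
by apply: eq_Rintegral => x _; rewrite big_cons.
Qed.

Lemma integral_sqr_shift f (c : R) : measurable_fun setT f ->
  rintegrable (fun x => f x ^+ 2) -> \int[P]_x f x = 0 ->
  (\int[P]_x ((c + f x) ^+ 2)%:E = (c ^+ 2 + \int[P]_x f x ^+ 2)%:E)%E.
Proof.
move=> mf I2 f0; have If := rintegrable_of_sqr mf I2.
have Ic := rintegrableZ (2 * c) If.
transitivity (\int[P]_x (c ^+ 2 + (2 * c * f x + f x ^+ 2))%:E)%E.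
  by apply: eq_integral => x _; congr (_%:E); ring.
rewrite EFin_Rintegral; last first.
  by apply: rintegrableD; [exact: rintegrable_cst|exact: rintegrableD].
congr (_%:E); rewrite RintegralDr; [|exact: rintegrable_cst|exact: rintegrableD].
by rewrite RintegralDr// RintegralZr// f0 mulr0 add0r Rintegral_cstr.
Qed.

End real_integrable.

Section objective_function.
Context {R : realType} {n : nat} {d : measure_display} {X : measurableType d}.
Variable P : probability X R.
Variables (F : 'rV[R]_n -> X -> R) (g : 'rV[R]_n -> X -> 'rV[R]_n) (L : X -> R).
Variables (L2 sigma : R).
Hypotheses (L20 : 0 < L2) (SP : stochastic_problem P F g L L2 sigma).
Local Notation f := (objective P F).
Implicit Types x y v e : 'rV[R]_n.

Lemma integral_L2 : (\int[P]_xi (L xi ^+ 2)%:E <= (L2 ^+ 2)%:E)%E.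
Proof.
have := sp_L2 SP; rewrite unlock.
have : (0 <= \int[P]_xi (L xi ^+ 2)%:E)%E.
  by apply: integral_ge0 => xi _; rewrite lee_fin sqr_ge0.
case: (integral _ _ _) => [r| |]//=; rewrite lee_fin => r0; rewrite !lee_fin => h.
by rewrite -(sqr_sqrtr r0) lerXn2r ?nnegrE ?sqrtr_ge0// ltW.
Qed.

Lemma rintegrable_L2 : rintegrable P (fun xi => L xi ^+ 2).
Proof. exact: rintegrable_sqr_le (sp_measurable_L SP) integral_L2. Qed.

Lemma measurable_gradient x : measurable_fun setT (g x).
Proof. exact: (measurableT_comp (sp_measurable_g SP) (measurable_pair1 x)). Qed.

Let mgB x : measurable_fun setT (fun xi => g x xi - grad f x).
Proof. by apply: measurable_subv; [exact: measurable_gradient|exact: measurable_cst]. Qed.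

Lemma integral_variance x :
  (\int[P]_xi (dotv (g x xi - grad f x) (g x xi - grad f x))%:E <= (sigma ^+ 2)%:E)%E.
Proof.
apply: le_trans (sp_variance SP x); rewrite unlock le_eqVlt; apply/orP; left.
by apply/eqP; apply: eq_integral => xi _; rewrite lnorm2_sqr.
Qed.

(** The variance bound makes the deviation from [grad f x] square integrable. At this point
    [grad f x] is only a constant vector, so there is no circularity with the identification of the
    mean. *)
Lemma rintegrable_gradient x i : rintegrable P (fun xi => g x xi 0 i).
Proof.
have mB : measurable_fun setT (fun xi => (g x xi - grad f x) 0 i).
  exact: measurable_coordT.
have I2 : rintegrable P (fun xi => (g x xi - grad f x) 0 i ^+ 2).
  apply: (rintegrable_sqr_le (c := sigma ^+ 2)) => //.
  apply: le_trans (integral_variance x); apply: ge0_le_integral => //.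
  - by move=> xi _; rewrite lee_fin sqr_ge0.
  - by apply/measurable_EFinP; exact: measurable_funX.
  - by apply/measurable_EFinP; exact: measurable_dotv.
  move=> xi _; rewrite lee_fin /dotv (bigD1 i)//= -expr2 lerDl.
  by apply: sumr_ge0 => j _; rewrite -expr2 sqr_ge0.
have := rintegrableD (rintegrable_of_sqr mB I2) (rintegrable_cst P (grad f x 0 i)).
by under eq_fun do rewrite [in X in X + _]mxE [in X in _ + X + _]mxE subrK.
Qed.

Let line_derive (h : 'rV[R]_n -> R) x v (t : R) : derivable h (t *: v + x) v ->
  is_derive t 1 (fun s : R => h (s *: v + x)) ('D_v h (t *: v + x)).
Proof.
move=> dh.
have E : (fun s : R => s^-1 *: (((fun s : R => h (s *: v + x)) \o shift t) (s *: 1) - h (t *: v + x))) =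
         (fun s : R => s^-1 *: ((h \o shift (t *: v + x)) (s *: v) - h (t *: v + x))).
  apply/funext => s; congr (_ *: (h _ - _)) => /=.
  by rewrite [s *: 1]mulr1 scalerDl addrA.
by apply: DeriveDef; rewrite /derivable/derive E.
Qed.

(** The mean value theorem along the [i]-th axis and the Lipschitz bound give a remainder [h^2 * L].
    The larger factor [1 + L^2] is nonnegative, and the second moment of [L] makes it integrable. *)
Lemma ae_gradient_expansion x i (h : R) : {ae P, forall xi,
  `|F (h *: delta_mx 0 i + x) xi - F x xi - h * g x xi 0 i| <= h ^+ 2 * (1 + L xi ^+ 2)}.
Proof.
apply: filterS2 (sp_gradient SP) (sp_lipschitz SP) => xi dF Lg.
set v := delta_mx 0 i; pose phi (t : R) := F (t *: v + x) xi.
have dphi (t : R) : is_derive t 1 phi (g (t *: v + x) xi 0 i).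
  have [df <-] := dF (t *: v + x); rewrite mxE -/v.
  by apply: line_derive; apply: diff_derivable.
have cphi a b : {within `[a, b], continuous phi}.
  apply/continuous_subspaceT => t.
  by apply/differentiable_continuous/derivable1_diffP; have [] := dphi t.
have phi0 : phi 0 = F x xi by rewrite /phi scale0r add0r.
have vv : lnorm 2 v = 1.
  by rewrite lnorm2E dotv_delta mxE !eqxx sqrtr1.
have Lc c : `|g (c *: v + x) xi 0 i - g x xi 0 i| <= (1 + L xi ^+ 2) * `|c|.
  have := Lg (c *: v + x) x; rewrite addrK lnorm2E => h1.
  have h2 : `|g (c *: v + x) xi 0 i - g x xi 0 i| <= L xi * `|c|.
    have nv : lnorm 2 (c *: v) = `|c|.
      rewrite lnorm2E dotvZl dotvZr mulrA dotv_delta mxE !eqxx mulr1 -expr2.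
      exact: sqrtr_sqr.
    rewrite nv in h1; apply: le_trans h1; rewrite -sqrtr_sqr ler_sqrt ?dotv_ge0//.
    rewrite /dotv (bigD1 i)//= !mxE -expr2 lerDl.
    by apply: sumr_ge0 => j _; rewrite -expr2 sqr_ge0.
  apply: le_trans h2 _; rewrite ler_wpM2r//; exact: le_1Dsqr.
have key c : `|c| <= `|h| -> F (h *: v + x) xi - F x xi = g (c *: v + x) xi 0 i * h ->
    `|F (h *: v + x) xi - F x xi - h * g x xi 0 i| <= h ^+ 2 * (1 + L xi ^+ 2).
  move=> ch ->; rewrite (mulrC h) -mulrBl normrM -[h ^+ 2]real_normK ?num_real//.
  rewrite expr2 -mulrA (mulrC `|h|); apply: ler_wpM2r => //.
  apply: le_trans (Lc c) _; rewrite mulrC ler_wpM2r// addr_ge0 ?sqr_ge0//.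
have [h0|h0|->] := ltgtP h 0.
- have [c /andP[hc c0]] := MVT h0 (fun t _ => dphi t) (cphi h 0).
  rewrite phi0 sub0r => E; apply: (key c).
    by rewrite !ltr0_norm// lerN2 ltW.
  by rewrite -/(phi h) -opprB E mulrN opprK.
- have [c /andP[c0 ch]] := MVT h0 (fun t _ => dphi t) (cphi 0 h).
  rewrite phi0 subr0 => E; apply: (key c) => //.
  by rewrite !gtr0_norm// ltW.
- by rewrite scale0r add0r subrr mul0r subrr normr0 expr0n mul0r.
Qed.

Lemma objectiveE x : f x = \int[P]_xi F x xi.
Proof. by rewrite /objective unlock. Qed.

(** Integrating the first-order expansion leaves a remainder of order [h^2], so the difference
    quotient of the objective tends to the mean of the gradients. *)
Lemma grad_objective x i : grad f x 0 i = \int[P]_xi g x xi 0 i.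
Proof.
rewrite mxE; set v := delta_mx 0 i; set l := Rintegral _ _ _.
pose K := \int[P]_xi (1 + L xi ^+ 2).
have IK : rintegrable P (fun xi => 1 + L xi ^+ 2).
  by apply: rintegrableD; [exact: rintegrable_cst|exact: rintegrable_L2].
have K1 : 0 < K.
  rewrite /K RintegralDr; [|exact: rintegrable_cst|exact: rintegrable_L2].
  rewrite Rintegral_cstr ltr_wpDr// ; first by apply: Rintegral_ge0 => xi _; exact: sqr_ge0.
have IF y : rintegrable P (F y) by exact: sp_integrable SP y.
have Ig := rintegrable_gradient x i.
have bound (h : R) : `|f (h *: v + x) - f x - h * l| <= h ^+ 2 * K.
  have ID : rintegrable P (fun xi => F (h *: v + x) xi - F x xi - h * g x xi 0 i).
    by apply: rintegrableB; [exact: rintegrableB|exact: rintegrableZ].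
  have -> : f (h *: v + x) - f x - h * l =
      \int[P]_xi (F (h *: v + x) xi - F x xi - h * g x xi 0 i).
    rewrite RintegralBr; [|exact: rintegrableB|exact: rintegrableZ].
    by rewrite RintegralBr// RintegralZr// !objectiveE.
  apply: le_trans (le_normr_Rintegral measurableT ID) _.
  rewrite /K -RintegralZr//; apply: ae_le_Rintegral.
  - exact: rintegrable_norm.
  - exact: rintegrableZ.
  - exact: ae_gradient_expansion.
apply/cvg_lim => //; apply/cvgrPdist_le => e e0.
exists (e / K) => /=; first by rewrite divr_gt0.
move=> h /=; rewrite sub0r normrN => he h0.
rewrite distrC /GRing.scale/=.
have hp : 0 < `|h| by rewrite normr_gt0.
rewrite -(ler_pM2l hp) -normrM mulrBr mulVKf//.
apply: le_trans (bound h) _; rewrite -real_normK ?num_real// expr2 -mulrA.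
by rewrite ler_wpM2l// -ler_pdivlMr// ltW.
Qed.

Lemma Rintegral_gradient_dotv x v : rintegrable P (fun xi => dotv (g x xi) v) /\
  \int[P]_xi dotv (g x xi) v = dotv (grad f x) v.
Proof.
have I i : rintegrable P (fun xi => v 0 i * g x xi 0 i).
  by apply: rintegrableZ; exact: rintegrable_gradient.
have E : (fun xi => dotv (g x xi) v) = (fun xi => \sum_i v 0 i * g x xi 0 i).
  by apply/funext => xi; apply: eq_bigr => i _; rewrite mulrC.
rewrite E; split; first exact: rintegrable_sum.
rewrite Rintegral_sum//; apply: eq_bigr => i _.
by rewrite RintegralZr ?grad_objective 1?mulrC//; exact: rintegrable_gradient.
Qed.

(** With [v] the difference of the two gradients, [|v|^2] is the mean of the products of [g x - g y]
    with [v]. Young's inequality bounds it by half the mean of [|g x - g y|^2] plus [|v|^2 / 2], and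
    the last term is absorbed. *)
Lemma grad_objective_lipschitz x y :
  dotv (grad f x - grad f y) (grad f x - grad f y) <= L2 ^+ 2 * dotv (x - y) (x - y).
Proof.
set v := grad f x - grad f y.
have [Ix Ex] := Rintegral_gradient_dotv x v.
have [Iy Ey] := Rintegral_gradient_dotv y v.
have IL := rintegrableZ (dotv (x - y) (x - y)) rintegrable_L2.
have E : dotv v v = \int[P]_xi (dotv (g x xi) v - dotv (g y xi) v).
  by rewrite RintegralBr// Ex Ey -dotvBl.
have h : \int[P]_xi (dotv (g x xi) v - dotv (g y xi) v) <=
    \int[P]_xi (2^-1 * (dotv (x - y) (x - y) * L xi ^+ 2) + 2^-1 * dotv v v).
  apply: ae_le_Rintegral; first exact: rintegrableB.
    by apply: rintegrableD; [exact: rintegrableZ|exact: rintegrable_cst].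
  apply: filterS (sp_lipschitz SP) => xi /(_ x y) Lxy; rewrite -dotvBl.
  have := dotv_young (g x xi - g y xi) v (@ltr01 R).
  rewrite mulr1 mul1r => /le_trans; apply; rewrite lerD2r.
  rewrite ler_wpM2l// -!lnorm2_sqr mulrC -exprMn.
  rewrite lerXn2r ?nnegrE ?lnorm_ge0//.
  exact: le_trans (lnorm_ge0 _ _) Lxy.
have LL : \int[P]_xi L xi ^+ 2 <= L2 ^+ 2.
  by rewrite -lee_fin -EFin_Rintegral; [exact: integral_L2|exact: rintegrable_L2].
have E2 : \int[P]_xi (2^-1 * (dotv (x - y) (x - y) * L xi ^+ 2) + 2^-1 * dotv v v) =
    2^-1 * (dotv (x - y) (x - y) * \int[P]_xi L xi ^+ 2) + 2^-1 * dotv v v.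
  rewrite RintegralDr; [|exact: rintegrableZ|exact: rintegrable_cst].
  rewrite (RintegralZr _ IL) (RintegralZr _ rintegrable_L2).
  by congr (_ + _); exact: Rintegral_cstr.
rewrite E2 -E in h.
have := ler_wpM2l (dotv_ge0 (x - y)) LL.
rewrite (mulrC (L2 ^+ 2)).
move: h; clear E E2 Ex Ey LL.
by move: (_ * Rintegral _ _ _) (dotv v v) (_ * L2 ^+ 2) => a b c; lra.
Qed.

Section convex_objective.
Hypothesis convf : forall x y, f x + dotv (grad f x) (y - x) <= f y.

(** Convexity at [y] bounds [f y - f x] by the slope at [y]; exchanging it for the slope at [x]
    costs [L2 |y - x|^2], by Young's inequality with parameter [1 / L2]. *)
Lemma objective_descent x y :
  f y <= f x + dotv (grad f x) (y - x) + L2 * dotv (y - x) (y - x).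
Proof.
have h1 := convf y x.
have h2 := grad_objective_lipschitz y x.
have := dotv_young (grad f y - grad f x) (y - x) (_ : 0 < L2^-1).
rewrite invr_gt0 => /(_ L20); rewrite dotvBl.
have E : dotv (grad f y) (x - y) = - dotv (grad f y) (y - x).
  by rewrite -dotvNr opprB.
rewrite {}E in h1 => h3.
have h4 : L2^-1 / 2 * dotv (grad f y - grad f x) (grad f y - grad f x) <=
    L2^-1 / 2 * (L2 ^+ 2 * dotv (y - x) (y - x)).
  by rewrite ler_wpM2l// divr_ge0// invr_ge0 ltW.
have e1 : L2^-1 / 2 * (L2 ^+ 2 * dotv (y - x) (y - x)) = L2 / 2 * dotv (y - x) (y - x).
  by move: (dotv _ _) => z; field; rewrite gt_eqF.
have e2 : (2 * L2^-1)^-1 = L2 / 2 by rewrite invfM invrK mulrC.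
rewrite e1 in h4; rewrite e2 in h3.
move: (f x) (f y) (dotv (grad f y) (y - x)) (dotv (grad f x) (y - x)) h1 h3 h4.
by move: (dotv (y - x) (y - x)) (_ * dotv _ _) => *; lra.
Qed.

(** The tangent from below and the quadratic bound from above squeeze the objective. Continuity is
    what gives its Borel measurability. *)
Lemma continuous_objective : continuous f.
Proof.
move=> x.
have cB : (fun y : 'rV[R]_n => dotv (grad f x) (y - x)) @ x --> (0 : R).
  have -> : (fun y : 'rV[R]_n => dotv (grad f x) (y - x)) =
      (fun y => dotv (grad f x) y - dotv (grad f x) x).
    by apply/funext => y; rewrite dotvBr.
  rewrite -(subrr (dotv (grad f x) x)).
  by apply: (@cvgB _ _ _ (nbhs x)); [exact: continuous_dotvl|exact: cvg_cst].
have cQ : (fun y : 'rV[R]_n => dotv (y - x) (y - x)) @ x --> (0 : R).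
  rewrite -[X in _ --> X](_ : dotv (x - x) (x - x) = 0); last by rewrite subrr dotv0r.
  apply: (@cvg_sumr _ _ _ (nbhs x)) => i.
  have ci : (fun y : 'rV[R]_n => (y - x) 0 i) @ x --> (x - x) 0 i.
    have -> : (fun y : 'rV[R]_n => (y - x) 0 i) = (fun y => y 0 i - x 0 i).
      by apply/funext => y; rewrite !mxE.
    rewrite [X in _ --> X]mxE [X in _ --> _ + X]mxE.
    by apply: (@cvgB _ _ _ (nbhs x)); [exact: coord_continuous|exact: cvg_cst].
  exact: (@cvgM _ _ (nbhs x)).
have cl : f x + dotv (grad f x) (y - x) @[y --> x] --> f x.
  rewrite -[X in _ --> X]addr0.
  by apply: (@cvgD _ _ _ (nbhs x)) => //; exact: cvg_cst.
have cu : f x + dotv (grad f x) (y - x) + L2 * dotv (y - x) (y - x) @[y --> x] --> f x.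
  rewrite -[X in _ --> X]addr0 -[X in _ --> _ + X](mulr0 L2).
  apply: (@cvgD _ _ _ (nbhs x)) => //.
  by apply: (@cvgM _ _ (nbhs x)) => //; exact: cvg_cst.
apply: squeeze_cvgr cl cu; apply: nearW => y.
by rewrite convf objective_descent.
Qed.

Lemma measurable_objective : measurable_fun setT f.
Proof. exact: continuous_measurable_rV continuous_objective. Qed.

End convex_objective.

End objective_function.

(** * Batches of independent draws *)

Lemma integral_cst_probability (R : realType) (d : measure_display)
    (T : measurableType d) (mu : probability T R) (c : R) :
  (\int[mu]_x c%:E)%E = c%:E.
Proof.
have -> : (\int[mu]_x c%:E)%E = (c%:E * mu setT)%E by apply: integral_cst.
have mu1 : mu setT = 1%E := probability_setT mu.
by transitivity (c%:E * 1)%E; [congr (_ * _)%E|rewrite mule1].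
Qed.

Section draws.
Context {R : realType} {n : nat} {d : measure_display} {X : measurableType d}.
Variable P : probability X R.
Context {d' : measure_display} {T : measurableType d'} (Pr : probability T R).
Variables (e : nat -> nat -> {RV Pr >-> 'rV[R]_n})
          (xi : nat -> nat -> nat -> {RV Pr >-> X}).
Hypothesis RD : random_draws P e xi.

Definition draw_index : Type := ((nat * nat) + (nat * nat * nat))%type.

Definition draw_events (a : draw_index) : set (set T) :=
  match a with
  | inl (k, j) => preimage_set_system setT (e k j) measurable
  | inr (k, j, i) => preimage_set_system setT (xi k j i) measurable
  end.

Lemma measurable_draw_events a : draw_events a `<=` measurable.
Proof.
by case: a => [[k j]|[[k j] i]] _ [A mA <-]; exact: measurable_funPT.
Qed.

Lemma draw_eventsT a : draw_events a setT.
Proof.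
by case: a => [[k j]|[[k j] i]]; exists setT => //; rewrite preimage_setT setIT.
Qed.

Lemma draw_events_setI a : setI_closed (draw_events a).
Proof.
case: a => [[k j]|[[k j] i]] _ _ [A mA <-] [B mB <-]; exists (A `&` B);
  rewrite ?setTI ?preimage_setI//; exact: measurableI.
Qed.

Let Cm := measurable_draw_events.
Let CT := draw_eventsT.
Let CI := draw_events_setI.

(** The sample space with the sigma-algebra of the draws in [S] alone; being measurable on it
    expresses dependence on these draws only. *)
Definition draws (S : set draw_index) := g_sigma_algebraType (cylinders draw_events S).

Lemma measurable_draw_e S k j : S (inl (k, j)) ->
  measurable_fun setT (e k j : draws S -> 'rV[R]_n).
Proof.
move=> Skj; apply: (measurable_block (i := inl (k, j))) => //= A mA.
by exists A => //; rewrite setTI.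
Qed.

Lemma measurable_draw_xi S k j i : S (inr (k, j, i)) ->
  measurable_fun setT (xi k j i : draws S -> X).
Proof.
move=> Skj; apply: (measurable_block (i := inr (k, j, i))) => //= A mA.
by exists A => //; rewrite setTI.
Qed.

Lemma draws_fubini S1 S2 (H : T * T -> \bar R) : S1 `&` S2 `<=` set0 ->
  @measurable_fun _ _ (draws S1 * draws S2)%type (\bar R) setT H ->
  (forall w, (0 <= H w)%E) ->
  (\int[Pr]_w H (w, w) = \int[Pr]_w \int[Pr]_w' H (w, w'))%E.
Proof.
move=> S12 mH H0.
have ind : mutually_independent Pr draw_events := rd_independent RD.
exact: (block_fubini Cm CT CI ind S12 mH H0).
Qed.

Lemma integral_draw_xi k j i (h : X -> \bar R) : measurable_fun setT h ->
  (forall x, 0 <= h x)%E -> (\int[Pr]_w h (xi k j i w) = \int[P]_x h x)%E.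
Proof.
move=> mh h0; rewrite -ge0_integral_distribution//.
by apply: eq_measure_integral => A mA _; exact: rd_xi RD _ _ _ _ mA.
Qed.

Lemma integral_batch_sqr k j (A : X -> R) (c : R) m : measurable_fun setT A ->
  rintegrable P (fun x => A x ^+ 2) -> \int[P]_x A x = 0 ->
  (\int[Pr]_w ((c + \sum_(i < m) A (xi k j i w)) ^+ 2)%:E =
   (c ^+ 2 + m%:R * \int[P]_x A x ^+ 2)%:E)%E.
Proof.
move=> mA IA A0; set q := \int[P]_x A x ^+ 2.
have q0 : 0 <= q by apply: Rintegral_ge0 => x _; exact: sqr_ge0.
elim: m c => [|m IH] c.
  under eq_integral do rewrite big_ord0 addr0.
  by rewrite integral_cst_probability mul0r addr0.
pose H (w : T * T) := ((c + \sum_(i < m) A (xi k j i w.1) + A (xi k j m w.2)) ^+ 2)%:E.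
pose S1 : set draw_index := [set a | exists2 i, (i < m)%N & a = inr (k, j, i)].
pose S2 : set draw_index := [set inr (k, j, m)].
transitivity (\int[Pr]_w H (w, w))%E.
  by apply: eq_integral => w _; rewrite /H big_ord_recr/= addrA.
rewrite (@draws_fubini S1 S2); last 3 first.
- by move=> a [[i im ->]] [E]; move: im; rewrite E ltnn.
- apply/measurable_EFinP; apply: measurable_funX; apply: measurable_funD.
    apply: measurable_funD; first exact: measurable_cst.
    apply: measurable_sum => i; apply: (measurableT_comp mA).
    apply: (@measurableT_comp _ _ _ _ _ _ (xi k j i : draws S1 -> X)).
      by apply: measurable_draw_xi; exists i.
    exact: measurable_fst.
  apply: (measurableT_comp mA).
  apply: (@measurableT_comp _ _ _ _ _ _ (xi k j m : draws S2 -> X)).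
    exact: measurable_draw_xi.
  exact: measurable_snd.
- by move=> w; rewrite lee_fin sqr_ge0.
transitivity (\int[Pr]_w ((c + \sum_(i < m) A (xi k j i w)) ^+ 2 + q)%:E)%E.
  apply: eq_integral => w _; rewrite /H/=.
  rewrite (@integral_draw_xi k j m (fun x => ((c + \sum_(i < m) A (xi k j i w) + A x) ^+ 2)%:E)).
  - exact: integral_sqr_shift.
  - apply/measurable_EFinP; apply: measurable_funX; apply: measurable_funD => //.
  - by move=> x; rewrite lee_fin sqr_ge0.
rewrite ge0_integralDr//; last 2 first.
- apply: measurable_funX; apply: measurable_funD; first exact: measurable_cst.
  by apply: measurable_sum => i; apply: (measurableT_comp mA).
- by move=> w; exact: sqr_ge0.
rewrite IH integral_cst_probability -EFinD; congr (_%:E).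
clear -q; by move: q => q; rewrite -natr1; ring.
Qed.

Lemma integral_batch_mean_sqr k j (A : X -> R) (c : R) m : (0 < m)%N ->
  measurable_fun setT A ->
  rintegrable P (fun x => A x ^+ 2) -> \int[P]_x A x = 0 ->
  (\int[Pr]_w ((c + m%:R^-1 * \sum_(i < m) A (xi k j i w)) ^+ 2)%:E =
   (c ^+ 2 + (\int[P]_x A x ^+ 2) / m%:R)%:E)%E.
Proof.
move=> m0 mA IA A0; have mn0 : m%:R != 0 :> R by rewrite pnatr_eq0 -lt0n.
transitivity (\int[Pr]_w (m%:R^-1 ^+ 2 *
    (m%:R * c + \sum_(i < m) A (xi k j i w)) ^+ 2)%:E)%E.
  apply: eq_integral => w _; congr (_%:E).
  by move: (\sum_(i < m) _) => z; field.
rewrite ge0_integralZr; last 3 first.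
- apply: measurable_funX; apply: measurable_funD; first exact: measurable_cst.
  by apply: measurable_sum => i; apply: (measurableT_comp mA).
- by move=> w; exact: sqr_ge0.
- exact: sqr_ge0.
rewrite integral_batch_sqr// -EFinM; congr (_%:E).
by move: (Rintegral _ _ _) => q; field.
Qed.

End draws.

(** * One iteration with a frozen past *)

(** Cauchy-Schwarz against the constant vector 1; for the empty batch both sides vanish. *)
Lemma sqr_mean_le {R : realType} (m : nat) (a : 'I_m -> R) :
  (m%:R^-1 * \sum_i a i) ^+ 2 <= m%:R^-1 * \sum_i a i ^+ 2.
Proof.
case: m a => [|m] a; first by rewrite !big_ord0 !mulr0 expr0n.
have := CauchySchwarz_dotv (\row_i a i) (const_mx 1).
have -> : dotv (\row_i a i) (const_mx 1) = \sum_i a i.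
  by apply: eq_bigr => i _; rewrite !mxE mulr1.
have -> : dotv (\row_i a i) (\row_i a i) = \sum_i a i ^+ 2.
  by apply: eq_bigr => i _; rewrite !mxE -expr2.
have -> : dotv (const_mx 1 : 'rV[R]_m.+1) (const_mx 1) = m.+1%:R.
  rewrite /dotv (eq_bigr (fun=> 1)); last by move=> i _; rewrite !mxE mulr1.
  by rewrite sumr_const card_ord.
move=> h; rewrite exprMn expr2 -mulrA ler_wpM2l ?invr_ge0//.
by rewrite mulrC ler_pdivrMr ?ltr0n.
Qed.

Section step_scalar.
Context {R : realType}.

(* The indefinite terms [c * s * t] and [c * a * t] are polarized so that     *)
(* every term has a sign and can be integrated as a nonnegative function.     *)
Lemma step_scalar (W c lam l s t a del N fx V H : R) :
  0 <= W -> 0 <= c -> 0 < lam -> 0 < l -> 0 <= N ->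
  H <= W * (fx + ((a + del) ^+ 2 - s ^+ 2) / (4 * l)) +
       (V - c * ((s + a + del) * t) + c ^+ 2 / 2 * ((s + a + del) ^+ 2 * N)) ->
  H + W / (4 * l) * s ^+ 2 + c / 4 * (s + t) ^+ 2 + c / 4 * (t + a) ^+ 2 <=
  W * fx + V + c / 4 * (s - t) ^+ 2 + c / 4 * (- t + a) ^+ 2
    + c / (2 * lam) * t ^+ 2 + c ^+ 2 * N * s ^+ 2
    + (W / (2 * l) + 2 * c ^+ 2 * N) * a ^+ 2
    + (W / (2 * l) + 2 * c ^+ 2 * N + c * lam / 2) * del ^+ 2.
Proof.
move=> W0 c0 lam0 l0 N0 h; rewrite -subr_ge0.
(* The slack is written as a sum of nonnegative terms: the squares come from
   [(a + del)^2 <= 2 a^2 + 2 del^2], from [(s + a + del)^2 <= 2 s^2 + 4 a^2 + 4 del^2], and from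
   Young's inequality with parameter [lam] for [del * t]; the last term is the slack of the
   hypothesis. *)
rewrite [leRHS](_ : _ = W / (4 * l) * (a - del) ^+ 2
  + c ^+ 2 * N * ((a - del) ^+ 2 + (s - a - del) ^+ 2 / 2)
  + c * lam / 2 * (t / lam + del) ^+ 2
  + (W * (fx + ((a + del) ^+ 2 - s ^+ 2) / (4 * l)) +
     (V - c * ((s + a + del) * t) + c ^+ 2 / 2 * ((s + a + del) ^+ 2 * N)) - H)); last first.
  by field; rewrite !gt_eqF.
apply: addr_ge0; last by rewrite subr_ge0.
apply: addr_ge0; last first.
  by rewrite mulr_ge0 ?sqr_ge0// divr_ge0// mulr_ge0// ltW.
apply: addr_ge0.
  by rewrite mulr_ge0 ?sqr_ge0// divr_ge0// mulr_ge0// ltW.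
by rewrite mulr_ge0 ?addr_ge0 ?divr_ge0 ?sqr_ge0// mulr_ge0// sqr_ge0.
Qed.
End step_scalar.

(** * Second moments of the oracle noise *)

Section noise.
Context {R : realType} {n : nat} {d : measure_display} {X : measurableType d}.
Variable P : probability X R.
Variables (zeta eta : 'rV[R]_n -> X -> 'rV[R]_n -> R) (Dz De : R).
Hypothesis ON : oracle_noise P zeta eta Dz De.

Lemma sphere_delta (i : 'I_n) : sphere n (delta_mx 0 i : 'rV[R]_n).
Proof. by apply/sphereE; rewrite dotv_delta mxE !eqxx. Qed.

Lemma oracle_noise_ge0 : (0 < n)%N -> 0 <= Dz /\ 0 <= De.
Proof.
move=> n0; have se := sphere_delta (Ordinal n0); split.
  rewrite -lee_fin; apply: le_trans (on_zeta ON 0 se).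
  by rewrite unlock; apply: integral_ge0 => y _; rewrite lee_fin sqr_ge0.
rewrite -(Rintegral_cstr P 0) -(Rintegral_cstr P De).
apply: ae_le_Rintegral; [exact: rintegrable_cst..|].
by apply: filterS (on_eta ON 0 se) => y; apply: le_trans.
Qed.

Context {d' : measure_display} {T : measurableType d'} (Pr : probability T R).
Variables (e : nat -> nat -> {RV Pr >-> 'rV[R]_n})
          (xi : nat -> nat -> nat -> {RV Pr >-> X}).
Hypothesis RD : random_draws P e xi.
Implicit Types x u : 'rV[R]_n.

Lemma measurable_oracle_section (h : 'rV[R]_n -> X -> 'rV[R]_n -> R) x u :
  measurable_fun setT (fun w : 'rV[R]_n * X * 'rV[R]_n => h w.1.1 w.1.2 w.2) ->
  measurable_fun setT (fun y => h x y u).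
Proof.
move=> mh; apply: (@measurableT_comp _ _ _ _ _ _
  (fun w : 'rV[R]_n * X * 'rV[R]_n => h w.1.1 w.1.2 w.2) _ (fun y => (x, y, u)) mh).
apply/measurable_fun_pairP; split; last exact: measurable_cst.
by apply/measurable_fun_pairP; split; [exact: measurable_cst|exact: measurable_id].
Qed.

(** The weights come from [(zeta - 2 eta)^2 >= 0], which gives
    [(zeta + eta)^2 <= 3/2 zeta^2 + 3 eta^2]. The factor 3/2 is the one for which the sum stays
    below six times the square of [sqrt Dz / 2 + 2 De]. *)
Lemma integral_noise_sqr x u k j i : sphere n u ->
  (\int[Pr]_w ((zeta x (xi k j i w) u + eta x (xi k j i w) u) ^+ 2)%:E
     <= (3 / 2 * Dz + 3 * De ^+ 2)%:E)%E.
Proof.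
move=> su.
have mz := measurable_oracle_section x u (on_measurable_zeta ON).
have me := measurable_oracle_section x u (on_measurable_eta ON).
rewrite (integral_draw_xi RD k j i (h := fun y => ((zeta x y u + eta x y u) ^+ 2)%:E)); last 2 first.
- by apply/measurable_EFinP; apply: measurable_funX; exact: measurable_funD.
- by move=> y; rewrite lee_fin sqr_ge0.
have := on_zeta ON x su; rewrite unlock => iz.
apply: (@le_trans _ _ (\int[P]_y (3 / 2 * zeta x y u ^+ 2 + 3 * De ^+ 2)%:E)%E).
  apply: ge0_le_integralr.
  - by apply: measurable_funX; exact: measurable_funD.
  - apply: measurable_funD => //; apply: measurable_funM => //.
    exact: measurable_funX.
  - by move=> y; exact: sqr_ge0.
  - by move=> y; apply: addr_ge0; apply: mulr_ge0; rewrite ?sqr_ge0// divr_ge0.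
  - apply: filterS (on_eta ON x su) => y ey.
    have : eta x y u ^+ 2 <= De ^+ 2.
      by rewrite -[leLHS]real_normK ?num_real// lerXn2r// nnegrE// (le_trans _ ey).
    have := sqr_ge0 (zeta x y u - 2 * eta x y u).
    by move: (zeta x y u) (eta x y u) (De ^+ 2) => a b ? ? ?; lra.
have m2 : measurable_fun setT (fun y => zeta x y u ^+ 2) by exact: measurable_funX.
rewrite ge0_integralDr; last 4 first.
- by apply: measurable_funM.
- exact: measurable_cst.
- by move=> y; apply: mulr_ge0; rewrite ?sqr_ge0// divr_ge0.
- by move=> y; apply: mulr_ge0; rewrite ?sqr_ge0// divr_ge0.
rewrite ge0_integralZr//; last by move=> y; exact: sqr_ge0.
rewrite integral_cst_probability [leRHS]EFinD leeD2r// [leRHS]EFinM.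
by apply: lee_wpmul2l => //; rewrite lee_fin divr_ge0.
Qed.

(** The noise is not centred, so the batch brings no factor [1 / m]: only the convexity of the
    square is available. *)
Lemma integral_noise_mean_sqr x u k j m : (0 < m)%N -> sphere n u ->
  (\int[Pr]_w ((m%:R^-1 * \sum_(i < m)
       (zeta x (xi k j i w) u + eta x (xi k j i w) u)) ^+ 2)%:E
     <= (3 / 2 * Dz + 3 * De ^+ 2)%:E)%E.
Proof.
move=> m0 su.
have mz := measurable_oracle_section x u (on_measurable_zeta ON).
have me := measurable_oracle_section x u (on_measurable_eta ON).
have md i : measurable_fun setT (fun w => zeta x (xi k j i w) u + eta x (xi k j i w) u).
  apply: measurable_funD; [apply: (measurableT_comp mz)|apply: (measurableT_comp me)];
  exact: measurable_funPT.
have mi : 0 <= m%:R^-1 :> R by rewrite invr_ge0.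
apply: (@le_trans _ _ (\int[Pr]_w (m%:R^-1 * \sum_(i < m)
    (zeta x (xi k j i w) u + eta x (xi k j i w) u) ^+ 2)%:E)%E).
  apply: ge0_le_integralr.
  - by apply: measurable_funX; apply: measurable_funM => //; exact: measurable_sum.
  - apply: measurable_funM => //; apply: measurable_sum => i; exact: measurable_funX.
  - by move=> w; exact: sqr_ge0.
  - by move=> w; rewrite mulr_ge0// sumr_ge0// => i _; exact: sqr_ge0.
  - by apply: aeW => w; exact: sqr_mean_le.
rewrite ge0_integralZr//; last 2 first.
- by apply: measurable_sum => i; exact: measurable_funX.
- by move=> w; rewrite sumr_ge0// => i _; exact: sqr_ge0.
rewrite ge0_integral_sumr; last 2 first.
- by move=> i; exact: measurable_funX.
- by move=> i w; exact: sqr_ge0.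
set D := 3 / 2 * Dz + _.
apply: (@le_trans _ _ (m%:R^-1%:E * \sum_(i < m) D%:E)%E).
  by rewrite lee_wpmul2l ?lee_fin// lee_sum// => i _; exact: integral_noise_sqr.
rewrite sumEFin -EFinM lee_fin sumr_const card_ord -[D *+ m]mulr_natl mulKf//.
by rewrite pnatr_eq0 -lt0n.
Qed.

End noise.

Lemma Omega_gt0 {R : realType} n p : (8 <= n)%N -> 0 < Omega n p :> R.
Proof.
move=> n8; have h : 1 <= Omega n p :> R by exact: Omega_ge1.
exact: lt_le_trans h.
Qed.

Lemma ge0_integral_leDZ {R : realType} d (T : measurableType d)
    (mu : {measure set T -> \bar R}) (f h : T -> R) (A B c : R) :
  measurable_fun setT f -> measurable_fun setT h ->
  (forall x, 0 <= f x) -> (forall x, 0 <= h x) -> 0 <= c ->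
  (\int[mu]_x (f x)%:E <= A%:E)%E -> (\int[mu]_x (h x)%:E <= B%:E)%E ->
  (\int[mu]_x (f x + c * h x)%:E <= (A + c * B)%:E)%E.
Proof.
move=> mf mh f0 h0 c0 fA hB; rewrite ge0_integralDr//; last 2 first.
- exact: measurable_funM.
- by move=> x; exact: mulr_ge0.
by rewrite ge0_integralZr// [leRHS]EFinD [in leRHS]EFinM leeD// lee_wpmul2l.
Qed.

Section measurable_mirror.
Context {R : realType} {n : nat}.
Variables (k q w : R).
Hypotheses (k1 : 1 < k) (q1 : 1 < q) (kq : (k - 1) * (q - 1) = 1).
Context {d : measure_display} {T : measurableType d}.
Implicit Types (a : T -> R) (f z x : T -> 'rV[R]_n).

Lemma measurable_mgrad f : measurable_fun setT f ->
  measurable_fun setT (fun t => mgrad k w (f t)).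
Proof.
move=> mf; apply: measurable_scalev; first exact: measurable_cst.
apply: measurable_rV => i.
apply: (@measurableT_comp _ _ _ _ _ _ (fun x : 'rV[R]_n => dmap k x 0 i)) mf.
by apply: continuous_measurable_rV; exact: (continuous_dmap k1 q1 kq).
Qed.

Lemma measurable_mdiv z x : measurable_fun setT z -> measurable_fun setT x ->
  measurable_fun setT (fun t => mdiv k q w (z t) (x t)).
Proof.
move=> mz mx; have mg := measurable_mgrad mz.
apply: measurable_funB; last exact: measurable_dotv.
apply: measurable_funD.
  apply: measurable_funM => //; apply: measurable_funX.
  exact: (measurableT_comp (measurable_lnorm k)).
apply: measurable_funM => //; apply: measurable_funX.
exact: (measurableT_comp (measurable_lnorm q)).
Qed.

End measurable_mirror.

Section step.
Context {R : realType} {n p : nat} {d : measure_display} {X : measurableType d}.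
Hypotheses (n8 : (8 <= n)%N) (p12 : p \in [:: 1%N; 2%N]).
Variable P : probability X R.
Variables (F : 'rV[R]_n -> X -> R) (g : 'rV[R]_n -> X -> 'rV[R]_n) (L : X -> R).
Variables (L2 sigma : R).
Hypotheses (L20 : 0 < L2) (SP : stochastic_problem P F g L L2 sigma).
Local Notation f := (objective P F).
Hypothesis convf : forall x y, f x + dotv (grad f x) (y - x) <= f y.
Variable xstar : 'rV[R]_n.
Hypothesis xstarP : minimizer f xstar.
Implicit Types x z u v xs G : 'rV[R]_n.

Local Notation dv := (@mdiv R n (primal_exp n p) (dual_exp n p) (Omega n p)).
Local Notation N := (@dnorm2 R n (dual_exp n p) (Omega n p)).
Local Notation gr := (@mgrad R n (primal_exp n p) (Omega n p)).
Local Notation grV := (@mgradV R n (dual_exp n p) (Omega n p)).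

(* [xs] is the minimizer in the coordinates centred at the restart point. *)
Definition step_value (W c : R) x z xs G : R :=
  W * (f (x - (2 * L2)^-1 *: G) - f xstar) + dv (grV (gr z - c *: G)) xs.

Let k1 : 1 < primal_exp n p :> R . Proof. exact: primal_exp_gt1. Qed.
Let q2 : 2 <= dual_exp n p :> R . Proof. exact: dual_exp_ge2. Qed.
Let kq : (primal_exp n p - 1) * (dual_exp n p - 1) = 1 :> R .
Proof. exact: primal_dual_exp. Qed.
Let om0 : 0 < Omega n p :> R .
Proof. exact: Omega_gt0. Qed.

Let N0 v : 0 <= N v. Proof. exact: dnorm2_ge0. Qed.
Let dv0 z x : 0 <= dv z x.
Proof. by apply: mdiv_ge0 => // v; exact: dnorm2_le_dotv. Qed.

Lemma step_value_ge0 W c x z xs G : 0 <= W -> 0 <= step_value W c x z xs G.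
Proof. by move=> W0; rewrite addr_ge0// mulr_ge0// subr_ge0. Qed.

(** The gradient step inserted in the quadratic bound gives [(w^2 - 2 s w) / (4 L2)] with [s] the
    slope along [u]. Completing the square shows [w - s], which is the total error along [u]. *)
Lemma step_value_le W c x z xs u (w : R) : 0 <= W -> sphere n u ->
  step_value W c x z xs (w *: u) <=
  W * (f x - f xstar + ((w - dotv (grad f x) u) ^+ 2 - dotv (grad f x) u ^+ 2) / (4 * L2))
  + (dv z xs - c * (w * dotv u (z - xs)) + c ^+ 2 / 2 * (w ^+ 2 * N u)).
Proof.
move=> W0 /sphereE su; apply: lerD.
  apply: ler_wpM2l => //.
  have xE G : x - G - x = - G by rewrite addrAC subrr add0r.
  have := objective_descent L20 SP convf x (x - (2 * L2)^-1 *: (w *: u)).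
  rewrite xE scalerA dotvNr dotvZr dotvNr dotvNl dotvZl dotvZr su.
  move: (dotv _ u) (f (x - _)) (f x) (f xstar) L20 => s f' fx fs l0 h.
  rewrite lerBlDr (le_trans h)// -subr_ge0 [leRHS](_ : _ = 0)//.
  by field; rewrite gt_eqF.
have := mdiv_step k1 q2 kq om0 z c (w *: u) xs.
rewrite dotvZl dnorm2Z//.
Qed.

Lemma measurable_step_value d0 (Y : measurableType d0) W c
    (x z xs G : Y -> 'rV[R]_n) :
  measurable_fun setT x -> measurable_fun setT z -> measurable_fun setT xs ->
  measurable_fun setT G ->
  measurable_fun setT (fun t => step_value W c (x t) (z t) (xs t) (G t)).
Proof.
move=> mx mz mxs mG; apply: measurable_funD.
  apply: measurable_funM => //; apply: measurable_funB => //.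
  apply: (measurableT_comp (measurable_objective L20 SP convf)).
  by apply: measurable_subv => //; exact: measurable_scalev.
have q1 : 1 < dual_exp n p :> R by apply: lt_le_trans q2; rewrite ltr1n.
apply: measurable_mdiv => //.
apply: (@measurable_mgrad _ _ (dual_exp n p) (primal_exp n p) (Omega n p)^-1) => //.
  by rewrite mulrC.
apply: measurable_subv; first exact: (measurable_mgrad _ k1 q1 kq mz).
exact: measurable_scalev.
Qed.

Context {d' : measure_display} {T : measurableType d'} (Pr : probability T R).
Variables (e : nat -> nat -> {RV Pr >-> 'rV[R]_n})
          (xi : nat -> nat -> nat -> {RV Pr >-> X}).
Hypothesis RD : random_draws P e xi.
Variables (zeta eta : 'rV[R]_n -> X -> 'rV[R]_n -> R) (Dz De : R).
Hypothesis ON : oracle_noise P zeta eta Dz De.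
Variables (k j m : nat).
Hypothesis m0 : (0 < m)%N.

Let err x u y := dotv (g x y - grad f x) u.

Let measurable_err x u : measurable_fun setT (err x u).
Proof.
apply: measurable_dotv; last exact: measurable_cst.
by apply: measurable_subv; [exact: (measurable_gradient SP)|exact: measurable_cst].
Qed.

Lemma integral_err_sqr x u : sphere n u ->
  (\int[P]_y (err x u y ^+ 2)%:E <= (sigma ^+ 2)%:E)%E.
Proof.
move=> /sphereE su; apply: le_trans (integral_variance SP x).
have mg : measurable_fun setT (fun y => g x y - grad f x).
  by apply: measurable_subv; [exact: (measurable_gradient SP)|exact: measurable_cst].
apply: ge0_le_integralr.
- by apply: measurable_funX; exact: measurable_err.
- exact: measurable_dotv.
- by move=> y; exact: sqr_ge0.
- by move=> y; exact: dotv_ge0.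
- by apply: aeW => y; rewrite (le_trans (CauchySchwarz_dotv _ _))// su mulr1.
Qed.

Lemma rintegrable_err_sqr x u : sphere n u -> rintegrable P (fun y => err x u y ^+ 2).
Proof.
move=> su; apply: (@rintegrable_sqr_le _ _ _ _ _ (sigma ^+ 2)).
- exact: measurable_err.
- exact: integral_err_sqr.
Qed.

Lemma integral_err x u : \int[P]_y err x u y = 0.
Proof.
have [I1 E1] := Rintegral_gradient_dotv L20 SP x u.
transitivity (\int[P]_y (dotv (g x y) u - dotv (grad f x) u)).
  by apply: eq_Rintegral => y _; rewrite /err dotvBl.
by rewrite RintegralBr ?Rintegral_cstr ?E1 ?subrr//; exact: rintegrable_cst.
Qed.

Let orc := oracle g zeta eta.

Lemma batch_gradientE x u (y : nat -> X) : batch_gradient orc m x u y =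
  (dotv (grad f x) u + m%:R^-1 * \sum_(i < m) err x u (y i) +
   m%:R^-1 * \sum_(i < m) (zeta x (y i) u + eta x (y i) u)) *: u.
Proof.
have mn0 : m%:R != 0 :> R by rewrite pnatr_eq0 -lt0n.
rewrite /batch_gradient; congr (_ *: _).
rewrite -[dotv (grad f x) u](mulKf mn0) -!mulrDr; congr (_ * _).
transitivity (\sum_(i < m) (dotv (grad f x) u + err x u (y i) + (zeta x (y i) u + eta x (y i) u))).
  by apply: eq_bigr => i _; rewrite /orc /oracle /err dotvBl [dotv (grad f x) u + _]addrC subrK addrA.
by rewrite big_split big_split/= sumr_const card_ord mulr_natl.
Qed.

(** The direction is frozen and only the batch is averaged. The polarized squares of [t + a] and of
    [- t + a] have the same mean [t^2 + q / m], so they cancel, and the term linear in [a]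
    disappears with them. Those of [s + t] and [s - t] remain until the direction is averaged. *)
Lemma integral_step_direction W c lam x z xs u (s t K : R) :
  0 <= W -> 0 <= c -> 0 < lam -> sphere n u ->
  s = dotv (grad f x) u -> t = dotv u (z - xs) ->
  K = W / (2 * L2) + 2 * c ^+ 2 * N u ->
  (\int[Pr]_w (step_value W c x z xs
      (batch_gradient orc m x u (fun i => xi k j i w)))%:E
    + (W / (4 * L2) * s ^+ 2 + c / 4 * (s + t) ^+ 2)%:E <=
  (W * (f x - f xstar) + dv z xs + c / 4 * (s - t) ^+ 2
    + c / (2 * lam) * t ^+ 2 + c ^+ 2 * N u * s ^+ 2
    + K * ((\int[P]_y err x u y ^+ 2) / m%:R)
    + (K + c * lam / 2) * (3 / 2 * Dz + 3 * De ^+ 2))%:E)%E.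
Proof.
move=> W0 c0 lam0 su sE tE KE; set q := \int[P]_y _.
pose a w := m%:R^-1 * \sum_(i < m) err x u (xi k j i w).
pose del w := m%:R^-1 * \sum_(i < m) (zeta x (xi k j i w) u + eta x (xi k j i w) u).
pose sv w := step_value W c x z xs (batch_gradient orc m x u (fun i => xi k j i w)).
have sv0 w : 0 <= sv w by exact: step_value_ge0.
have ma : measurable_fun setT a.
  apply: measurable_funM => //; apply: measurable_sum => i.
  apply: (measurableT_comp (measurable_err x u)); exact: measurable_funPT.
have mdel : measurable_fun setT del.
  apply: measurable_funM => //; apply: measurable_sum => i; apply: measurable_funD.
    apply: (measurableT_comp (measurable_oracle_section x u (on_measurable_zeta ON))).
    exact: measurable_funPT.
  apply: (measurableT_comp (measurable_oracle_section x u (on_measurable_eta ON))).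
  exact: measurable_funPT.
have msv : measurable_fun setT sv.
  apply: measurable_step_value; [exact: measurable_cst..|].
  rewrite /= [X in measurable_fun _ X](_ : _ = fun w => (s + a w + del w) *: u).
    apply: measurable_scalev; last exact: measurable_cst.
    by apply: measurable_funD => //; exact: measurable_funD.
  by apply/funext => w; rewrite batch_gradientE -sE.
pose D : R := 3 / 2 * Dz + 3 * De ^+ 2.
have D0 : 0 <= D.
  have := integral_noise_mean_sqr ON RD x k j m0 su; rewrite -lee_fin; apply: le_trans.
  by apply: integral_ge0 => w _; rewrite lee_fin sqr_ge0.
have K0 : 0 <= K.
  by rewrite KE addr_ge0//; apply: mulr_ge0 => //; rewrite ?invr_ge0 mulr_ge0 ?sqr_ge0 ?ltW.
have Kl0 : 0 <= K + c * lam / 2.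
  by rewrite addr_ge0// mulr_ge0 ?invr_ge0// mulr_ge0// ltW.
pose C1 := W / (4 * L2) * s ^+ 2 + c / 4 * (s + t) ^+ 2.
pose C2 := W * (f x - f xstar) + dv z xs + c / 4 * (s - t) ^+ 2
    + c / (2 * lam) * t ^+ 2 + c ^+ 2 * N u * s ^+ 2.
have c4 : 0 <= c / 4 by rewrite divr_ge0.
have C10 : 0 <= C1.
  by rewrite addr_ge0//; apply: mulr_ge0; rewrite ?sqr_ge0// divr_ge0// mulr_ge0// ltW.
have C20 : 0 <= C2.
  have cl0 : 0 <= c / (2 * lam) by rewrite divr_ge0// mulr_ge0// ltW.
  apply: addr_ge0; last by apply: mulr_ge0; rewrite ?sqr_ge0// mulr_ge0// sqr_ge0.
  apply: addr_ge0; last by apply: mulr_ge0; rewrite ?sqr_ge0.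
  apply: addr_ge0; last by apply: mulr_ge0; rewrite ?sqr_ge0.
  by apply: addr_ge0 => //; apply: mulr_ge0; rewrite ?subr_ge0.
have q0 : 0 <= q by apply: Rintegral_ge0 => y _; exact: sqr_ge0.
(* Used with the shifts [t], [- t] and 0. *)
have Ia b : (\int[Pr]_w ((b + a w) ^+ 2)%:E = (b ^+ 2 + q / m%:R)%:E)%E.
  apply: (integral_batch_mean_sqr RD) => //; [exact: rintegrable_err_sqr|exact: integral_err].
have maX b : measurable_fun setT (fun w => (b + a w) ^+ 2).
  by apply: measurable_funX; exact: measurable_funD.
have sq0 b w : 0 <= (b + a w) ^+ 2 by exact: sqr_ge0.
have c4sq b w : 0 <= c / 4 * (b + a w) ^+ 2 by exact: mulr_ge0.
have Ksq b w : 0 <= K * (b + a w) ^+ 2 by exact: mulr_ge0.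
have Kdel w : 0 <= (K + c * lam / 2) * del w ^+ 2.
  by apply: mulr_ge0 => //; exact: sqr_ge0.
have m4 : measurable_fun setT (fun w => c / 4 * (t + a w) ^+ 2) by exact: measurable_funM.
have IC1 : (\int[Pr]_w (C1 + c / 4 * (t + a w) ^+ 2)%:E =
    (C1 + c / 4 * (t ^+ 2 + q / m%:R))%:E)%E.
  rewrite ge0_integralDr//.
  by rewrite ge0_integralZr// Ia integral_cst_probability -EFinM -EFinD.
have IL : (\int[Pr]_w (sv w + (C1 + c / 4 * (t + a w) ^+ 2))%:E =
    \int[Pr]_w (sv w)%:E + (C1 + c / 4 * (t ^+ 2 + q / m%:R))%:E)%E.
  rewrite -IC1; apply: ge0_integralDr => //.
  - exact: measurable_funD.
  - by move=> w; exact: addr_ge0.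
have IR : (\int[Pr]_w (C2 + c / 4 * (- t + a w) ^+ 2 + K * (0 + a w) ^+ 2
     + (K + c * lam / 2) * del w ^+ 2)%:E <=
    (C2 + c / 4 * ((- t) ^+ 2 + q / m%:R) + K * (0 ^+ 2 + q / m%:R) +
     (K + c * lam / 2) * D)%:E)%E.
  have m1 : measurable_fun setT (fun w => C2 + c / 4 * (- t + a w) ^+ 2).
    by apply: measurable_funD => //; exact: measurable_funM.
  have p1 w : 0 <= C2 + c / 4 * (- t + a w) ^+ 2 by exact: addr_ge0.
  apply: ge0_integral_leDZ => //.
  - by apply: measurable_funD => //; exact: measurable_funM.
  - exact: measurable_funX.
  - by move=> w; exact: addr_ge0.
  - by move=> w; exact: sqr_ge0.
  - apply: ge0_integral_leDZ => //; last by rewrite Ia.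
    apply: ge0_integral_leDZ => //; last by rewrite Ia.
    by rewrite integral_cst_probability.
  - exact: (integral_noise_mean_sqr ON RD).
have : (\int[Pr]_w (sv w)%:E + (C1 + c / 4 * (t ^+ 2 + q / m%:R))%:E <=
    (C2 + c / 4 * ((- t) ^+ 2 + q / m%:R) + K * (0 ^+ 2 + q / m%:R) +
     (K + c * lam / 2) * D)%:E)%E.
  rewrite -IL; apply: le_trans IR; apply: ge0_le_integralr.
  - apply: measurable_funD => //; apply: measurable_funD => //; exact: measurable_funM.
  - apply: measurable_funD; last by apply: measurable_funM => //; exact: measurable_funX.
    apply: measurable_funD; last exact: measurable_funM.
    by apply: measurable_funD => //; exact: measurable_funM.
  - by move=> w; rewrite addr_ge0// addr_ge0.
  - move=> w; apply: addr_ge0 => //; apply: addr_ge0 => //; exact: addr_ge0.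
  - apply: aeW => w.
    have := step_value_le c x z xs (s + a w + del w) W0 su.
    have <- : sv w = step_value W c x z xs ((s + a w + del w) *: u).
      by rewrite /sv batch_gradientE -sE.
    rewrite -sE -tE.
    have -> : s + a w + del w - s = a w + del w by rewrite -[s + _ + _]addrA [s + _]addrC addrK.
    move=> /(step_scalar W0 c0 lam0 L20 (N0 u)).
    rewrite add0r -KE => h; rewrite addrA /C1 addrA; apply: le_trans h _.
    by rewrite lerD2r lerD2r -/C2 le_eqVlt; apply/orP; left; apply/eqP; rewrite /C2; ring.
rewrite EFinD addeA => h.
rewrite -(@leeD2rE _ (c / 4 * (t ^+ 2 + q / m%:R))%:E)//; apply: le_trans h _.
rewrite -EFinD lee_fin /C2 sqrrN expr0n/= add0r -/D.
by rewrite le_eqVlt; apply/orP; left; apply/eqP; ring.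
Qed.
End step.

Section algebra.
Context {R : realType}.

Lemma direction_average_eq (A V T1 T2 cc Nu ss K q mi cl D : R) :
  A + V + T1 + T2 + cc * Nu * ss + K * (q * mi) + (K + cl) * D =
  A + V + cl * D + T1 + T2 + cc * (ss * Nu) + D * K + mi * (K * q).
Proof. by ring. Qed.

Lemma polarized_step_eq (A V c cl cc hh hv vv ni mi r W4 K si l2 D : R) :
  A + V + cl * D + c / 4 * ((hh + 2 * - hv + vv) * ni) + l2 * (vv * ni)
    + cc * (hh * ni * r) + D * K + mi * (si * ni * K) =
  A + V - c * (hv * ni) + (cc * r - W4) * (hh * ni) + l2 * (vv * ni)
    + K * (si * (ni * mi)) + (K + cl) * D
    + (W4 * (hh * ni) + c / 4 * ((hh + 2 * hv + vv) * ni)).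
Proof. by field. Qed.

End algebra.

Section integral_step.
Context {R : realType} {n p : nat} {d : measure_display} {X : measurableType d}.
Hypotheses (n8 : (8 <= n)%N) (p12 : p \in [:: 1%N; 2%N]).
Variable P : probability X R.
Variables (F : 'rV[R]_n -> X -> R) (g : 'rV[R]_n -> X -> 'rV[R]_n) (L : X -> R).
Variables (L2 sigma : R).
Hypotheses (L20 : 0 < L2) (SP : stochastic_problem P F g L L2 sigma).
Local Notation f := (objective P F).
Hypothesis convf : forall x y, f x + dotv (grad f x) (y - x) <= f y.
Variable xstar : 'rV[R]_n.
Hypothesis xstarP : minimizer f xstar.
Context {d' : measure_display} {T : measurableType d'} (Pr : probability T R).
Variables (e : nat -> nat -> {RV Pr >-> 'rV[R]_n})
          (xi : nat -> nat -> nat -> {RV Pr >-> X}).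
Hypothesis RD : random_draws P e xi.
Variables (zeta eta : 'rV[R]_n -> X -> 'rV[R]_n -> R) (Dz De : R).
Hypothesis ON : oracle_noise P zeta eta Dz De.
Implicit Types x z u v xs G : 'rV[R]_n.

Local Notation dv := (@mdiv R n (primal_exp n p) (dual_exp n p) (Omega n p)).
Local Notation N := (@dnorm2 R n (dual_exp n p) (Omega n p)).
Local Notation orc := (oracle g zeta eta).
Local Notation sv := (step_value (p := p) P F L2 xstar).

Lemma measurable_batch_gradient d0 (Y : measurableType d0) (m : nat)
    (x u : Y -> 'rV[R]_n) (y : nat -> Y -> X) :
  measurable_fun setT x -> measurable_fun setT u ->
  (forall i, (i < m)%N -> measurable_fun setT (y i)) ->
  measurable_fun setT (fun t => batch_gradient orc m (x t) (u t) (fun i => y i t)).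
Proof.
move=> mx mu my; apply: measurable_scalev => //.
apply: measurable_funM => //; apply: measurable_sum => -[i im] /=.
have mxy : measurable_fun setT (fun t => (x t, y i t)).
  by apply/measurable_fun_pairP; split => //; exact: my.
have mxyu : measurable_fun setT (fun t => (x t, y i t, u t)).
  by apply/measurable_fun_pairP; split.
apply: measurable_funD; last exact: (measurableT_comp (on_measurable_eta ON) mxyu).
apply: measurable_funD; last exact: (measurableT_comp (on_measurable_zeta ON) mxyu).
apply: measurable_dotv => //; exact: (measurableT_comp (sp_measurable_g SP) mxy).
Qed.

Variables (k j m : nat).
Hypothesis m0 : (0 < m)%N.
Local Notation G x u w := (batch_gradient orc m x u (fun i => xi k j i w)).

Let e_draw : set draw_index := [set inl (k, j)].
Let xi_draw : set draw_index := [set a | exists i, a = inr (k, j, i)].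

Lemma integral_split_direction W c x z xs : 0 <= W ->
  (\int[Pr]_w (sv W c x z xs (G x (e k j w) w))%:E =
   \int[Pr]_w \int[Pr]_w' (sv W c x z xs (G x (e k j w) w'))%:E)%E.
Proof.
move=> W0.
apply: (draws_fubini RD (S1 := e_draw) (S2 := xi_draw)
  (H := fun w => (sv W c x z xs (G x (e k j w.1) w.2))%:E)).
- by move=> a [-> [i]].
- apply/measurable_EFinP.
  apply: (@measurable_step_value _ _ _ _ _ n8 _ _ _ _ _ _ L20 SP convf xstar _
    (draws e xi e_draw * draws e xi xi_draw)%type W c (cst x) (cst z) (cst xs)
    (fun w => batch_gradient orc m x (e k j w.1) (fun i => xi k j i w.2)));
    [exact: measurable_cst..|].
  apply: (@measurable_batch_gradient _ (draws e xi e_draw * draws e xi xi_draw)%type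
    m (cst x) (fun w => e k j w.1) (fun i w => xi k j i w.2)); first exact: measurable_cst.
    apply: (@measurableT_comp _ _ _ _ _ _ (e k j : draws e xi e_draw -> 'rV[R]_n)).
      exact: measurable_draw_e.
    exact: measurable_fst.
  move=> i _; apply: (@measurableT_comp _ _ _ _ _ _ (xi k j i : draws e xi xi_draw -> X)).
    by apply: measurable_draw_xi; exists i.
  exact: measurable_snd.
- by move=> w; rewrite lee_fin (step_value_ge0 n8 p12).
Qed.

(** The squares along [e] average to [1 / n] times squared lengths, and the two remaining polarized
    squares recombine into [- c <h, v> / n]. *)
Lemma integral_step W c lam x z xs : 0 <= W -> 0 <= c -> 0 < lam ->
  let Kbar := W / (2 * L2) + 2 * c ^+ 2 * rho n p in
  let D := 3 / 2 * Dz + 3 * De ^+ 2 in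
  let h := grad f x in
  let v := z - xs in
  is_true (\int[Pr]_w (sv W c x z xs (G x (e k j w) w))%:E <=
  (W * (f x - f xstar) + dv z xs - c * (dotv h v / n%:R)
   + (c ^+ 2 * rho n p - W / (4 * L2)) * (dotv h h / n%:R)
   + c / (2 * lam) * (dotv v v / n%:R)
   + Kbar * (sigma ^+ 2 / (n%:R * m%:R)) + (Kbar + c * lam / 2) * D)%:E)%E.
Proof.
move=> W0 c0 lam0 Kbar D h v.
have n0 : (0 < n)%N by exact: leq_trans n8.
pose U := distribution Pr (e k j).
have unifU : uniform_on_sphere U by exact: rd_e RD k j.
pose H u := (\int[Pr]_w (sv W c x z xs (G x u w))%:E)%E.
have mHf : measurable_fun setT
    (fun t : 'rV[R]_n * T => (sv W c x z xs (G x t.1 t.2))%:E).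
  apply/measurable_EFinP.
  apply: (@measurable_step_value _ _ _ _ _ n8 _ _ _ _ _ _ L20 SP convf xstar _
    ('rV[R]_n * T)%type W c (cst x) (cst z) (cst xs) (fun t => G x t.1 t.2));
    [exact: measurable_cst..|].
  apply: (@measurable_batch_gradient _ ('rV[R]_n * T)%type m (cst x) (fun w => w.1)
    (fun i w => xi k j i w.2)) => //; first exact: measurable_fst.
  by move=> i _; apply: (measurableT_comp (measurable_funPT (xi k j i))); exact: measurable_snd.
have sv0 u w : (0 <= (sv W c x z xs (G x u w))%:E)%E.
  by rewrite lee_fin (step_value_ge0 n8 p12).
have mH : measurable_fun setT H by apply: (measurable_fun_fubini_tonelli_F _ mHf) => -[].
have H0 u : (0 <= H u)%E by apply: integral_ge0 => w _.
rewrite integral_split_direction//.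
have -> : (\int[Pr]_w H (e k j w) = \int[U]_u H u)%E by rewrite ge0_integral_distribution.
have N0 u : 0 <= N u.
  apply: dnorm2_ge0; first exact: dual_exp_ge2.
  exact: Omega_gt0.
have mN : measurable_fun setT (N : 'rV[R]_n -> R) := measurable_dnorm2 p.
pose K u := W / (2 * L2) + 2 * c ^+ 2 * N u.
have W2 : 0 <= W / (2 * L2) by rewrite divr_ge0// mulr_ge0// ltW.
have c2 : 0 <= 2 * c ^+ 2 by rewrite mulr_ge0// sqr_ge0.
have K0 u : 0 <= K u by rewrite addr_ge0// mulr_ge0.
have mK : measurable_fun setT K by apply: measurable_funD => //; exact: measurable_funM.
have IK : (\int[U]_u (K u)%:E <= Kbar%:E)%E.
  apply: ge0_integral_leDZ => //; first by rewrite integral_cst_probability.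
  exact: integral_sphere_dnorm2.
have mdot y : measurable_fun setT (dotv y : 'rV[R]_n -> R).
  by apply: measurable_dotv.
have msq y : measurable_fun setT (fun u => dotv y u ^+ 2) by exact: measurable_funX.
have Isq y : (\int[U]_u (dotv y u ^+ 2)%:E = (dotv y y / n%:R)%:E)%E.
  exact: integral_sphere_dotv2.
pose err u y := dotv (g x y - h) u.
pose Q u := (\int[P]_y (err u y ^+ 2 * K u)%:E)%E.
have merr : measurable_fun setT (fun t : 'rV[R]_n * X => (err t.1 t.2 ^+ 2 * K t.1)%:E).
  apply/measurable_EFinP; apply: measurable_funM; last first.
    exact: (measurableT_comp mK measurable_fst).
  apply: measurable_funX; apply: measurable_dotv; last exact: measurable_fst.
  apply: measurable_subv; last exact: measurable_cst.
  exact: (measurableT_comp (measurable_gradient SP x) measurable_snd).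
have err0 u y : (0 <= (err u y ^+ 2 * K u)%:E)%E by rewrite lee_fin mulr_ge0// sqr_ge0.
have mQ : measurable_fun setT Q by apply: (measurable_fun_fubini_tonelli_F _ merr) => -[].
have Q0 u : (0 <= Q u)%E by apply: integral_ge0 => y _.
have IQ : (\int[U]_u Q u <= (sigma ^+ 2 / n%:R * Kbar)%:E)%E.
  (* The sphere is integrated first, for a fixed deviation of the gradient. The variance thus enters
     with the factor [1 / n] and is decoupled from the random weight [K u]. *)
  rewrite [leLHS](_ : _ = \int[P]_y \int[U]_u (err u y ^+ 2 * K u)%:E)%E; last first.
    exact: (fubini_tonelli _ merr (fun t => err0 t.1 t.2)).
  have [kk IkE] : exists kk : R, (\int[U]_u (K u)%:E = kk%:E)%E.
    exists (fine (\int[U]_u (K u)%:E)); rewrite fineK// ge0_fin_numE.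
      by apply: le_lt_trans IK _; exact: ltry.
    by apply: integral_ge0 => u _; rewrite lee_fin.
  have kk0 : 0 <= kk.
    by rewrite -lee_fin -IkE; apply: integral_ge0 => u _; rewrite lee_fin.
  have kkb : kk <= Kbar by rewrite -lee_fin -IkE.
  have mg : measurable_fun setT (fun y => dotv (g x y - h) (g x y - h)).
    have mg' : measurable_fun setT (fun y => g x y - h).
      by apply: measurable_subv; [exact: (measurable_gradient SP)|exact: measurable_cst].
    exact: measurable_dotv.
  have Kflip i u : K (flip i u) = K u by rewrite /K dnorm2_flip.
  have Kswap i l u : K (swap i l u) = K u by rewrite /K dnorm2_swap.
  have inner y : (\int[U]_u (err u y ^+ 2 * K u)%:E =
      (kk / n%:R * dotv (g x y - h) (g x y - h))%:E)%E.
    rewrite /err (integral_sphere_quadratic unifU mK K0 Kflip Kswap (g x y - h) n0) IkE.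
    by rewrite -EFinM mulrC mulrA mulrAC.
  under eq_integral do rewrite inner.
  rewrite ge0_integralZr//; last 2 first.
  - by move=> y; exact: dotv_ge0.
  - by rewrite divr_ge0.
  apply: (@le_trans _ _ ((kk / n%:R)%:E * (sigma ^+ 2)%:E)%E).
    by apply: lee_wpmul2l; [rewrite lee_fin divr_ge0|exact: integral_variance SP x].
  rewrite -EFinM lee_fin mulrC [kk / _]mulrC mulrA.
  by apply: ler_wpM2l => //; rewrite divr_ge0// sqr_ge0.
have [Dz0 De0] := oracle_noise_ge0 ON n0.
have D0 : 0 <= D by rewrite addr_ge0// mulr_ge0// sqr_ge0.
have c4 : 0 <= c / 4 by rewrite divr_ge0.
have cl0 : 0 <= c / (2 * lam) by rewrite divr_ge0// mulr_ge0// ltW.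
have cc0 : 0 <= c ^+ 2 by exact: sqr_ge0.
have W4 : 0 <= W / (4 * L2) by rewrite divr_ge0// mulr_ge0// ltW.
have dv0 : 0 <= dv z xs.
  apply: mdiv_ge0; [exact: primal_exp_gt1|exact: dual_exp_ge2|exact: primal_dual_exp|
    exact: Omega_gt0|exact: dnorm2_le_dotv].
pose A0 := W * (f x - f xstar) + dv z xs + c * lam / 2 * D.
have A00 : 0 <= A0.
  apply: addr_ge0; last by rewrite mulr_ge0// divr_ge0// mulr_ge0// ltW.
  by apply: addr_ge0 => //; rewrite mulr_ge0// subr_ge0.
pose C1 u := W / (4 * L2) * dotv h u ^+ 2 + c / 4 * dotv (h + v) u ^+ 2.
pose R0 u := A0 + c / 4 * dotv (h - v) u ^+ 2 + c / (2 * lam) * dotv v u ^+ 2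
  + c ^+ 2 * (dotv h u ^+ 2 * N u) + D * K u.
have sq0 y u : 0 <= dotv y u ^+ 2 by exact: sqr_ge0.
have C10 u : 0 <= C1 u by rewrite addr_ge0// mulr_ge0.
have mC1 : measurable_fun setT C1 by apply: measurable_funD; exact: measurable_funM.
have IC1 : (\int[U]_u (C1 u)%:E = (W / (4 * L2) * (dotv h h / n%:R)
    + c / 4 * (dotv (h + v) (h + v) / n%:R))%:E)%E.
  rewrite ge0_integralDr//; last 4 first.
  - exact: measurable_funM.
  - exact: measurable_funM.
  - by move=> u; exact: mulr_ge0.
  - by move=> u; exact: mulr_ge0.
  by rewrite !ge0_integralZr// !Isq -!EFinM -EFinD.
have mhN : measurable_fun setT (fun u => dotv h u ^+ 2 * N u) by exact: measurable_funM.
have hN0 u : 0 <= dotv h u ^+ 2 * N u by exact: mulr_ge0.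
have IhN : (\int[U]_u (dotv h u ^+ 2 * N u)%:E <= (dotv h h / n%:R * rho n p)%:E)%E.
  rewrite (integral_sphere_quadratic unifU mN N0 (@dnorm2_flip _ _ _) (@dnorm2_swap _ _ _) h n0).
  rewrite [leRHS]EFinM; apply: lee_wpmul2l; last exact: integral_sphere_dnorm2.
  by rewrite lee_fin divr_ge0// dotv_ge0.
have Q1 u : 0 <= A0 + c / 4 * dotv (h - v) u ^+ 2 by rewrite addr_ge0// mulr_ge0.
have Q2 u : 0 <= A0 + c / 4 * dotv (h - v) u ^+ 2 + c / (2 * lam) * dotv v u ^+ 2.
  by rewrite addr_ge0// mulr_ge0.
have Q3 u : 0 <= A0 + c / 4 * dotv (h - v) u ^+ 2 + c / (2 * lam) * dotv v u ^+ 2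
    + c ^+ 2 * (dotv h u ^+ 2 * N u) by rewrite addr_ge0// mulr_ge0.
have R00 u : 0 <= R0 u by rewrite addr_ge0// mulr_ge0.
have M1 : measurable_fun setT (fun u => A0 + c / 4 * dotv (h - v) u ^+ 2).
  by apply: measurable_funD => //; exact: measurable_funM.
have M2 : measurable_fun setT
    (fun u => A0 + c / 4 * dotv (h - v) u ^+ 2 + c / (2 * lam) * dotv v u ^+ 2).
  by apply: measurable_funD => //; exact: measurable_funM.
have M3 : measurable_fun setT (fun u => A0 + c / 4 * dotv (h - v) u ^+ 2
    + c / (2 * lam) * dotv v u ^+ 2 + c ^+ 2 * (dotv h u ^+ 2 * N u)).
  by apply: measurable_funD => //; exact: measurable_funM.
have mR0 : measurable_fun setT R0.
  by apply: measurable_funD => //; exact: measurable_funM.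
have IR0 : (\int[U]_u (R0 u)%:E <= (A0 + c / 4 * (dotv (h - v) (h - v) / n%:R)
    + c / (2 * lam) * (dotv v v / n%:R) + c ^+ 2 * (dotv h h / n%:R * rho n p)
    + D * Kbar)%:E)%E.
  do 4 ![apply: ge0_integral_leDZ => //; try by rewrite Isq].
  by rewrite integral_cst_probability.
have mi0 : (0 <= m%:R^-1%:E :> \bar R)%E by rewrite lee_fin invr_ge0.
have main : (\int[U]_u (H u + (C1 u)%:E) <=
    \int[U]_u ((R0 u)%:E + m%:R^-1%:E * Q u))%E.
  apply: ae_ge0_le_integral => //.
  - by move=> u _; apply: adde_ge0 => //; rewrite lee_fin.
  - by apply: emeasurable_funD => //; exact/measurable_EFinP.
  - by move=> u _; apply: adde_ge0; rewrite ?lee_fin// mule_ge0.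
  - apply: emeasurable_funD; first exact/measurable_EFinP.
    exact: measurable_funeM.
  apply: filterS (ae_sphere unifU) => u su _.
  have QE : Q u = (K u * \int[P]_y err u y ^+ 2)%:E.
    rewrite /Q; under eq_integral do rewrite mulrC.
    rewrite ge0_integralZr//; last 2 first.
    - apply: measurable_funX; apply: measurable_dotv; last exact: measurable_cst.
      by apply: measurable_subv; [exact: (measurable_gradient SP)|exact: measurable_cst].
    - by move=> y; exact: sqr_ge0.
    by rewrite (EFin_Rintegral (rintegrable_err_sqr SP x su)).
  rewrite QE -EFinM -EFinD.
  have := integral_step_direction n8 p12 L20 SP convf xstarP RD ON k j m0
    W0 c0 lam0 su (erefl (dotv h u)) (erefl (dotv u v)) (erefl (K u)).
  rewrite /C1 /R0 /A0 dotvDl dotvBl (dotvC v) => hh.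
  apply: le_trans hh _; rewrite lee_fin -/h -/v -/D.
  rewrite le_eqVlt; apply/orP; left; apply/eqP.
  exact: direction_average_eq.
have : (\int[U]_u H u + (W / (4 * L2) * (dotv h h / n%:R)
    + c / 4 * (dotv (h + v) (h + v) / n%:R))%:E <=
   (A0 + c / 4 * (dotv (h - v) (h - v) / n%:R)
    + c / (2 * lam) * (dotv v v / n%:R) + c ^+ 2 * (dotv h h / n%:R * rho n p)
    + D * Kbar)%:E + (m%:R^-1 * (sigma ^+ 2 / n%:R * Kbar))%:E)%E.
  rewrite -IC1 -ge0_integralD//; last 2 first.
  - by move=> u _; rewrite lee_fin.
  - exact/measurable_EFinP.
  apply: le_trans main _; rewrite ge0_integralD//; last 4 first.
  - by move=> u _; rewrite lee_fin.
  - exact/measurable_EFinP.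
  - by move=> u _; rewrite mule_ge0.
  - exact: measurable_funeM.
  rewrite ge0_integralZl// leeD// [leRHS]EFinM.
  exact: lee_wpmul2l.
rewrite -EFinD => hh.
(* The polarized part is a real number and can be subtracted from both sides. *)
rewrite -(@leeD2rE _ (W / (4 * L2) * (dotv h h / n%:R)
    + c / 4 * (dotv (h + v) (h + v) / n%:R))%:E)//.
apply: le_trans hh _; rewrite -EFinD lee_fin /A0.
rewrite (dotv_sqrD h v) (dotv_sqrD h (- v)) dotvNr dotvNl dotvNr opprK.
rewrite [(n%:R * m%:R)^-1]invfM.
by rewrite le_eqVlt; apply/orP; left; apply/eqP; exact: polarized_step_eq.
Qed.

End integral_step.

(** * The weights of the accelerated scheme *)

Section weights.
Context {R : realType}.
Variables (n p : nat) (L2 : R).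
Hypotheses (n8 : (8 <= n)%N) (L20 : 0 < L2).

(** Half of the unit of [alpha]. With it [weight j * tau j = alpha j] and
    [weight j - alpha j = carried_weight j], as the coupling of the two sequences requires;
    [carried_weight 0] vanishes. *)
Definition weight_unit : R := (192 * n%:R ^+ 2 * rho n p * L2)^-1.

(* The weights of the primal gap after and before the iteration [j]. *)
Definition weight j : R := weight_unit * j.+2%:R ^+ 2.
Definition carried_weight j : R := weight_unit * (j%:R * j.+2%:R).

Hypothesis p12 : p \in [:: 1%N; 2%N].

Lemma weight_unit_gt0 : 0 < weight_unit.
Proof.
have n0 : 0 < n%:R :> R by rewrite ltr0n (leq_trans _ n8).
have r0 : 0 < rho n p :> R by exact: rho_gt0.
have c0 : 0 < 192 :> R by rewrite ltr0n.
rewrite /weight_unit; move: (rho n p) r0 (192 : R) c0 => r r0 c c0; rewrite invr_gt0.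
apply: mulr_gt0 => //; apply: mulr_gt0 => //; apply: mulr_gt0 => //; exact: exprn_gt0.
Qed.

Lemma weight_ge0 j : 0 <= weight j.
Proof. by rewrite mulr_ge0 ?sqr_ge0// ltW// weight_unit_gt0. Qed.

Lemma alphaE j : (@alpha R n p L2 j) = 2 * weight_unit * j.+2%:R.
Proof.
have n0 : n%:R != 0 :> R by rewrite pnatr_eq0 -lt0n (leq_trans _ n8).
have r0 : rho n p != 0 :> R by rewrite gt_eqF// rho_gt0.
rewrite /alpha /weight_unit; move: (rho n p) r0 => r r0.
by field; rewrite r0 n0 gt_eqF.
Qed.

Lemma alpha_ge0 j : 0 <= (@alpha R n p L2 j).
Proof. by rewrite alphaE mulr_ge0// mulr_ge0// ltW// weight_unit_gt0. Qed.

Lemma weight_alpha j : weight j - (@alpha R n p L2 j) = carried_weight j.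
Proof.
rewrite alphaE /weight /carried_weight -[j.+2]addn2 natrD.
by move: weight_unit (j%:R) => b a; ring.
Qed.

Lemma weight_tau j : weight j * tau j = (@alpha R n p L2 j).
Proof.
have j0 : j.+2%:R != 0 :> R by rewrite pnatr_eq0.
by rewrite alphaE /weight /tau; move: weight_unit => b; field.
Qed.

(** This is where the constant 96 of the step sizes acts: the coefficient [W / (48 L2)] of the
    mirror step is a twelfth of the gain [W / (4 L2)] of the gradient step. *)
Lemma alpha_sqr_rho j :
  ((@alpha R n p L2 j) * n%:R) ^+ 2 * rho n p = weight j / (48 * L2).
Proof.
have n0 : n%:R != 0 :> R by rewrite pnatr_eq0 -lt0n (leq_trans _ n8).
have r0 : rho n p != 0 :> R by rewrite gt_eqF// rho_gt0.
rewrite alphaE /weight /weight_unit; move: (rho n p) r0 => r r0.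
by field; rewrite r0 n0 gt_eqF.
Qed.

End weights.

Section algebra.
Context {R : realType}.

Lemma noise_weight_eq (w l : R) : l != 0 ->
  w / (2 * l) + 2 * (w / (48 * l)) = 13 / 24 * w / l.
Proof. by move=> l0; field. Qed.

Lemma step_sum_le (A V a t2 t3 ks kd cl B l : R) :
  t2 <= 0 -> t3 <= l -> A - a <= B ->
  A + V - a + t2 + t3 + ks + (kd + cl) <= B + (V + l) + (ks + kd) + cl.
Proof. by lra. Qed.

End algebra.

Section weighted_step.
Context {R : realType} {n p : nat} {d : measure_display} {X : measurableType d}.
Hypotheses (n8 : (8 <= n)%N) (p12 : p \in [:: 1%N; 2%N]).
Variable P : probability X R.
Variables (F : 'rV[R]_n -> X -> R) (g : 'rV[R]_n -> X -> 'rV[R]_n) (L : X -> R).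
Variables (L2 sigma : R).
Hypotheses (L20 : 0 < L2) (SP : stochastic_problem P F g L L2 sigma).
Local Notation f := (objective P F).
Hypothesis convf : forall x y, f x + dotv (grad f x) (y - x) <= f y.
Variable xstar : 'rV[R]_n.
Hypothesis xstarP : minimizer f xstar.
Context {d' : measure_display} {T : measurableType d'} (Pr : probability T R).
Variables (e : nat -> nat -> {RV Pr >-> 'rV[R]_n})
          (xi : nat -> nat -> nat -> {RV Pr >-> X}).
Hypothesis RD : random_draws P e xi.
Variables (zeta eta : 'rV[R]_n -> X -> 'rV[R]_n -> R) (Dz De : R).
Hypothesis ON : oracle_noise P zeta eta Dz De.
Local Notation dv := (@mdiv R n (primal_exp n p) (dual_exp n p) (Omega n p)).
Local Notation orc := (oracle g zeta eta).
Local Notation sv := (step_value (p := p) P F L2 xstar).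

Let coupling_eq (W a w tu fx fs fy hx hy ha : R) : W * tu = a -> W - a = w ->
  tu * ha = tu * hx + (1 - tu) * hy ->
  W * (fx - fs) - a * ha = w * (fx - hy - fs) + a * (fx - hx - fs).
Proof.
move=> wa <- h.
have -> : a * ha = W * (tu * ha) by rewrite mulrA wa.
by rewrite h -wa; ring.
Qed.

(** The factor [n] in [c = alpha * n] undoes the average over the direction. The coefficient of
    [|h|^2] is negative, and [|v|^2] is at most twice the divergence. The linear term is turned into
    primal gaps by convexity at [xstar] and at [y]; the coefficient 13/24 is [1/2 + 2/48]. *)
Lemma weighted_step (k j m : nat) (lam : R) (y z u : 'rV[R]_n) :
  (0 < m)%N -> 0 < lam ->
  let x := tau j *: z + (1 - tau j) *: y in
  let W := weight n p L2 j in
  let D := 3 / 2 * Dz + 3 * De ^+ 2 in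
  is_true (\int[Pr]_w (sv W ((@alpha R n p L2 j) * n%:R) x (z - u) (xstar - u)
     (batch_gradient orc m x (e k j w) (fun i => xi k j i w)))%:E <=
  (carried_weight n p L2 j * (f y - f xstar)
   + (1 + (@alpha R n p L2 j) / lam) * dv (z - u) (xstar - u)
   + 13 / 24 * W / L2 * (sigma ^+ 2 / (n%:R * m%:R) + D)
   + (@alpha R n p L2 j) * n%:R * lam / 2 * D)%:E)%E.
Proof.
move=> m0 lam0 x W D; set a := (@alpha R n p L2 j); set V := dv _ _.
have nn0 : n%:R != 0 :> R by rewrite pnatr_eq0 -lt0n (leq_trans _ n8).
have n0 : (0 < n)%N by exact: leq_trans n8.
have W0 : 0 <= W by exact: weight_ge0.
have a0 : 0 <= a by exact: alpha_ge0.
have c0 : 0 <= a * n%:R by rewrite mulr_ge0.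
apply: le_trans (integral_step n8 p12 L20 SP convf xstarP RD ON k j m0 x
  (z - u) (xstar - u) W0 c0 lam0) _.
rewrite lee_fin -/D -/V.
have c2r : (a * n%:R) ^+ 2 * rho n p = W / (48 * L2) by exact: alpha_sqr_rho.
have -> : W / (2 * L2) + 2 * (a * n%:R) ^+ 2 * rho n p = 13 / 24 * W / L2.
  by rewrite -[2 * _ * _]mulrA c2r; apply: noise_weight_eq; rewrite gt_eqF.
rewrite c2r.
have -> : z - u - (xstar - u) = z - xstar by rewrite opprB addrA subrK.
set h := grad f x; set v := z - xstar.
have Vv : dotv v v <= 2 * V.
  have k1 : 1 < primal_exp n p :> R by exact: primal_exp_gt1.
  have q2 : 2 <= dual_exp n p :> R by exact: dual_exp_ge2.
  have kq : (primal_exp n p - 1) * (dual_exp n p - 1) = 1 :> R by exact: primal_dual_exp.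
  have o0 : 0 < Omega n p :> R by exact: Omega_gt0.
  have := mdiv_ge k1 q2 kq o0 (dnorm2_le_dotv n8 p12) (z - u) (xstar - u).
  rewrite -/V opprB addrA subrK -[xstar - z]opprB dotvNl dotvNr opprK -/v.
  by rewrite ler_pdivrMr// mulrC.
have hx := convf x xstar; have hy := convf x y.
(* The extrapolation [x = tau z + (1 - tau) y] splits [tau (z - xstar)] into a vector towards the
   minimizer and one towards [y], the two places where convexity is used. *)
have tauv : tau j * dotv h v =
    tau j * dotv h (x - xstar) + (1 - tau j) * dotv h (x - y).
  rewrite -!dotvZr -dotvDr; congr dotv.
  have -> : x - y = tau j *: (z - y).
    by apply/rowP => i; rewrite !mxE; ring.
  have -> : x - xstar = v - (1 - tau j) *: (z - y).
    by apply/rowP => i; rewrite !mxE; ring.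
  by apply/rowP => i; rewrite !mxE; ring.
have aW : W * tau j = a by exact: weight_tau.
have aw : W - a = carried_weight n p L2 j by exact: weight_alpha.
have key := coupling_eq (f x) (f xstar) (f y) aW aw tauv.
have w0 : 0 <= carried_weight n p L2 j.
  by rewrite mulr_ge0// ltW// weight_unit_gt0.
have t4 : W * (f x - f xstar) - a * dotv h v <= carried_weight n p L2 j * (f y - f xstar).
  rewrite key -[leRHS]addr0; apply: lerD.
    apply: ler_wpM2l => //; rewrite lerD2r lerBlDr; move: hy.
    by rewrite -/h -[y - x]opprB dotvNr; move: (dotv h _) (f x) (f y) => *; lra.
  apply: mulr_ge0_le0 => //; move: hx.
  by rewrite -/h -[xstar - x]opprB dotvNr; move: (dotv h _) (f x) (f xstar) => *; lra.
move: (dotv_ge0 h) Vv t4; rewrite -/h.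
move: (sigma ^+ 2 / (n%:R * m%:R)) (dotv h h) (dotv h v) (dotv v v) => s hh hv vv.
move: V D (W * (f x - f xstar)) (carried_weight n p L2 j * _) => V' D' A B.
move=> hh0 Vv t4.
have t1 : a * n%:R * (hv / n%:R) = a * hv by field.
have t2 : (W / (48 * L2) - W / (4 * L2)) * (hh / n%:R) <= 0.
  apply: mulr_le0_ge0; last exact: divr_ge0.
  rewrite subr_le0; apply: ler_wpM2l => //; rewrite lef_pV2 ?posrE ?mulr_gt0//.
  by rewrite ler_pM2r// ler_nat.
have t3 : a * n%:R / (2 * lam) * (vv / n%:R) <= a / lam * V'.
  have -> : a * n%:R / (2 * lam) * (vv / n%:R) = a / lam * (vv / 2).
    by field; rewrite nn0 gt_eqF.
  apply: ler_wpM2l; first by rewrite divr_ge0// ltW.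
  by rewrite ler_pdivrMr// mulrC.
rewrite t1 [(1 + _) * _]mulrDl mul1r [_ * (s + _)]mulrDr [(_ + _) * D']mulrDl.
exact: step_sum_le.
Qed.

End weighted_step.

(** * The inner run *)

Section expected_step.
Context {R : realType} {n p : nat} {d : measure_display} {X : measurableType d}.
Hypotheses (n8 : (8 <= n)%N) (p12 : p \in [:: 1%N; 2%N]).
Variable P : probability X R.
Variables (F : 'rV[R]_n -> X -> R) (g : 'rV[R]_n -> X -> 'rV[R]_n) (L : X -> R).
Variables (L2 sigma : R).
Hypotheses (L20 : 0 < L2) (SP : stochastic_problem P F g L L2 sigma).
Local Notation f := (objective P F).
Hypothesis convf : forall x y, f x + dotv (grad f x) (y - x) <= f y.
Variable xstar : 'rV[R]_n.
Hypothesis xstarP : minimizer f xstar.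
Context {d' : measure_display} {T : measurableType d'} (Pr : probability T R).
Variables (e : nat -> nat -> {RV Pr >-> 'rV[R]_n})
          (xi : nat -> nat -> nat -> {RV Pr >-> X}).
Hypothesis RD : random_draws P e xi.
Variables (zeta eta : 'rV[R]_n -> X -> 'rV[R]_n -> R) (Dz De : R).
Hypothesis ON : oracle_noise P zeta eta Dz De.
Local Notation dv := (@mdiv R n (primal_exp n p) (dual_exp n p) (Omega n p)).
Local Notation orc := (oracle g zeta eta).
Local Notation sv := (step_value (p := p) P F L2 xstar).

Lemma mdiv_prox_ge0 z x : 0 <= dv z x.
Proof.
apply: mdiv_ge0; [exact: primal_exp_gt1|exact: dual_exp_ge2|exact: primal_dual_exp|
  exact: Omega_gt0|exact: dnorm2_le_dotv].
Qed.

Lemma measurable_mdiv_prox d0 (Y : measurableType d0) (z x : Y -> 'rV[R]_n) :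
  measurable_fun setT z -> measurable_fun setT x ->
  measurable_fun setT (fun t => dv (z t) (x t)).
Proof.
have q2 : 2 <= dual_exp n p :> R by exact: dual_exp_ge2.
apply: measurable_mdiv; [exact: primal_exp_gt1| |exact: primal_dual_exp].
by apply: lt_le_trans q2; rewrite ltr1n.
Qed.

Definition new_draws k j : set draw_index :=
  [set a | a = inl (k, j) \/ exists i, a = inr (k, j, i)].

Lemma measurable_draws_id (S : set draw_index) :
  measurable_fun setT (idfun : T -> draws e xi S).
Proof.
move=> _ A mA; rewrite setTI preimage_id.
by apply: (smallest_sub (@sigma_algebra_measurable _ T)) mA;
  exact: (measurable_cylinders (@measurable_draw_events _ _ _ _ _ _ _ e xi)).
Qed.

Lemma measurable_draws_setT (S : set draw_index) d0 (Y : measurableType d0) (h : T -> Y) :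
  measurable_fun setT (h : draws e xi S -> Y) -> measurable_fun setT h.
Proof.
move=> mh _ A mA; rewrite setTI; have := mh measurableT _ mA; rewrite setTI => hA.
by have := measurable_draws_id measurableT hA; rewrite setTI preimage_id.
Qed.

Variables (k j m : nat) (lam : R) (S : set draw_index) (u y z : T -> 'rV[R]_n).
Hypotheses (m0 : (0 < m)%N) (lam0 : 0 < lam)
  (S_new : S `&` new_draws k j `<=` set0)
  (mu : measurable_fun setT (u : draws e xi S -> 'rV[R]_n))
  (my : measurable_fun setT (y : draws e xi S -> 'rV[R]_n))
  (mz : measurable_fun setT (z : draws e xi S -> 'rV[R]_n)).

Let x w := tau j *: z w + (1 - tau j) *: y w.

Definition step_error : R :=
  13 / 24 * weight n p L2 j / L2 * (sigma ^+ 2 / (n%:R * m%:R) + (3 / 2 * Dz + 3 * De ^+ 2))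
  + (@alpha R n p L2 j) * n%:R * lam / 2 * (3 / 2 * Dz + 3 * De ^+ 2).

(** Restart point and iterates depend on the draws in [S], which are disjoint from those of this
    iteration, so for almost all purposes they are constants: Fubini reduces the claim to the
    one-step bound at each outcome of the past. *)
Lemma expected_step :
  (\int[Pr]_w (sv (weight n p L2 j) ((@alpha R n p L2 j) * n%:R) (x w) (z w - u w)
      (xstar - u w) (batch_gradient orc m (x w) (e k j w) (fun i => xi k j i w)))%:E <=
   \int[Pr]_w (carried_weight n p L2 j * (f (y w) - f xstar)
     + (1 + (@alpha R n p L2 j) / lam) * dv (z w - u w) (xstar - u w)
     + step_error)%:E)%E.
Proof.
have W0 : 0 <= weight n p L2 j :> R by exact: weight_ge0.
set c := _ * n%:R.
pose H (w : T * T) := (sv (weight n p L2 j) c (x w.1) (z w.1 - u w.1) (xstar - u w.1)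
  (batch_gradient orc m (x w.1) (e k j w.2) (fun i => xi k j i w.2)))%:E.
have mxz (z1 z2 : draws e xi S -> 'rV[R]_n) : measurable_fun setT z1 ->
  measurable_fun setT z2 -> measurable_fun setT (fun w => z1 w - z2 w).
  by move=> ? ?; exact: measurable_subv.
have mx : measurable_fun setT (x : draws e xi S -> 'rV[R]_n).
  by apply: measurable_addv; apply: measurable_scalev => //; exact: measurable_cst.
have sv0 w : (0 <= H w)%E by rewrite lee_fin (step_value_ge0 n8 p12).
set Y := (draws e xi S * draws e xi (new_draws k j))%type.
have mH : measurable_fun [set: Y] H.
  apply/measurable_EFinP.
  have m1 (h : T -> 'rV[R]_n) : measurable_fun setT (h : draws e xi S -> _) ->
    measurable_fun setT (fun w : Y => h w.1).
    by move=> mh; exact: (measurableT_comp mh measurable_fst).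
  apply: (@measurable_step_value _ _ _ _ _ n8 _ _ _ _ _ _ L20 SP convf xstar _ Y
    _ c (fun w => x w.1) (fun w => z w.1 - u w.1) (fun w => xstar - u w.1)).
  - exact: m1.
  - by apply: (m1 (fun w => z w - u w)); exact: mxz.
  - by apply: (m1 (fun w => xstar - u w)); apply: mxz => //; exact: measurable_cst.
  - apply: (@measurable_batch_gradient _ _ _ _ _ _ _ _ _ _ SP _ _ _ _ ON _ Y m
      (fun w => x w.1) (fun w => e k j w.2) (fun i w => xi k j i w.2)).
    + exact: m1.
    + apply: (@measurableT_comp _ _ _ _ _ _ (e k j : draws e xi (new_draws k j) -> 'rV[R]_n)).
        by apply: measurable_draw_e; left.
      exact: measurable_snd.
    + move=> i _.
      apply: (@measurableT_comp _ _ _ _ _ _ (xi k j i : draws e xi (new_draws k j) -> X)).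
        by apply: measurable_draw_xi; right; exists i.
      exact: measurable_snd.
have -> : (\int[Pr]_w H (w, w) = \int[Pr]_w \int[Pr]_w' H (w, w'))%E.
  exact: (draws_fubini RD S_new).
(* The iterated integral is taken on the original sample space, so measurability is transferred from
   the two smaller sigma-algebras to the full ones. *)
have mHT : measurable_fun [set: T * T] H.
  have mid : measurable_fun [set: T * T] (idfun : T * T -> Y).
    have mpr S' (h : T * T -> T) : measurable_fun setT h ->
        measurable_fun setT (h : T * T -> draws e xi S').
      move=> mh _ A mA; have := measurable_draws_id (S := S') measurableT mA.
      by rewrite setTI preimage_id => hA; exact: mh.
    apply/measurable_fun_pairP; split.
      exact: (mpr S fst measurable_fst).
    exact: (mpr (new_draws k j) snd measurable_snd).
  move=> _ A mA; rewrite setTI; have := mH measurableT _ mA; rewrite setTI => hA.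
  by have := mid measurableT _ hA; rewrite setTI preimage_id.
have my' : measurable_fun setT y by apply: (measurable_draws_setT (S := S)).
have mu' : measurable_fun setT u by apply: (measurable_draws_setT (S := S)).
have mz' : measurable_fun setT z by apply: (measurable_draws_setT (S := S)).
apply: ge0_le_integral => //.
- by move=> w _; apply: integral_ge0.
- exact: (measurable_fun_fubini_tonelli_F _ mHT).
- apply/measurable_EFinP; apply: measurable_funD => //; apply: measurable_funD.
    apply: measurable_funM => //; apply: measurable_funB => //.
    exact: (measurableT_comp (measurable_objective L20 SP convf)).
  apply: measurable_funM => //; apply: measurable_mdiv_prox.
    exact: measurable_subv.
  by apply: measurable_subv => //; exact: measurable_cst.
- move=> w _.
  have h := weighted_step n8 p12 L20 SP convf xstarP RD ON k j (y w) (z w) (u w) m0 lam0.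
  by apply: le_trans h _; rewrite lee_fin -addrA.
Qed.

End expected_step.

Section inner_run.
Context {R : realType} {n p : nat} {d : measure_display} {X : measurableType d}.
Hypotheses (n8 : (8 <= n)%N) (p12 : p \in [:: 1%N; 2%N]).
Variable P : probability X R.
Variables (F : 'rV[R]_n -> X -> R) (g : 'rV[R]_n -> X -> 'rV[R]_n) (L : X -> R).
Variables (L2 sigma : R).
Hypotheses (L20 : 0 < L2) (SP : stochastic_problem P F g L L2 sigma).
Local Notation f := (objective P F).
Hypothesis convf : forall x y, f x + dotv (grad f x) (y - x) <= f y.
Variable xstar : 'rV[R]_n.
Hypothesis xstarP : minimizer f xstar.
Context {d' : measure_display} {T : measurableType d'} (Pr : probability T R).
Variables (e : nat -> nat -> {RV Pr >-> 'rV[R]_n})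
          (xi : nat -> nat -> nat -> {RV Pr >-> X}).
Hypothesis RD : random_draws P e xi.
Variables (zeta eta : 'rV[R]_n -> X -> 'rV[R]_n -> R) (Dz De : R).
Hypothesis ON : oracle_noise P zeta eta Dz De.
Local Notation dv := (@mdiv R n (primal_exp n p) (dual_exp n p) (Omega n p)).
Local Notation gr := (@mgrad R n (primal_exp n p) (Omega n p)).
Local Notation grV := (@mgradV R n (dual_exp n p) (Omega n p)).
Local Notation orc := (oracle g zeta eta).
Local Notation sv := (step_value (p := p) P F L2 xstar).
Local Notation al := (@alpha R n p L2).
Local Notation pr := (@mprox R n (primal_exp n p) (Omega n p)).

Variables (k m : nat) (S0 : set draw_index) (u : T -> 'rV[R]_n).
Hypotheses (m0 : (0 < m)%N) (S0_new : forall j, S0 `&` new_draws k j `<=` set0)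
  (mu : forall S, S0 `<=` S -> measurable_fun setT (u : draws e xi S -> 'rV[R]_n)).

Definition inner_state j w := ardd_state p L2 orc (fun y => pr (y - u w)) m (u w)
  (fun j => e k j w) (fun j i => xi k j i w) j.

Let y j w := (inner_state j w).1.
Let z j w := (inner_state j w).2.
Let x j w := tau j *: z j w + (1 - tau j) *: y j w.
Let G j w := batch_gradient orc m (x j w) (e k j w) (fun i => xi k j i w).

(** The closed form of the mirror step replaces [argmin] here; everything after works with explicit
    maps. *)
Let inner_stateS j w : inner_state j.+1 w = (x j w - (2 * L2)^-1 *: G j w,
  u w + grV (gr (z j w - u w) - (al j * n%:R) *: G j w)).
Proof.
have k1 : 1 < primal_exp n p :> R by exact: primal_exp_gt1.
have q2 : 2 <= dual_exp n p :> R by exact: dual_exp_ge2.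
have kq : (primal_exp n p - 1) * (dual_exp n p - 1) = 1 :> R by exact: primal_dual_exp.
have o0 : 0 < Omega n p :> R by exact: Omega_gt0.
rewrite /G /x /y /z /inner_state /=.
case: (ardd_state _ _ _ _ _ _ _ _ j) => y' z' /=.
by rewrite (argmin_mprox_shift k1 q2 kq o0 (dnorm2_le_dotv n8 p12)).
Qed.

Definition past_draws j : set draw_index :=
  [set a | S0 a \/ exists2 i, (i < j)%N & new_draws k i a].

(** Stated for every [S] that contains the past, so that one induction serves all stages without
    comparing the sigma-algebras of different blocks. *)
Lemma measurable_inner_state j S : past_draws j `<=` S ->
  measurable_fun setT (y j : draws e xi S -> 'rV[R]_n) /\
  measurable_fun setT (z j : draws e xi S -> 'rV[R]_n).
Proof.
have k1 : 1 < primal_exp n p :> R by exact: primal_exp_gt1.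
have q2 : 2 <= dual_exp n p :> R by exact: dual_exp_ge2.
have q1 : 1 < dual_exp n p :> R by apply: lt_le_trans q2; rewrite ltr1n.
have kq : (primal_exp n p - 1) * (dual_exp n p - 1) = 1 :> R by exact: primal_dual_exp.
elim: j => [|j IH] jS.
  have := mu (fun a Sa => jS a (or_introl Sa)); by split.
have [my mz] : measurable_fun setT (y j : draws e xi S -> 'rV[R]_n) /\
    measurable_fun setT (z j : draws e xi S -> 'rV[R]_n).
  apply: IH => a [Sa|[i ij ia]]; apply: jS; first by left.
  by right; exists i => //; rewrite ltnS ltnW.
have mu' : measurable_fun setT (u : draws e xi S -> 'rV[R]_n).
  by apply: mu => a Sa; apply: jS; left.
have mx : measurable_fun setT (x j : draws e xi S -> 'rV[R]_n).
  by apply: measurable_addv; apply: measurable_scalev => //; exact: measurable_cst.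
have new a : new_draws k j a -> S a by move=> ja; apply: jS; right; exists j.
have mG : measurable_fun setT (G j : draws e xi S -> 'rV[R]_n).
  apply: (@measurable_batch_gradient _ _ _ _ _ _ _ _ _ _ SP _ _ _ _ ON _ (draws e xi S) m
      (x j) (e k j) (fun i => xi k j i)) => //.
    by apply: measurable_draw_e; apply: new; left.
  by move=> i _; apply: measurable_draw_xi; apply: new; right; exists i.
split.
  rewrite [X in measurable_fun _ X](_ : _ = fun w => x j w - (2 * L2)^-1 *: G j w).
    by apply: measurable_subv => //; exact: measurable_scalev.
  by apply/funext => w; rewrite /y inner_stateS.
rewrite [X in measurable_fun _ X](_ : _ = fun w =>
    u w + grV (gr (z j w - u w) - (al j * n%:R) *: G j w)); last first.
  by apply/funext => w; rewrite /z inner_stateS.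
apply: measurable_addv => //.
apply: (@measurable_mgrad _ _ (dual_exp n p) (primal_exp n p) (Omega n p)^-1) => //.
  by rewrite mulrC.
apply: measurable_subv; last exact: measurable_scalev.
apply: (measurable_mgrad _ k1 q1 kq); exact: measurable_subv.
Qed.

Let gap j w := f (y j w) - f xstar.
Let V j w := dv (z j w - u w) (xstar - u w).

Let gap0 j w : 0 <= gap j w. Proof. by rewrite subr_ge0. Qed.
Let V0 j w : 0 <= V j w. Proof. exact: mdiv_prox_ge0. Qed.

Let carried0 j : 0 <= carried_weight n p L2 j :> R.
Proof. by apply: mulr_ge0 => //; apply: ltW; exact: weight_unit_gt0. Qed.

Let measurable_setT_y j : measurable_fun setT (y j).
Proof.
have [my _] := @measurable_inner_state j (past_draws j) (fun _ h => h).
exact: (measurable_draws_setT (e := e) (xi := xi) (S := past_draws j) my).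
Qed.

Let measurable_setT_z j : measurable_fun setT (z j).
Proof.
have [_ mz] := @measurable_inner_state j (past_draws j) (fun _ h => h).
exact: (measurable_draws_setT (e := e) (xi := xi) (S := past_draws j) mz).
Qed.

Let measurable_setT_u : measurable_fun setT u.
Proof.
exact: (measurable_draws_setT (e := e) (xi := xi) (S := S0) (@mu S0 (fun _ h => h))).
Qed.

Let measurable_gap j : measurable_fun setT (gap j).
Proof.
apply: measurable_funB => //.
exact: (measurableT_comp (measurable_objective L20 SP convf)).
Qed.

Let measurable_V j : measurable_fun setT (V j).
Proof.
apply: measurable_mdiv_prox => //; first exact: measurable_subv.
by apply: measurable_subv => //; exact: measurable_cst.
Qed.

Variable lam : R.
Hypothesis lam0 : 0 < lam.

Local Notation err j := (@step_error R n p L2 sigma Dz De j m lam).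

Lemma step_error_ge0 j : 0 <= err j.
Proof.
have n0 : (0 < n)%N by exact: leq_trans n8.
have [Dz0 De0] := oracle_noise_ge0 ON n0.
have D0 : 0 <= 3 / 2 * Dz + 3 * De ^+ 2.
  by apply: addr_ge0; apply: mulr_ge0; rewrite ?sqr_ge0// divr_ge0.
have a0 : 0 <= al j by exact: alpha_ge0.
have w0 : 0 <= weight n p L2 j :> R by exact: weight_ge0.
apply: addr_ge0.
  apply: mulr_ge0.
    by apply: divr_ge0; [apply: mulr_ge0 => //; rewrite divr_ge0|exact: ltW].
  by apply: addr_ge0 => //; apply: divr_ge0; [exact: sqr_ge0|rewrite mulr_ge0].
apply: mulr_ge0 => //; apply: divr_ge0 => //; apply: mulr_ge0; last exact: ltW.
exact: mulr_ge0.
Qed.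

Definition potential j := (\int[Pr]_w (carried_weight n p L2 j * gap j w + V j w)%:E)%E.

(** The inequality [(j + 1) * (j + 3) <= (j + 2) ^ 2] is what lets successive steps be chained. *)
Let ler_weight j : carried_weight n p L2 j.+1 <= weight n p L2 j :> R.
Proof.
apply: ler_wpM2l; first by rewrite ltW// weight_unit_gt0.
by rewrite -!natr1; move: (j%:R : R) => a; lra.
Qed.

Lemma potentialS j : (potential j.+1 <=
  potential j + (al j / lam)%:E * \int[Pr]_w (V j w)%:E + (err j)%:E)%E.
Proof.
have past_new : past_draws j `&` new_draws k j `<=` set0.
  move=> a [[Sa|[i ij ia]] ja]; first exact: (S0_new (conj Sa ja)).
  by case: ia ja => [->|[i1 ->]] [|[i2]] // [E]; move: ij; rewrite E ltnn.
have [my mz] := @measurable_inner_state j (past_draws j) (fun _ h => h).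
have mu' := @mu (past_draws j) (fun _ h => or_introl h).
have step := expected_step n8 p12 L20 SP convf xstarP RD ON m0 lam0 past_new mu' my mz.
apply: (@le_trans _ _ (\int[Pr]_w (weight n p L2 j * gap j.+1 w + V j.+1 w)%:E)%E).
  have w0 : 0 <= weight n p L2 j :> R by exact: weight_ge0.
  apply: ge0_le_integralr.
  - by apply: measurable_funD => //; exact: measurable_funM.
  - by apply: measurable_funD => //; exact: measurable_funM.
  - by move=> w; apply: addr_ge0 => //; exact: mulr_ge0.
  - by move=> w; apply: addr_ge0 => //; exact: mulr_ge0.
  - by apply: aeW => w; rewrite lerD2r; apply: ler_wpM2r => //; exact: ler_weight.
rewrite (_ : (\int[Pr]_w (weight n p L2 j * gap j.+1 w + V j.+1 w)%:E)%E =
  (\int[Pr]_w (sv (weight n p L2 j) (al j * n%:R) (x j w) (z j w - u w)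
      (xstar - u w) (G j w))%:E)%E); last first.
  apply: eq_integral => w _; rewrite /gap /V /y /z inner_stateS /=.
  by rewrite [u w + _]addrC addrK.
apply: le_trans step _.
have al0 : 0 <= al j / lam by apply: divr_ge0; [exact: alpha_ge0|exact: ltW].
pose A w := carried_weight n p L2 j * gap j w + V j w.
pose B w := al j / lam * V j w.
have mA : measurable_fun setT A by apply: measurable_funD => //; exact: measurable_funM.
have A0 w : 0 <= A w by apply: addr_ge0 => //; exact: mulr_ge0.
have mB : measurable_fun setT B by exact: measurable_funM.
have B0 w : 0 <= B w by exact: mulr_ge0.
have er0 := step_error_ge0 j.
rewrite (_ : \int[Pr]_w _ = \int[Pr]_w ((A w + B w) + err j)%:E)%E.
  rewrite -ge0_integralZr// ge0_integralDr//; last 2 first.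
  - exact: measurable_funD.
  - by move=> w; exact: addr_ge0.
  by rewrite ge0_integralDr// integral_cst_probability.
apply: eq_integral => w _; congr (_%:E); rewrite /A /B /gap /V.
congr (_ + _); move: (f _ - _) (dv _ _) (carried_weight _ _ _ _) (al j / lam).
by move=> a b c r; ring.
Qed.

(** A bootstrap: as long as the accumulated ratio of the [alpha] to [lam] is at most 1/2, the
    potential stays below [M], and this bound feeds the Young term of the next step, whose total
    over the run is at most [M / 2]. *)
Lemma inner_run_bound N (Theta : R) :
  (\int[Pr]_w (pr (xstar - u w))%:E <= Theta%:E)%E ->
  lam = 2 * \sum_(i < N) al i ->
  (\int[Pr]_w (carried_weight n p L2 N * gap N w)%:E <=
     (2 * (Theta + \sum_(i < N) err i))%:E)%E.
Proof.
move=> Th lamE; set M := 2 * _.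
have k1 : 1 < primal_exp n p :> R by exact: primal_exp_gt1.
have q2 : 2 <= dual_exp n p :> R by exact: dual_exp_ge2.
have kq : (primal_exp n p - 1) * (dual_exp n p - 1) = 1 :> R by exact: primal_dual_exp.
have mdiv0p v : dv 0 v = pr v by apply: mdiv0 => //; exact: Omega_gt0.
have pot0 : potential 0 = (\int[Pr]_w (pr (xstar - u w))%:E)%E.
  (* The initial gap has weight 0 and the run starts at [u], so only the prox-function of
     [xstar - u] remains. *)
  apply: eq_integral => w _; rewrite /carried_weight mul0r mulr0 mul0r add0r.
  by rewrite /V /z /inner_state /= subrr mdiv0p.
have Theta0 : 0 <= Theta.
  rewrite -lee_fin; apply: le_trans Th; apply: integral_ge0 => w _.
  by rewrite lee_fin -mdiv0p; exact: mdiv_prox_ge0.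
have sum_le (h : nat -> R) j : (forall i, 0 <= h i) -> (j <= N)%N ->
    \sum_(i < j) h i <= \sum_(i < N) h i.
  move=> h0 jN; have <- := subnKC jN; rewrite big_split_ord/= lerDl.
  by apply: sumr_ge0.
have bound j : (j <= N)%N -> (potential j <=
    (Theta + \sum_(i < j) err i + (\sum_(i < j) al i) / lam * M)%:E)%E.
  elim: j => [|j IH] jN.
    by rewrite !big_ord0 mul0r mul0r !addr0 pot0.
  have {}IH := IH (ltnW jN).
  have SA0 : 0 <= \sum_(i < N) al i by apply: sumr_ge0 => i _; exact: alpha_ge0.
  have SE0 : 0 <= \sum_(i < N) err i by apply: sumr_ge0 => i _; exact: step_error_ge0.
  have M0 : 0 <= M by apply: mulr_ge0 => //; exact: addr_ge0.
  have pM : (potential j <= M%:E)%E.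
    apply: le_trans IH _; rewrite lee_fin.
    have s1 := sum_le (fun i => err i) j step_error_ge0 (ltnW jN).
    have s2 := sum_le (fun i => al i) j (alpha_ge0 n8 L20 p12) (ltnW jN).
    have s3 : (\sum_(i < j) al i) / lam <= 2^-1.
      by rewrite ler_pdivrMr// lamE mulKf.
    have s4 : (\sum_(i < j) al i) / lam * M <= 2^-1 * M by apply: ler_wpM2r.
    apply: le_trans (lerD (lerD (lexx Theta) s1) s4) _.
    by rewrite /M mulKf// mulr_natl mulr2n.
  apply: le_trans (potentialS j) _.
  rewrite !big_ord_recr/=.
  have al0 : 0 <= al j / lam by apply: divr_ge0; [exact: alpha_ge0|exact: ltW].
  have Vp : (\int[Pr]_w (V j w)%:E <= M%:E)%E.
    apply: le_trans pM; apply: ge0_le_integralr => //.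
    - by apply: measurable_funD => //; exact: measurable_funM.
    - by move=> w; apply: addr_ge0 => //; exact: mulr_ge0.
    - by apply: aeW => w; rewrite lerDr mulr_ge0.
  have VM : ((al j / lam)%:E * \int[Pr]_w (V j w)%:E <= (al j / lam * M)%:E)%E.
    by rewrite [leRHS]EFinM; apply: lee_wpmul2l; rewrite ?lee_fin.
  apply: le_trans (leeD (leeD IH VM) (lexx _)) _.
  rewrite -!EFinD lee_fin le_eqVlt; apply/orP; left; apply/eqP.
  rewrite [(_ + _) / lam]mulrDl [(_ + _) * M]mulrDl.
  have swap4 (t a b c r : R) : t + b + a + c + r = t + (b + r) + (a + c) by ring.
  exact: swap4.
have sumE : (\sum_(i < N) al i) / lam = 2^-1.
  have S0' : \sum_(i < N) al i != 0.
    by apply/eqP => h; move: lam0; rewrite lamE h mulr0 ltxx.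
  by rewrite lamE invfM mulrCA mulfV ?mulr1.
have : (potential N <= M%:E)%E.
  apply: le_trans (bound N (leqnn N)) _; rewrite lee_fin sumE {1}/M mulKf//.
  by rewrite /M mulr_natl mulr2n.
apply: le_trans; apply: ge0_le_integralr.
- exact: measurable_funM.
- by apply: measurable_funD => //; exact: measurable_funM.
- by move=> w; exact: mulr_ge0.
- by move=> w; apply: addr_ge0 => //; exact: mulr_ge0.
- by apply: aeW => w; rewrite lerDl.
Qed.

End inner_run.

(** * Scalar estimates for one run *)

Section inner_scalars.
Context {R : realType}.
Variables (n p : nat) (L2 sigma Dz De : R) (m : nat).
Hypotheses (n8 : (8 <= n)%N) (p12 : p \in [:: 1%N; 2%N]) (L20 : 0 < L2).
Local Notation b := (weight_unit n p L2 : R).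
Local Notation al := (@alpha R n p L2).
Local Notation D := (3 / 2 * Dz + 3 * De ^+ 2).
Local Notation q := (sigma ^+ 2 / (n%:R * m%:R)).

Lemma sum_alpha N : \sum_(i < N) al i = b * (N%:R * (N%:R + 3)).
Proof.
elim: N => [|N IH]; first by rewrite big_ord0 mul0r mulr0.
have NS : N.+1%:R = N%:R + 1 :> R by rewrite natr1.
rewrite big_ord_recr/= IH alphaE// -[N.+2]addn2 natrD NS.
by move: b (N%:R : R) => c x; ring.
Qed.

Lemma sum_weight_le N : \sum_(i < N) weight n p L2 i <= b * (N%:R * (N%:R + 1) ^+ 2).
Proof.
have b0 : 0 < b by exact: weight_unit_gt0.
apply: (@le_trans _ _ (\sum_(i < N) b * (N%:R + 1) ^+ 2)).
  apply: ler_sum => i _; apply: ler_wpM2l; first exact: ltW.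
  by rewrite natr1; apply: lerXn2r; rewrite ?nnegrE// ler_nat; exact: ltn_ord.
by rewrite sumr_const card_ord -[_ *+ N]mulr_natl mulrCA.
Qed.

Lemma sum_step_error N lam : lam = 2 * \sum_(i < N) al i ->
  \sum_(i < N) @step_error R n p L2 sigma Dz De i m lam =
  13 / 24 / L2 * (\sum_(i < N) weight n p L2 i) * (q + D)
  + n%:R * (\sum_(i < N) al i) ^+ 2 * D.
Proof.
move=> lamE.
transitivity (\sum_(i < N) (13 / 24 / L2 * (q + D) * weight n p L2 i
    + n%:R * lam / 2 * D * al i)).
  apply: eq_bigr => i _; rewrite /step_error.
  by move: (weight n p L2 i) (al i) D (q + D) => w a r s; ring.
rewrite big_split/= -[X in X + _]mulr_sumr -[X in _ + X]mulr_sumr lamE.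
move: (\sum_(i < N) al i) (\sum_(i < N) weight n p L2 i) D (q + D) => a w r s.
by field; rewrite gt_eqF.
Qed.

(** The total error is divided by the final weight, of order [N^2]. The three summands, from the
    starting distance, from variance and noise, and from the Young term, are compared separately;
    384 is twice the 192 of [weight_unit]. *)
Lemma inner_scalar_le N lam Theta s : (13 <= N)%N -> lam = 2 * \sum_(i < N) al i ->
  0 <= Theta -> 0 <= D -> D <= 6 * s ^+ 2 ->
  2 * (Theta + \sum_(i < N) @step_error R n p L2 sigma Dz De i m lam) <=
  carried_weight n p L2 N * (384 * n%:R ^+ 2 * rho n p * L2 / N%:R ^+ 2 * Theta
    + 5 / 4 * N%:R / L2 * (q + D) + N%:R ^+ 2 / (12 * n%:R * rho n p * L2) * s ^+ 2).
Proof.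
move=> N13 lamE Th0 D0 Ds; rewrite (sum_step_error lamE) sum_alpha /carried_weight.
have sw := sum_weight_le N; move: (\sum_(i < N) weight n p L2 i) sw => w sw.
have b0 : 0 < b by exact: weight_unit_gt0.
have n0 : 0 < n%:R :> R by rewrite ltr0n (leq_trans _ n8).
have r0 : 0 < rho n p :> R by exact: rho_gt0.
have x13 : 13 <= N%:R :> R by rewrite (ler_nat R 13 N).
have q0 : 0 <= q by rewrite divr_ge0 ?sqr_ge0 ?mulr_ge0.
have bE : b * (192 * n%:R ^+ 2 * rho n p * L2) = 1.
  rewrite /weight_unit mulVf//.
  by move: (rho n p) r0 => r r0; rewrite !mulf_neq0 ?expf_neq0 ?gt_eqF// ltr0n.
rewrite -[N.+2]addn2 natrD.
move: (rho n p : R) b (N%:R : R) (n%:R : R) q D r0 b0 x13 n0 q0 D0 Ds bE sw.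
move=> r c x nn qq DD r0 c0 x13 n0 q0 D0 Ds bE sw.
have x0 : 0 < x by lra.
have t1 : 2 * Theta <= c * (x * (x + 2)) * (384 * nn ^+ 2 * r * L2 / x ^+ 2 * Theta).
  have -> : c * (x * (x + 2)) * (384 * nn ^+ 2 * r * L2 / x ^+ 2 * Theta) =
     c * (192 * nn ^+ 2 * r * L2) * (2 * Theta * (1 + 2 / x)) by field; rewrite gt_eqF.
  rewrite bE mul1r; apply: ler_peMr; first exact: mulr_ge0.
  by rewrite lerDl divr_ge0// ltW.
have t2 : 2 * (13 / 24 / L2 * w * (qq + DD)) <=
    c * (x * (x + 2)) * (5 / 4 * x / L2 * (qq + DD)).
  have -> : 2 * (13 / 24 / L2 * w * (qq + DD)) = (13 / 12 * w) * ((qq + DD) / L2).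
    by field; rewrite gt_eqF.
  have -> : c * (x * (x + 2)) * (5 / 4 * x / L2 * (qq + DD)) =
     (c * x * (5 / 4 * x * (x + 2))) * ((qq + DD) / L2) by field; rewrite gt_eqF.
  apply: ler_wpM2r; first by rewrite divr_ge0 ?addr_ge0// ltW.
  have h : c * (x * (x + 1) ^+ 2) * (13 / 12) <= c * x * (5 / 4 * x * (x + 2)).
    rewrite mulrA -mulrA; apply: ler_wpM2l; first by rewrite mulr_ge0// ltW.
    by nra.
  by apply: le_trans h; rewrite mulrC; apply: ler_wpM2r.
have t3 : 2 * (nn * (c * (x * (x + 3))) ^+ 2 * DD) <=
    c * (x * (x + 2)) * (x ^+ 2 / (12 * nn * r * L2) * s ^+ 2).
  have cn : c * nn = (192 * nn * r * L2)^-1.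
    have z0 : 192 * nn * r * L2 != 0 by rewrite !mulf_neq0 ?gt_eqF// ltr0n.
    apply: (mulIf z0); rewrite mulVf//.
    by rewrite -[RHS]bE; ring.
  have -> : 2 * (nn * (c * (x * (x + 3))) ^+ 2 * DD) =
     c * (c * nn) * x ^+ 2 * 2 * (x + 3) ^+ 2 * DD by ring.
  rewrite cn.
  have -> : c * (192 * nn * r * L2)^-1 * x ^+ 2 * 2 * (x + 3) ^+ 2 * DD =
    c * x ^+ 2 / (nn * r * L2) * ((x + 3) ^+ 2 / 96 * DD).
    by field; rewrite !gt_eqF.
  have -> : c * (x * (x + 2)) * (x ^+ 2 / (12 * nn * r * L2) * s ^+ 2) =
    c * x ^+ 2 / (nn * r * L2) * (x * (x + 2) / 12 * s ^+ 2).
    by field; rewrite !gt_eqF.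
  apply: ler_wpM2l.
    by rewrite divr_ge0 ?mulr_ge0 ?sqr_ge0// ltW.
  (* Here the threshold 13 is decided: what remains is [3 (x + 3)^2 <= 4 x (x + 2)], true at 13 and
     false at 12. *)
  apply: (@le_trans _ _ ((x + 3) ^+ 2 / 96 * (6 * s ^+ 2))).
    by apply: ler_wpM2l => //; rewrite divr_ge0 ?sqr_ge0.
  rewrite mulrA; apply: ler_wpM2r; first exact: sqr_ge0.
  by nra.
have distr (h a b' c' : R) : h * (a + b' + c') = h * a + h * b' + h * c' by ring.
by rewrite [X in 2 * X]addrA distr distr; apply: lerD => //; apply: lerD.
Qed.

End inner_scalars.

(** * The restarts *)

Lemma nat_ceil_ge {R : realType} (x : R) : 0 <= x -> x <= (nat_ceil x)%:R.
Proof.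
move=> x0; have c0 : 0 <= Num.ceil x by rewrite ceil_ge0 (lt_le_trans _ x0)// ltrN10.
apply: le_trans (ceil_ge x) _.
by rewrite /nat_ceil -[X in X%:~R]gez0_abs// pmulrn.
Qed.

Lemma nat_ceil_lt {R : realType} (x : R) : 0 <= x -> (nat_ceil x)%:R < x + 1.
Proof.
move=> x0; have c0 : 0 <= Num.ceil x by rewrite ceil_ge0 (lt_le_trans _ x0)// ltrN10.
have := ceilB1_lt x; rewrite intrB ltrBlDr.
by rewrite /nat_ceil -[X in X%:~R < _]gez0_abs// -pmulrn.
Qed.

Section restart_scalars.
Context {R : realType}.
Variables (n p : nat) (L2 mu sigma Rp : R).
Hypotheses (n8 : (8 <= n)%N) (p12 : p \in [:: 1%N; 2%N]) (L20 : 0 < L2)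
  (mu0 : 0 < mu) (Rp0 : 0 < Rp).
Local Notation r := (rho n p : R).
Local Notation Om := (Omega n p : R).
Local Notation N0 := (inner_steps n p L2 mu).
Local Notation m k := (batch_size n p L2 mu sigma Rp k).

Let n0 : 0 < n%:R :> R. Proof. by rewrite ltr0n (leq_trans _ n8). Qed.
Let r0 : 0 < r. Proof. exact: rho_gt0. Qed.
Let om1 : 1 <= Om. Proof. exact: Omega_ge1. Qed.
Let om0 : 0 < Om. Proof. by move: om1; apply: lt_le_trans. Qed.

Lemma inner_steps_arg_ge0 : 0 <= 8 * (384 * n%:R ^+ 2 * r) * L2 * Om / mu.
Proof.
move: (ler0n R 384) r0 om0; move: (384 : R) r Om => z a b z0 a0 b0.
by apply: divr_ge0; [|exact: ltW]; do !apply: mulr_ge0 => //; rewrite ?sqr_ge0 ?ltW.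
Qed.

Lemma inner_steps_sqr : 3072 * n%:R ^+ 2 * r * L2 * Om <= mu * N0%:R ^+ 2.
Proof.
have h := nat_ceil_ge (sqrtr_ge0 (8 * (384 * n%:R ^+ 2 * r) * L2 * Om / mu)).
rewrite -/N0 in h.
have h2 : Num.sqrt (8 * (384 * n%:R ^+ 2 * r) * L2 * Om / mu) ^+ 2 <= N0%:R ^+ 2.
  by apply: lerXn2r => //; rewrite nnegrE ?sqrtr_ge0.
move: h2; rewrite sqr_sqrtr ?inner_steps_arg_ge0// ler_pdivrMr// [X in _ <= X]mulrC => h2.
apply: le_trans h2; rewrite le_eqVlt; apply/orP; left; apply/eqP.
by move: r Om (n%:R : R) => a b c; ring.
Qed.

Lemma sqr_n_rho_ge1 : 1 <= n%:R ^+ 2 * r.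
Proof.
have n8R : 8 <= n%:R :> R by rewrite (ler_nat R 8 n).
move: p12; rewrite !inE => /orP[/eqP p1|/eqP p2].
  rewrite rho1//; have := @ln_ge_32 R n n8.
  move: (ln _) => l l32; have -> : n%:R ^+ 2 * ((16 * l - 8) / n%:R) = n%:R * (16 * l - 8).
    by field; rewrite gt_eqF.
  by move: n8R; move: (n%:R : R) => x ?; nra.
by rewrite rho2// mulr1; move: n8R; move: (n%:R : R) => x ?; nra.
Qed.

(** With [n^2 rho >= 1] and [Omega >= 1] one has [N0^2 >= 3072 L2 / mu >= 1536], far above
    [12^2]. *)
Lemma inner_steps_ge13 : mu <= 2 * L2 -> (13 <= N0)%N.
Proof.
move=> muL; rewrite leqNgt; apply/negP => N13.
have N12 : N0%:R <= 12 :> R by rewrite (ler_nat R N0 12).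
have h := inner_steps_sqr; have h1 := sqr_n_rho_ge1.
have x2 : N0%:R ^+ 2 <= 144 :> R.
  by move: N12 (ler0n R N0); move: (N0%:R : R) => x ? ?; nra.
have hL : L2 <= n%:R ^+ 2 * r * L2 * Om.
  rewrite -mulrA mulrCA; apply: ler_peMr; first exact: ltW.
  exact: mulr_ege1 h1 om1.
have := ler_wpM2l (ltW mu0) x2.
have h' : 3072 * (n%:R ^+ 2 * r * L2 * Om) <= mu * N0%:R ^+ 2.
  have assoc (z a b c t : R) : z * (a * b * c * t) = z * a * b * c * t by ring.
  by rewrite assoc.
move: h' hL muL L20; move: (mu * N0%:R ^+ 2) (n%:R ^+ 2 * r * L2 * Om) => a b.
by move: mu L2 => c l; lra.
Qed.

Lemma batch_size_gt0 k : (0 < m k)%N.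
Proof. by rewrite /batch_size leq_max ltnSn. Qed.

(** The batch doubles with [k] so that the variance shrinks at the rate of the target gap; its
    constant leaves the share 1/32. *)
Lemma batch_size_ge k :
  N0%:R * (sigma ^+ 2 / (n%:R * (m k)%:R)) / L2 <= mu * Rp ^+ 2 * 2 ^- k / 32.
Proof.
have mk0 : 0 < (m k)%:R :> R by rewrite ltr0n batch_size_gt0.
have R20 : 0 < Rp ^+ 2 by exact: exprn_gt0.
have k0 : 0 < 2 ^+ k :> R by exact: exprn_gt0.
set a := 8 * (4 / n%:R) * sigma ^+ 2 * N0%:R * 2 ^+ k / (L2 * mu * Rp ^+ 2).
have a0 : 0 <= a.
  apply: divr_ge0; last by apply: mulr_ge0; [apply: mulr_ge0; exact: ltW|exact: ltW].
  apply: mulr_ge0; last exact: ltW.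
  apply: mulr_ge0 => //; apply: mulr_ge0; last exact: sqr_ge0.
  by apply: mulr_ge0 => //; apply: divr_ge0 => //; exact: ltW.
have am : a <= (m k)%:R.
  apply: le_trans (nat_ceil_ge a0) _; rewrite ler_nat; exact: leq_maxr.
have -> : N0%:R * (sigma ^+ 2 / (n%:R * (m k)%:R)) / L2 =
    a * (mu * Rp ^+ 2 * 2 ^- k / 32) / (m k)%:R.
  rewrite /a; move: (N0%:R : R) ((m k)%:R : R) mk0 (2 ^+ k : R) k0 => x y y0 z z0.
  by field; rewrite !gt_eqF.
rewrite ler_pdivrMr// mulrC; apply: ler_wpM2l => //.
apply: divr_ge0 => //; apply: mulr_ge0; last by rewrite invr_ge0 ltW.
by apply: mulr_ge0; exact: ltW.
Qed.

Variables (Dz De : R).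
Hypotheses (Dz0 : 0 <= Dz) (De0 : 0 <= De).
Local Notation s := (Num.sqrt Dz / 2 + 2 * De).
Local Notation D := (3 / 2 * Dz + 3 * De ^+ 2).
Local Notation Delta := (noise_level n p L2 mu Rp Dz De).

Lemma noise_sqr_le : D <= 6 * s ^+ 2.
Proof.
have := sqr_sqrtr Dz0; have := sqrtr_ge0 Dz.
move: (Num.sqrt Dz) => x x0 <-.
by have := mulr_ge0 x0 De0; have := sqr_ge0 De; lra.
Qed.

(** With the weights 3/2 and 3 of the noise bound, the coefficients to compare are [15/8 <= 61/24]
    and [15/4 <= 122/3]. *)
Lemma noise_level_ge :
  5 / 4 * N0%:R / L2 * D + N0%:R ^+ 2 / (12 * n%:R * r * L2) * s ^+ 2 <= Delta.
Proof.
rewrite /noise_level; apply: lerD => //.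
have h : 0 <= 12 * Num.sqrt (2 * n%:R * Rp ^+ 2 * Om) / N0%:R ^+ 2 * s.
  apply: mulr_ge0; last by rewrite addr_ge0 ?divr_ge0 ?mulr_ge0// sqrtr_ge0.
  by apply: divr_ge0; [apply: mulr_ge0 => //; exact: sqrtr_ge0|exact: sqr_ge0].
rewrite -[leLHS]addr0; apply: lerD => //.
have a0 : 0 <= N0%:R / L2 * Dz by apply: mulr_ge0 => //; apply: divr_ge0 => //; exact: ltW.
have b0 : 0 <= N0%:R / L2 * De ^+ 2.
  by apply: mulr_ge0; rewrite ?sqr_ge0//; apply: divr_ge0 => //; exact: ltW.
have -> : 5 / 4 * N0%:R / L2 * D = 15 / 8 * (N0%:R / L2 * Dz) + 15 / 4 * (N0%:R / L2 * De ^+ 2).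
  by move: (N0%:R : R) => x; field; rewrite gt_eqF.
have -> : 61 * N0%:R / (24 * L2) * Dz + 122 * N0%:R / (3 * L2) * De ^+ 2 =
    61 / 24 * (N0%:R / L2 * Dz) + 122 / 3 * (N0%:R / L2 * De ^+ 2).
  by move: (N0%:R : R) => x; field; rewrite gt_eqF.
by move: (_ * Dz) (_ * De ^+ 2) a0 b0 => x y; lra.
Qed.

Lemma noise_level_ge0 : 0 <= Delta.
Proof.
apply: le_trans noise_level_ge; apply: addr_ge0; apply: mulr_ge0; rewrite ?sqr_ge0//.
- by apply: divr_ge0; [apply: mulr_ge0 => //; exact: divr_ge0|exact: ltW].
- by apply: addr_ge0; apply: mulr_ge0; rewrite ?sqr_ge0// divr_ge0.
- apply: divr_ge0; first exact: sqr_ge0.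
  by apply: mulr_ge0; [apply: mulr_ge0; [exact: mulr_ge0|exact: ltW]|exact: ltW].
Qed.

Lemma radius2_gt0 k : 0 < radius2 mu Rp Delta k.
Proof.
have k0 : 0 < 2 ^- k :> R by rewrite invr_gt0 exprn_gt0.
have k1 : 2 ^- k <= 1 :> R by rewrite invf_le1 ?exprn_gt0// exprn_ege1// ler1n.
apply: ltr_wpDr; last by rewrite mulr_gt0// exprn_gt0.
apply: mulr_ge0; last by rewrite subr_ge0.
by apply: divr_ge0; [apply: mulr_ge0 => //; exact: noise_level_ge0|exact: ltW].
Qed.

(** The budget of one restart, with [xi = mu Rp^2 2^-k]: the choice of [N0] leaves [mu / 16] times
    the old squared radius, the batch leaves [5/128 xi], and the noise [Delta]. The available amount
    is [xi / 4 + Delta (2 - 2^-k)]; for the terms in [Delta] the comparison is an equality at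
    [k = 0]. *)
Lemma restart_scalar_le k : mu <= 2 * L2 ->
  384 * n%:R ^+ 2 * r * L2 / N0%:R ^+ 2 * (Om / 2 * radius2 mu Rp Delta k)
  + 5 / 4 * N0%:R / L2 * (sigma ^+ 2 / (n%:R * (m k)%:R) + D)
  + N0%:R ^+ 2 / (12 * n%:R * r * L2) * s ^+ 2 <= mu / 2 * radius2 mu Rp Delta k.+1.
Proof.
move=> muL; have N13 := inner_steps_ge13 muL.
have x0 : 0 < N0%:R :> R by rewrite ltr0n (leq_trans _ N13).
have k0 : 0 < 2 ^- k :> R by rewrite invr_gt0 exprn_gt0.
have k1 : 2 ^- k <= 1 :> R by rewrite invf_le1 ?exprn_gt0// exprn_ege1// ler1n.
have t1 : 384 * n%:R ^+ 2 * r * L2 / N0%:R ^+ 2 * (Om / 2 * radius2 mu Rp Delta k) <=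
    mu / 16 * radius2 mu Rp Delta k.
  rewrite mulrA; apply: ler_wpM2r; first by rewrite ltW// radius2_gt0.
  have -> : 384 * n%:R ^+ 2 * r * L2 / N0%:R ^+ 2 * (Om / 2) =
      3072 * n%:R ^+ 2 * r * L2 * Om / N0%:R ^+ 2 / 16.
    by move: r Om (N0%:R : R) x0 => a b x x0; field; rewrite gt_eqF.
  rewrite ler_pM2r// ler_pdivrMr; [exact: inner_steps_sqr|exact: exprn_gt0].
have t2 := batch_size_ge k; have t3 := noise_level_ge; have D0 := noise_level_ge0.
have kE : 2 ^- k.+1 = 2 ^- k / 2 :> R by rewrite exprS invfM mulrC.
have xi0 : 0 <= mu * Rp ^+ 2 * 2 ^- k.
  by apply: mulr_ge0; [apply: mulr_ge0; [exact: ltW|exact: sqr_ge0]|exact: ltW].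
have rE j : mu * radius2 mu Rp Delta j = mu * Rp ^+ 2 * 2 ^- j + 4 * (Delta * (1 - 2 ^- j)).
  by rewrite /radius2; move: Delta (2 ^- j : R) => a b; field; rewrite gt_eqF.
have e1 : mu / 16 * radius2 mu Rp Delta k = (mu * radius2 mu Rp Delta k) / 16 by rewrite mulrAC.
have e2 : mu / 2 * radius2 mu Rp Delta k.+1 = (mu * radius2 mu Rp Delta k.+1) / 2 by rewrite mulrAC.
have e3 : mu * Rp ^+ 2 * 2 ^- k.+1 = mu * Rp ^+ 2 * 2 ^- k / 2 by rewrite kE mulrA.
have Dk : 0 <= Delta * 2 ^- k by apply: mulr_ge0 => //; exact: ltW.
have Dk1 : Delta * 2 ^- k <= Delta by apply: ler_piMr.
rewrite e2 rE e3 kE; rewrite e1 rE in t1.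
have e4 : 5 / 4 * N0%:R / L2 * (sigma ^+ 2 / (n%:R * (m k)%:R) + D) =
  5 / 4 * (N0%:R * (sigma ^+ 2 / (n%:R * (m k)%:R)) / L2) + 5 / 4 * N0%:R / L2 * D.
  by move: (N0%:R : R) (sigma ^+ 2 / _) D L2^-1 => x y z l; ring.
rewrite e4.
move: t1 t2 t3 D0 xi0 Dk Dk1.
move: (384 * n%:R ^+ 2 * r * L2 / _ * _) (N0%:R * (sigma ^+ 2 / (n%:R * (m k)%:R)) / L2).
move: (5 / 4 * N0%:R / L2 * D) (N0%:R ^+ 2 / (12 * n%:R * r * L2) * s ^+ 2) (mu * Rp ^+ 2 * 2 ^- k).
move: Delta (2 ^- k : R) => a h b c w t q.
by lra.
Qed.

End restart_scalars.

Lemma lnormN {R : realType} {n : nat} (r : R) (x : 'rV[R]_n) : lnorm r (- x) = lnorm r x.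
Proof. by rewrite /lnorm; under eq_bigr do rewrite mxE normrN. Qed.

Lemma lnorm_delta {R : realType} {n : nat} (r : R) (i : 'I_n) : r != 0 ->
  lnorm r (delta_mx 0 i : 'rV[R]_n) = 1.
Proof.
move=> r0; rewrite /lnorm (bigD1 i)//= mxE !eqxx normr1 powR1 big1 ?addr0 ?powR1//.
by move=> j ji; rewrite mxE (negPf ji) andbF normr0 powR0.
Qed.

Lemma ge0_le_integralZ {R : realType} d (T : measurableType d)
    (mu : {measure set T -> \bar R}) (f h : T -> R) (c B : R) :
  measurable_fun setT f -> measurable_fun setT h ->
  (forall x, 0 <= f x) -> (forall x, 0 <= h x) -> 0 <= c ->
  (forall x, f x <= c * h x) -> (\int[mu]_x (h x)%:E <= B%:E)%E ->
  (\int[mu]_x (f x)%:E <= (c * B)%:E)%E.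
Proof.
move=> mf mh f0 h0 c0 fh hB; apply: (@le_trans _ _ (\int[mu]_x (c * h x)%:E)%E).
  apply: ge0_le_integralr => //; first exact: measurable_funM.
    by move=> x; exact: mulr_ge0.
  exact: aeW.
rewrite ge0_integralZr// [leRHS]EFinM.
by apply: lee_wpmul2l; [rewrite lee_fin|exact: hB].
Qed.

Lemma ge0_integral_le_div {R : realType} d (T : measurableType d)
    (mu : {measure set T -> \bar R}) (h : T -> R) (c B : R) :
  measurable_fun setT h -> (forall x, 0 <= h x) -> 0 < c ->
  (\int[mu]_x (c * h x)%:E <= (c * B)%:E)%E -> (\int[mu]_x (h x)%:E <= B%:E)%E.
Proof.
move=> mh h0 c0; have c0' := ltW c0; rewrite ge0_integralZr//.
have -> : (c * B)%:E = (c%:E * B%:E)%E by rewrite EFinM.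
by rewrite lee_pmul2l.
Qed.

(** * Consequences of strong convexity at the minimizer *)

Section strong_convexity.
Context {R : realType} {n : nat} {d : measure_display} {X : measurableType d}.
Variable P : probability X R.
Variables (F : 'rV[R]_n -> X -> R) (g : 'rV[R]_n -> X -> 'rV[R]_n) (L : X -> R).
Variables (L2 sigma r mu : R).
Hypotheses (L20 : 0 < L2) (SP : stochastic_problem P F g L L2 sigma).
Local Notation f := (objective P F).
Hypotheses (mu0 : 0 < mu) (scf : strongly_convex r mu f).
Variable xstar : 'rV[R]_n.
Hypothesis xstarP : minimizer f xstar.

Lemma strongly_convex_convex x y : f x + dotv (grad f x) (y - x) <= f y.
Proof.
apply: le_trans (scf x y); rewrite lerDl.
by apply: mulr_ge0; [apply: divr_ge0 => //; exact: ltW|exact: sqr_ge0].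
Qed.

(** A gradient step of length [1 / (2 L2)] from the minimizer would lower the objective by
    [|h|^2 / (4 L2)]. *)
Lemma grad_minimizer v : dotv (grad f xstar) v = 0.
Proof.
set h := grad f xstar.
have := objective_descent L20 SP strongly_convex_convex xstar (xstar - (2 * L2)^-1 *: h).
have -> : xstar - (2 * L2)^-1 *: h - xstar = - ((2 * L2)^-1 *: h).
  by rewrite addrAC subrr add0r.
rewrite -/h dotvNr dotvNl dotvNr opprK dotvZr dotvZl dotvZr => h1.
have h2 := le_trans (xstarP _) h1.
suff h0 : dotv h h = 0 by rewrite (dotv_eq0 h0) dotv0l.
apply/eqP; rewrite eq_le dotv_ge0 andbT.
have l0 : 0 < (4 * L2)^-1 by rewrite invr_gt0 mulr_gt0.
have e : L2 * ((2 * L2)^-1 * ((2 * L2)^-1 * dotv h h)) = (4 * L2)^-1 * dotv h h.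
  by move: (dotv h h) L20 => a ?; field; rewrite gt_eqF.
have e2 : (2 * L2)^-1 * dotv h h = 2 * ((4 * L2)^-1 * dotv h h).
  by move: (dotv h h) L20 => a ?; field; rewrite gt_eqF.
rewrite -(pmulr_rle0 _ l0); move: h2; rewrite e e2.
by move: (_^-1 * _) (f xstar) => a b; lra.
Qed.

Lemma strongly_convex_gap x : mu / 2 * lnorm r (x - xstar) ^+ 2 <= f x - f xstar.
Proof. by have := scf xstar x; rewrite grad_minimizer addr0 lerBrDl. Qed.

(** Both quadratic bounds are evaluated at [xstar] plus a coordinate vector, which has norm 1 for
    every exponent. *)
Lemma strongly_convex_smooth : (0 < n)%N -> r != 0 -> mu <= 2 * L2.
Proof.
move=> n0 r0; pose v : 'rV[R]_n := delta_mx 0 (Ordinal n0).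
have := scf xstar (xstar + v).
have := objective_descent L20 SP strongly_convex_convex xstar (xstar + v).
have -> : xstar + v - xstar = v by rewrite addrAC subrr add0r.
rewrite !grad_minimizer addr0 lnorm_delta// expr1n mulr1.
have -> : dotv v v = 1 by rewrite dotv_delta mxE !eqxx.
by move: (f _) (f (_ + _)) => a b; lra.
Qed.

End strong_convexity.

Section outer_run.
Context {R : realType} {n p : nat} {d : measure_display} {X : measurableType d}.
Hypotheses (n8 : (8 <= n)%N) (p12 : p \in [:: 1%N; 2%N]).
Variable P : probability X R.
Variables (F : 'rV[R]_n -> X -> R) (g : 'rV[R]_n -> X -> 'rV[R]_n) (L : X -> R).
Variables (L2 sigma mu Rp : R).
Hypotheses (L20 : 0 < L2) (mu0 : 0 < mu) (Rp0 : 0 < Rp)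
  (SP : stochastic_problem P F g L L2 sigma).
Local Notation f := (objective P F).
Hypothesis scf : strongly_convex p%:R mu f.
Variables xstar x0 : 'rV[R]_n.
Hypotheses (xstarP : minimizer f xstar) (x0R : lnorm p%:R (x0 - xstar) ^+ 2 <= Rp ^+ 2).
Context {d' : measure_display} {T : measurableType d'} (Pr : probability T R).
Variables (e : nat -> nat -> {RV Pr >-> 'rV[R]_n})
          (xi : nat -> nat -> nat -> {RV Pr >-> X}).
Hypothesis RD : random_draws P e xi.
Variables (zeta eta : 'rV[R]_n -> X -> 'rV[R]_n -> R) (Dz De : R).
Hypothesis ON : oracle_noise P zeta eta Dz De.
Local Notation pr := (@mprox R n (primal_exp n p) (Omega n p)).
Local Notation N0 := (inner_steps n p L2 mu).
Local Notation m k := (batch_size n p L2 mu sigma Rp k).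
Local Notation Delta := (noise_level n p L2 mu Rp Dz De).

Let convf x y : f x + dotv (grad f x) (y - x) <= f y.
Proof. exact: (strongly_convex_convex mu0 scf). Qed.

Let p0 : p%:R != 0 :> R.
Proof. by move: p12; rewrite pnatr_eq0 !inE => /orP[] /eqP ->. Qed.

Let muL : mu <= 2 * L2.
Proof.
by apply: (strongly_convex_smooth L20 SP mu0 scf xstarP) => //; exact: leq_trans n8.
Qed.

Let Dz0 : 0 <= Dz.
Proof. by have [] := oracle_noise_ge0 ON (leq_trans (isT : 0 < 8)%N n8). Qed.

Let De0 : 0 <= De.
Proof. by have [] := oracle_noise_ge0 ON (leq_trans (isT : 0 < 8)%N n8). Qed.

Let rad_gt0 k : 0 < radius2 mu Rp Delta k. Proof. exact: radius2_gt0. Qed.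

(* The prox-function is 2-homogeneous, so the scaling by the radius cancels.  *)
Lemma restart_proxE k (v : 'rV[R]_n) :
  restart_prox p mu Rp Delta k v = fun x => pr (x - v).
Proof.
apply/funext => x; rewrite /restart_prox proxE /mprox lnormZ; last first.
  by rewrite gt_eqF// (lt_trans ltr01)// primal_exp_gt1.
have q0 := rad_gt0 k; move: (radius2 _ _ _ _) q0 => q q0.
rewrite gtr0_norm ?invr_gt0 ?sqrtr_gt0// exprMn exprVn sqr_sqrtr ?ltW//.
move: (Omega n p / 2) (lnorm _ (x - v) ^+ 2) => a b.
by rewrite [q * _]mulrCA mulVKf// gt_eqF.
Qed.

Definition outer_iterate k w := @arddsc R n p L2 mu sigma Rp Delta X
  (oracle g zeta eta) x0 (fun k j => e k j w) (fun k j i => xi k j i w) k.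

Let u := outer_iterate.

Let uS k w : u k.+1 w =
  (inner_state (p := p) g L2 e xi zeta eta k (m k) (u k) N0 w).1.
Proof. by rewrite /u /outer_iterate /= restart_proxE. Qed.

Definition outer_draws k : set draw_index :=
  [set a | match a with inl (k', _) => (k' < k)%N | inr (k', _, _) => (k' < k)%N end].

Lemma measurable_outer_iterate k S : outer_draws k `<=` S ->
  measurable_fun setT (u k : draws e xi S -> 'rV[R]_n).
Proof.
elim: k S => [|k IH] S kS; first exact: measurable_cst.
rewrite [X in measurable_fun _ X](_ : _ = fun w =>
  (inner_state (p := p) g L2 e xi zeta eta k (m k) (u k) N0 w).1); last first.
  by apply/funext => w; rewrite uS.
suff kS' : past_draws k (outer_draws k) N0 `<=` S.
  by have [] := measurable_inner_state n8 p12 SP ON (m k) IH kS'.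
move=> a [ka|[i _ ia]]; apply: kS.
  by case: a ka => [[k' j']|[[k' j'] i']] /= kk; exact: ltnW.
by case: ia => [->|[i' ->]] /=.
Qed.

Let measurable_u k : measurable_fun setT (u k).
Proof.
exact: (measurable_draws_setT (e := e) (xi := xi) (S := outer_draws k)
  (@measurable_outer_iterate k (outer_draws k) (fun _ h => h))).
Qed.

Let measurable_gap k : measurable_fun setT (fun w => f (u k w) - f xstar).
Proof.
apply: measurable_funB => //.
exact: (measurableT_comp (measurable_objective L20 SP convf)).
Qed.

Let measurable_dist k : measurable_fun setT (fun w => lnorm p%:R (u k w - xstar) ^+ 2).
Proof.
apply: measurable_funX; apply: (measurableT_comp (measurable_lnorm p%:R)).
by apply: measurable_subv => //; exact: measurable_cst.
Qed.

(** The distance bound controls the prox-function at the restart through [prox_le]. The bounds for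
    the run and for the restart then share the factor [carried_weight N0], which is divided out. *)
Lemma outer_gap_le k :
  (\int[Pr]_w (lnorm p%:R (u k w - xstar) ^+ 2)%:E <= (radius2 mu Rp Delta k)%:E)%E ->
  (\int[Pr]_w (f (u k.+1 w) - f xstar)%:E <=
   (mu / 2 * radius2 mu Rp Delta k.+1)%:E)%E.
Proof.
move=> dist; have N13 := inner_steps_ge13 n8 p12 L20 mu0 muL.
have n0 : 0 < n%:R :> R by rewrite ltr0n (leq_trans _ n8).
have om0 : 0 < Omega n p :> R by exact: Omega_gt0.
have om2 : 0 <= Omega n p / 2 :> R by rewrite divr_ge0// ltW.
pose Theta := Omega n p / 2 * radius2 mu Rp Delta k.
have Th0 : 0 <= Theta by apply: mulr_ge0 => //; exact: ltW.
have Th : (\int[Pr]_w (pr (xstar - u k w))%:E <= Theta%:E)%E.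
  apply: (ge0_le_integralZ _ (measurable_dist k) _ _ om2 _ dist).
  - apply: measurable_funM => //; apply: measurable_funX.
    apply: (measurableT_comp (measurable_lnorm _)).
    by apply: measurable_subv => //; exact: measurable_cst.
  - move=> w; apply: mulr_ge0; last exact: sqr_ge0.
    by apply: divr_ge0 => //; exact: ltW.
  - by move=> w; exact: sqr_ge0.
  - move=> w; have := prox_le n8 p12 (xstar - u k w).
    by rewrite proxE -[xstar - _]opprB lnormN.
pose lam := 2 * \sum_(i < N0) @alpha R n p L2 i.
have b0 : 0 < weight_unit n p L2 :> R by exact: weight_unit_gt0.
have lam0 : 0 < lam.
  rewrite /lam sum_alpha//; apply: mulr_gt0 => //; apply: mulr_gt0 => //.
  have x0' : 0 < N0%:R :> R by rewrite ltr0n (leq_trans _ N13).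
  by apply: mulr_gt0 => //; apply: ltr_wpDr.
have S0_new j : outer_draws k `&` new_draws k j `<=` set0.
  by move=> a [ka [|[i]] aE]; move: ka; rewrite aE /= ltnn.
have run := inner_run_bound n8 p12 L20 SP convf xstarP RD ON (batch_size_gt0 n p L2 mu sigma Rp k)
  S0_new (@measurable_outer_iterate k) lam0 Th erefl.
have D0 : 0 <= 3 / 2 * Dz + 3 * De ^+ 2.
  by apply: addr_ge0; apply: mulr_ge0; rewrite ?sqr_ge0// divr_ge0.
have sc := inner_scalar_le sigma (m k) n8 p12 L20 N13 (erefl lam) Th0 D0
  (noise_sqr_le Dz0 De0).
have rs := restart_scalar_le sigma n8 p12 L20 mu0 Rp0 Dz0 De0 k muL.
have c0 : 0 < carried_weight n p L2 N0 :> R.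
  apply: mulr_gt0 => //; apply: mulr_gt0; rewrite ltr0n// (leq_trans _ N13)//.
apply: (ge0_integral_le_div (measurable_gap k.+1) _ c0).
  by move=> w; rewrite subr_ge0.
under eq_integral do rewrite uS.
apply: le_trans run _; rewrite lee_fin; apply: le_trans sc _.
by apply: ler_wpM2l; [exact: ltW|exact: rs].
Qed.

Lemma outer_dist_le k :
  (\int[Pr]_w (lnorm p%:R (u k w - xstar) ^+ 2)%:E <= (radius2 mu Rp Delta k)%:E)%E.
Proof.
elim: k => [|k IH].
  rewrite /u /outer_iterate /= integral_cst_probability lee_fin /radius2.
  by rewrite expr0 invr1 mulr1 subrr mulr0 addr0.
have mu2 : 0 < mu / 2 by rewrite divr_gt0.
apply: (ge0_integral_le_div (measurable_dist k.+1) _ mu2).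
  by move=> w; exact: sqr_ge0.
apply: le_trans (outer_gap_le IH); apply: ge0_le_integralr => //.
- exact: measurable_funM.
- by move=> w; apply: mulr_ge0; [exact: ltW|exact: sqr_ge0].
- by move=> w; rewrite subr_ge0.
- by apply: aeW => w; exact: (strongly_convex_gap L20 SP mu0 scf xstarP).
Qed.

(** The bound on the nonnegative gap yields integrability of the objective at the output, so that
    the minimum value may be subtracted outside the expectation. *)
Lemma outer_expectation_le K : (0 < K)%N ->
  ('E_Pr[(fun w => f (u K w))] - (f xstar)%:E <=
   (mu * Rp ^+ 2 / 2 * 2 ^- K + 2 * Delta)%:E)%E.
Proof.
case: K => // k _; have h := outer_gap_le (outer_dist_le k).
have gap0 w : 0 <= f (u k.+1 w) - f xstar by rewrite subr_ge0.
have I1 : rintegrable Pr (fun w => f (u k.+1 w) - f xstar).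
  apply/integrableP; split; first exact/measurable_EFinP.
  apply: le_lt_trans (ltry (mu / 2 * radius2 mu Rp Delta k.+1)).
  apply: le_trans h; rewrite le_eqVlt; apply/orP; left; apply/eqP.
  by apply: eq_integral => w _; rewrite /comp gee0_abs// lee_fin.
have I2 := rintegrableD I1 (rintegrable_cst Pr (f xstar)).
have fE : (fun w => f (u k.+1 w)) = (fun w => f (u k.+1 w) - f xstar + f xstar).
  by apply/funext => w; rewrite subrK.
rewrite fE unlock EFin_Rintegral// RintegralDr//; last exact: rintegrable_cst.
rewrite Rintegral_cstr -EFinB addrK -EFin_Rintegral//.
apply: le_trans h _; rewrite lee_fin /radius2.
have k0 : 0 < 2 ^- k.+1 :> R by rewrite invr_gt0 exprn_gt0.
have Dl0 : 0 <= Delta by exact: noise_level_ge0.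
have -> : mu / 2 * (Rp ^+ 2 * 2 ^- k.+1 + 4 * Delta / mu * (1 - 2 ^- k.+1)) =
  mu * Rp ^+ 2 / 2 * 2 ^- k.+1 + 2 * Delta * (1 - 2 ^- k.+1).
  by move: Delta (2 ^- k.+1 : R) => a b; field; rewrite gt_eqF.
rewrite lerD2l; apply: ler_piMr; first exact: mulr_ge0.
by rewrite lerBlDr lerDl ltW.
Qed.

End outer_run.

(** * Oracle complexity *)

Section dimension_factors.
Context {R : realType}.
Variables n p : nat.
Hypotheses (n8 : (8 <= n)%N) (p12 : p \in [:: 1%N; 2%N]).
Local Notation l := (ln n%:R : R).

Let n0 : 0 < n%:R :> R. Proof. by rewrite ltr0n (leq_trans _ n8). Qed.
Let l32 : 3 / 2 <= l. Proof. exact: ln_ge_32. Qed.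

Let inv_q_cases : (p = 1%N /\ inv_q p = 0 :> R) \/ (p = 2%N /\ inv_q p = 2^-1 :> R).
Proof.
move: p12; rewrite !inE => /orP[/eqP ->|/eqP ->]; [left|right]; split => //.
  by rewrite /inv_q /conj_exp hoelder_conjugate1.
by rewrite /inv_q /conj_exp hoelder_conjugate2 /= inver/= pnatr_eq0.
Qed.

Lemma n_rho_le : n%:R * rho n p <= 16 * l * n%:R `^ (2 * inv_q p) :> R.
Proof.
case: inv_q_cases => -[pE ->].
  rewrite rho1// mulr0 powRr0 mulr1 mulrC divfK ?gt_eqF//.
  by move: l32; move: l => a; lra.
have n0' := ltW n0; rewrite rho2// mulr1 mulfV ?pnatr_eq0// powRr1//.
by apply: ler_peMl; [exact: ltW|move: l32; move: l => a; lra].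
Qed.

(** For p = 1 the left side is [sqrt (16 ln n - 8) * sqrt n], for p = 2 it is [n]; the factor
    [16 ln n] covers both and is the source of the logarithm in the rate. *)
Lemma sqrt_n_rho_le :
  Num.sqrt (n%:R ^+ 2 * rho n p) <= 16 * l * n%:R `^ (2^-1 + inv_q p) :> R.
Proof.
case: inv_q_cases => -[pE ->].
  have -> : n%:R ^+ 2 * rho n p = n%:R * (16 * l - 8) :> R.
    by rewrite rho1//; move: n0; move: (n%:R : R) (ln _) => x a x0; field; rewrite gt_eqF.
  have n0' := ltW n0; rewrite addr0 powR12_sqrt// sqrtrM// mulrC; apply: ler_wpM2r.
    exact: sqrtr_ge0.
  have a0 : 0 <= 16 * l by move: l32; move: l => a; lra.
  rewrite -[leRHS](ger0_norm a0) -sqrtr_sqr; apply: ler_wsqrtr.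
  by move: l32; move: l => a ?; nra.
have -> : 2^-1 + 2^-1 = 1 :> R by field.
have n0' := ltW n0; rewrite rho2// mulr1 sqrtr_sqr ger0_norm// powRr1//.
by apply: ler_peMl; [exact: ltW|move: l32; move: l => a; lra].
Qed.

End dimension_factors.

Section complexity.
Context {R : realType}.
Variables (n p : nat) (L2 mu sigma Rp : R).
Hypotheses (n8 : (8 <= n)%N) (p12 : p \in [:: 1%N; 2%N]) (L20 : 0 < L2)
  (mu0 : 0 < mu) (Rp0 : 0 < Rp) (muL : mu <= 2 * L2).
Local Notation Om := (Omega n p : R).
Local Notation N0 := (inner_steps n p L2 mu).
Local Notation m k := (batch_size n p L2 mu sigma Rp k).

Let n0 : 0 < n%:R :> R. Proof. by rewrite ltr0n (leq_trans _ n8). Qed.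
Let om1 : 1 <= Om. Proof. exact: Omega_ge1. Qed.
Let om0 : 0 < Om. Proof. by move: om1; apply: lt_le_trans. Qed.

(** The square root is at most [64 q Z], and the 1 added by the ceiling is absorbed since
    [q Z >= 1/2], a consequence of [mu <= 2 L2]. *)
Lemma inner_steps_le :
  N0%:R <= 128 * (Num.sqrt (n%:R ^+ 2 * rho n p) * Num.sqrt (L2 * Om / mu)) :> R.
Proof.
have nr1 : 1 <= n%:R ^+ 2 * rho n p :> R by exact: sqr_n_rho_ge1.
have z12 : 2^-1 <= L2 * Om / mu.
  rewrite ler_pdivlMr// mulrC ler_pdivrMr//.
  apply: le_trans muL _; rewrite mulrC; apply: ler_wpM2r => //.
  by apply: ler_peMr; [exact: ltW|exact: om1].
set q := Num.sqrt (n%:R ^+ 2 * rho n p); set Z := Num.sqrt (L2 * Om / mu).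
have q0 : 0 <= q by exact: sqrtr_ge0.
have Z0 : 0 <= Z by exact: sqrtr_ge0.
have qE : q ^+ 2 = n%:R ^+ 2 * rho n p by rewrite sqr_sqrtr// (le_trans _ nr1).
have ZE : Z ^+ 2 = L2 * Om / mu by rewrite sqr_sqrtr// (le_trans _ z12).
have aE : 8 * (384 * n%:R ^+ 2 * rho n p) * L2 * Om / mu = 3072 * (q * Z) ^+ 2.
  rewrite exprMn qE ZE; move: (rho n p : R) Om (n%:R : R) mu^-1 => a b c h; ring.
have qZ : 2^-1 <= q * Z.
  rewrite leNgt; apply/negP => h.
  have : 2^-1 <= (q * Z) ^+ 2.
    rewrite exprMn qE ZE -[leLHS]mul1r; apply: ler_pM => //.
  have := mulr_ge0 q0 Z0; move: h; move: (q * Z) => a; nra.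
have s64 : Num.sqrt (3072 * (q * Z) ^+ 2) <= 64 * (q * Z).
  have y0 : 0 <= 64 * (q * Z) by apply: mulr_ge0 => //; exact: mulr_ge0.
  rewrite -[leRHS](ger0_norm y0) -sqrtr_sqr; apply: ler_wsqrtr.
  by move: (q * Z) => a; nra.
rewrite /inner_steps aE.
have := nat_ceil_lt (sqrtr_ge0 (3072 * (q * Z) ^+ 2)).
move: s64 qZ; move: (Num.sqrt _) => a.
by move: (q * Z) ((nat_ceil a)%:R : R) => b c; lra.
Qed.

Lemma batch_size_le k : (m k)%:R <= 1 +
  8 * (4 / n%:R) * sigma ^+ 2 * N0%:R / (L2 * mu * Rp ^+ 2) * 2 ^+ k.
Proof.
set a := 8 * (4 / n%:R) * sigma ^+ 2 * N0%:R / (L2 * mu * Rp ^+ 2).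
have a0 : 0 <= a * 2 ^+ k.
  apply: mulr_ge0; last exact: exprn_ge0.
  apply: divr_ge0; last by apply: mulr_ge0; [apply: mulr_ge0; exact: ltW|exact: sqr_ge0].
  apply: mulr_ge0 => //; apply: mulr_ge0; last exact: sqr_ge0.
  by apply: mulr_ge0 => //; apply: divr_ge0 => //; exact: ltW.
have := nat_ceil_lt a0.
rewrite /batch_size (_ : _ / _ = a * 2 ^+ k); last by rewrite /a mulrAC.
move=> h; rewrite /maxn; case: ifP => _; last by rewrite lerDl.
by rewrite addrC ltW.
Qed.

(** The geometric part of the batch sizes sums to less than [2 ^ K] times its coefficient; the 1
    from rounding gives the term linear in [K]. *)
Lemma oracle_calls_le K : (oracle_calls n p L2 mu sigma Rp K)%:R <=
  N0%:R * K%:R + 32 * N0%:R ^+ 2 * sigma ^+ 2 * 2 ^+ K / (n%:R * L2 * mu * Rp ^+ 2).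
Proof.
set a := 8 * (4 / n%:R) * sigma ^+ 2 * N0%:R / (L2 * mu * Rp ^+ 2).
have a0 : 0 <= a.
  apply: divr_ge0; last by apply: mulr_ge0; [apply: mulr_ge0; exact: ltW|exact: sqr_ge0].
  apply: mulr_ge0 => //; apply: mulr_ge0; last exact: sqr_ge0.
  by apply: mulr_ge0 => //; apply: divr_ge0 => //; exact: ltW.
have -> : 32 * N0%:R ^+ 2 * sigma ^+ 2 * 2 ^+ K / (n%:R * L2 * mu * Rp ^+ 2) =
    N0%:R * (a * 2 ^+ K).
  rewrite /a; move: (N0%:R : R) (2 ^+ K : R) => x y.
  by field; rewrite !gt_eqF// exprn_gt0.
rewrite -mulrDr /oracle_calls.
elim: K => [|K IH].
  by rewrite big_ord0; apply: mulr_ge0 => //; rewrite add0r mulr1.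
rewrite big_ord_recr/= natrD natrM; apply: le_trans (lerD IH (lexx _)) _.
rewrite -mulrDr; apply: ler_wpM2l => //.
have NS : K.+1%:R = K%:R + 1 :> R by rewrite natr1.
have := batch_size_le K; rewrite -/a exprS NS.
by move: (2 ^+ K : R) ((m K)%:R : R) (K%:R : R) => x y z; lra.
Qed.

(** Each of the two parts is at most [2^24 * ln n] times the maximum: the deterministic one has the
    constant [128 * 2 * 16 = 2^12], the stochastic one [32 * 2^14 * 2 * 16 = 2^24]. *)
Lemma oracle_calls_rate K (eps lg : R) : 0 < eps ->
  2 ^+ K <= 2 * (mu * Rp ^+ 2 / eps) -> K%:R <= 2 * lg ->
  (oracle_calls n p L2 mu sigma Rp K)%:R <= 2 ^+ 25 * ln n%:R `^ 1 *
    Num.max (n%:R `^ (2^-1 + inv_q p) * Num.sqrt (L2 * Om / mu) * lg)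
            (n%:R `^ (2 * inv_q p) * sigma ^+ 2 * Om / (mu * eps)).
Proof.
move=> eps0 K2 Klg; have l32 := @ln_ge_32 R n n8.
have l0 : 0 <= ln n%:R :> R by apply: le_trans l32; rewrite divr_ge0.
rewrite powRr1//.
set A := _ * lg; set B := _ / (mu * eps); set M := Num.max A B.
have AM : A <= M by rewrite le_max lexx.
have BM : B <= M by rewrite le_max lexx orbT.
have lg0 : 0 <= lg by rewrite -(pmulr_rge0 _ (ltr0Sn R 1)) (le_trans _ Klg).
pose q : R := Num.sqrt (n%:R ^+ 2 * rho n p); pose Z : R := Num.sqrt (L2 * Om / mu).
have NqZ : N0%:R <= 128 * (q * Z) by exact: inner_steps_le.
have q0 : 0 <= q by exact: sqrtr_ge0.
have Z0 : 0 <= Z by exact: sqrtr_ge0.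
have A0 : 0 <= A by apply: mulr_ge0 => //; apply: mulr_ge0 => //; exact: powR_ge0.
have lM : 0 <= ln n%:R * M by apply: mulr_ge0 => //; exact: le_trans AM.
have tA : N0%:R * K%:R <= 2 ^+ 24 * (ln n%:R * M).
  apply: (@le_trans _ _ (128 * (q * Z) * (2 * lg))); first exact: ler_pM.
  apply: (@le_trans _ _ (2 ^+ 12 * (ln n%:R * A))).
    have -> : 2 ^+ 12 * (ln n%:R * A) =
        2 ^+ 8 * ((16 * ln n%:R * n%:R `^ (2^-1 + inv_q p)) * (Z * lg)).
      by rewrite /A -/Z; move: (ln n%:R : R) (n%:R `^ _) => x y; ring.
    have -> : 128 * (q * Z) * (2 * lg) = 2 ^+ 8 * (q * (Z * lg)) by ring.
    apply: ler_wpM2l; first exact: exprn_ge0.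
    by apply: ler_wpM2r; [exact: mulr_ge0|exact: sqrt_n_rho_le].
  apply: ler_pM => //.
  - exact: mulr_ge0.
  - by apply: ler_weXn2l => //; rewrite ler1n.
  - exact: ler_wpM2l.
have tB : 32 * N0%:R ^+ 2 * sigma ^+ 2 * 2 ^+ K / (n%:R * L2 * mu * Rp ^+ 2) <=
    2 ^+ 24 * (ln n%:R * M).
  have N2 : N0%:R ^+ 2 <= 2 ^+ 14 * (n%:R ^+ 2 * rho n p * (L2 * Om / mu)) :> R.
    have -> : 2 ^+ 14 * (n%:R ^+ 2 * rho n p * (L2 * Om / mu)) = (128 * (q * Z)) ^+ 2.
      rewrite [RHS]exprMn exprMn !sqr_sqrtr.
      - by move: (n%:R ^+ 2 * rho n p) (L2 * Om / mu) => x y; ring.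
      - by apply: divr_ge0; [apply: mulr_ge0; exact: ltW|exact: ltW].
      - by apply: le_trans (sqr_n_rho_ge1 n8 p12).
    have y0 : 0 <= 128 * (q * Z) by apply: mulr_ge0 => //; exact: mulr_ge0.
    by apply: lerXn2r => //; rewrite nnegrE.
  have R20 : 0 < Rp ^+ 2 by exact: exprn_gt0.
  have den0 : 0 < n%:R * L2 * mu * Rp ^+ 2.
    by apply: mulr_gt0 => //; apply: mulr_gt0 => //; exact: mulr_gt0.
  apply: (@le_trans _ _ (32 * (2 ^+ 14 * (n%:R ^+ 2 * rho n p * (L2 * Om / mu))) * sigma ^+ 2
      * (2 * (mu * Rp ^+ 2 / eps)) / (n%:R * L2 * mu * Rp ^+ 2))).
    rewrite ler_pM2r ?invr_gt0//; apply: ler_pM => //.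
    + by apply: mulr_ge0; [apply: mulr_ge0 => //; exact: sqr_ge0|exact: sqr_ge0].
    by apply: ler_wpM2r; [exact: sqr_ge0|exact: ler_wpM2l].
  have -> : 32 * (2 ^+ 14 * (n%:R ^+ 2 * rho n p * (L2 * Om / mu))) * sigma ^+ 2
      * (2 * (mu * Rp ^+ 2 / eps)) / (n%:R * L2 * mu * Rp ^+ 2) =
      2 ^+ 20 * (n%:R * rho n p * (sigma ^+ 2 * Om / (mu * eps))).
    move: (rho n p : R) Om (n%:R : R) n0 => a b x x0.
    by field; rewrite !gt_eqF.
  have w0 : 0 <= sigma ^+ 2 * Om / (mu * eps).
    by apply: divr_ge0; apply: mulr_ge0; rewrite ?sqr_ge0// ltW.
  apply: (@le_trans _ _ (2 ^+ 24 * (ln n%:R * B))); last first.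
    by apply: ler_wpM2l; [exact: exprn_ge0|exact: ler_wpM2l].
  have -> : 2 ^+ 24 * (ln n%:R * B) =
     2 ^+ 20 * (16 * ln n%:R * n%:R `^ (2 * inv_q p) * (sigma ^+ 2 * Om / (mu * eps))).
    rewrite /B; move: (ln n%:R : R) (n%:R `^ _) (mu * eps)^-1 Om => x y w b.
    by ring.
  apply: ler_wpM2l; first exact: exprn_ge0.
  by apply: ler_wpM2r => //; exact: n_rho_le.
apply: le_trans (oracle_calls_le K) _; apply: le_trans (lerD tA tB) _.
have -> : 2 ^+ 25 = 2 * 2 ^+ 24 :> R by rewrite -exprS.
have twice (c l x : R) : c * (l * x) + c * (l * x) = 2 * c * l * x by ring.
by rewrite twice.
Qed.

(** [K] is the ceiling of [log2 y], and 1 when [y <= 1]. For [y >= 2] the logarithm is at least 1,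
    so rounding up at most doubles it. *)
Lemma accuracy_iterations (y : R) : 0 < y -> exists K : nat,
  [/\ (1 <= K)%N, y <= 2 ^+ K &
    2 <= y -> 2 ^+ K <= 2 * y /\ K%:R <= 2 * log2 y].
Proof.
move=> y0; have [y1|y1] := leP y 1.
  exists 1%N; split => //; first by rewrite expr1; lra.
  by lra.
have ln2 : 0 < ln 2 :> R by apply: ln_gt0; rewrite ltr1n.
have lg0 : 0 < log2 y by apply: divr_gt0 => //; exact: ln_gt0.
have K1 := nat_ceil_ge (ltW lg0); have K2 := nat_ceil_lt (ltW lg0).
set K := nat_ceil (log2 y) in K1 K2 *.
have powE j : 2 ^+ j = expR (j%:R * ln 2) :> R.
  by rewrite expRM_natl lnK// posrE.
have yE : y = expR (log2 y * ln 2) by rewrite /log2 divfK ?gt_eqF// lnK.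
exists K; split.
- by rewrite -(ltr_nat R) (lt_le_trans lg0).
- by rewrite powE {1}yE ler_expR ler_pM2r.
- move=> y2; split.
    have -> : 2 * y = expR ((log2 y + 1) * ln 2).
      have -> : (log2 y + 1) * ln 2 = log2 y * ln 2 + ln 2 by ring.
      by rewrite expRD -yE lnK ?posrE// mulrC.
    by rewrite powE ler_expR ler_pM2r// ltW.
  have : 1 <= log2 y by rewrite /log2 ler_pdivlMr// mul1r ler_ln ?posrE.
  by move: K2; move: (log2 y) (K%:R : R) => a b; lra.
Qed.

(** With [Dz = t^2] and [De = t] the combination [sqrt Dz / 2 + 2 De] is [5/2 t], so for [t <= 1]
    the whole level is at most linear in [t]. *)
Lemma noise_level_small (eps : R) : 0 < eps -> exists Dz De : R,
  [/\ 0 < Dz, 0 < De & 2 * noise_level n p L2 mu Rp Dz De <= eps / 2].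
Proof.
move=> eps0.
have N13 := inner_steps_ge13 n8 p12 L20 mu0 muL.
have x0 : 0 < N0%:R :> R by rewrite ltr0n (leq_trans _ N13).
have r0 : 0 < rho n p :> R by exact: rho_gt0.
pose a : R := 61 * N0%:R / (24 * L2).
pose b : R := 122 * N0%:R / (3 * L2).
pose c : R := 12 * Num.sqrt (2 * n%:R * Rp ^+ 2 * Om) / N0%:R ^+ 2.
pose h : R := N0%:R ^+ 2 / (12 * n%:R * rho n p * L2).
have a0 : 0 <= a by apply: divr_ge0; apply: mulr_ge0 => //; exact: ltW.
have b0 : 0 <= b by apply: divr_ge0; apply: mulr_ge0 => //; exact: ltW.
have c0 : 0 <= c by apply: divr_ge0; [apply: mulr_ge0 => //; exact: sqrtr_ge0|exact: sqr_ge0].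
have h0 : 0 <= h.
  apply: divr_ge0; first exact: sqr_ge0.
  by apply: mulr_ge0; [apply: mulr_ge0; [exact: mulr_ge0|exact: ltW]|exact: ltW].
pose M := a + b + c * (5 / 2) + h * (25 / 4).
have M0 : 0 <= M by do !apply: addr_ge0 => //; apply: mulr_ge0 => //; rewrite divr_ge0.
(* The bound 1 linearizes the squares; the denominator [M + 1] is positive whatever the data. *)
pose t := Num.min 1 (eps / 4 / (M + 1)).
have M1 : 0 < M + 1 by apply: ltr_wpDl.
have t0 : 0 < t by rewrite lt_min ltr01 !divr_gt0.
have t1 : t <= 1 by rewrite ge_min lexx.
have tM : t * M <= eps / 4.
  have : t <= eps / 4 / (M + 1) by rewrite ge_min lexx orbT.
  rewrite ler_pdivlMr// => h'; apply: le_trans h'; apply: ler_wpM2l; first exact: ltW.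
  by rewrite lerDl.
exists (t ^+ 2), t; split => //; first exact: exprn_gt0.
rewrite /noise_level sqrtr_sqr (ger0_norm (ltW t0)) -/a -/b -/c -/h.
have t2 : t ^+ 2 <= t by rewrite expr2 ler_piMl// ltW.
have e (y : R) : y / 2 + 2 * y = 5 / 2 * y by field.
have eM (y a' b' c' h' : R) : y * (a' + b' + c' * (5 / 2) + h' * (25 / 4)) =
  a' * y + b' * y + c' * (5 / 2 * y) + h' * (25 / 4 * y) by field.
have e2 (y : R) : y ^+ 2 <= y -> (5 / 2 * y) ^+ 2 <= 25 / 4 * y by lra.
have key : a * t ^+ 2 + b * t ^+ 2 + c * (5 / 2 * t) + h * (5 / 2 * t) ^+ 2 <= t * M.
  rewrite /M eM; apply: lerD; last by apply: ler_wpM2l => //; exact: e2.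
  by apply: lerD => //; apply: lerD; exact: ler_wpM2l.
rewrite e; apply: le_trans (ler_wpM2l (ler0n R 2) (le_trans key tM)) _.
by rewrite le_eqVlt; apply/orP; left; apply/eqP; field.
Qed.

End complexity.

(** The soft-O is read as a power of [ln n] with constants uniform in all data, and [K] is fixed
    before the noise of the oracle. The rate is asserted for [2 * eps <= mu * Rp ^ 2], where the
    logarithm is at least 1 and absorbs the rounding of [K]. *)
Theorem theorem2p4 (R : realType) :
  (* the absolute constants of the soft-O *)
  exists C c : R, 0 < C /\ 0 < c /\
  forall (n p : nat) (d : measure_display) (X : measurableType d)
    (P : probability X R) (F : 'rV[R]_n -> X -> R)
    (g : 'rV[R]_n -> X -> 'rV[R]_n) (L : X -> R) (L2 sigma mu Rp : R)
    (xstar x0 : 'rV[R]_n),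
  let f := objective P F in
  let Delta := noise_level n p L2 mu Rp in
  let run Dzeta Deta zeta eta :=
    @arddsc R n p L2 mu sigma Rp (Delta Dzeta Deta) X (oracle g zeta eta) x0 in
  (8 <= n)%N -> p \in [:: 1%N; 2%N] -> 0 < L2 -> 0 < mu -> 0 < Rp ->
  stochastic_problem P F g L L2 sigma ->
  strongly_convex p%:R mu f ->
  minimizer f xstar ->
  lnorm p%:R (x0 - xstar) ^+ 2 <= Rp ^+ 2 ->
  (forall (Dzeta Deta : R) (zeta eta : 'rV[R]_n -> X -> 'rV[R]_n -> R)
     (d' : measure_display) (T : measurableType d') (Pr : probability T R)
     (e : nat -> nat -> {RV Pr >-> 'rV[R]_n})
     (xi : nat -> nat -> nat -> {RV Pr >-> X}) (K : nat),
   oracle_noise P zeta eta Dzeta Deta ->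
   random_draws P e xi ->
   (1 <= K)%N ->
   ('E_Pr[(fun w => f (run Dzeta Deta zeta eta
                        (fun k j => e k j w) (fun k j i => xi k j i w) K))%R]
      - (f xstar)%:E
    <= (mu * Rp ^+ 2 / 2 * 2 ^- K + 2 * Delta Dzeta Deta)%:E)%E)
  /\
  (forall eps : R, 0 < eps ->
   exists K : nat,
   [/\ (1 <= K)%N,
       2 * eps <= mu * Rp ^+ 2 ->
       (oracle_calls n p L2 mu sigma Rp K)%:R <=
         C * ln n%:R `^ c *
         Num.max
           (n%:R `^ (2^-1 + inv_q p) * Num.sqrt (L2 * Omega n p / mu)
              * log2 (mu * Rp ^+ 2 / eps))
           (n%:R `^ (2 * inv_q p) * sigma ^+ 2 * Omega n p / (mu * eps)),
       exists Dzeta Deta : R,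
         [/\ 0 < Dzeta, 0 < Deta & 2 * Delta Dzeta Deta <= eps / 2] &
       forall (Dzeta Deta : R) (zeta eta : 'rV[R]_n -> X -> 'rV[R]_n -> R)
         (d' : measure_display) (T : measurableType d') (Pr : probability T R)
         (e : nat -> nat -> {RV Pr >-> 'rV[R]_n})
         (xi : nat -> nat -> nat -> {RV Pr >-> X}),
       2 * Delta Dzeta Deta <= eps / 2 ->
       oracle_noise P zeta eta Dzeta Deta ->
       random_draws P e xi ->
       ('E_Pr[(fun w => f (run Dzeta Deta zeta eta
                            (fun k j => e k j w) (fun k j i => xi k j i w) K))%R]
          - (f xstar)%:E <= eps%:E)%E]).
Proof.
exists (2 ^+ 25), 1; split; first exact: exprn_gt0.
split; first exact: ltr01.
move=> n p d X P F g L L2 sigma mu Rp xstar x0 f Delta run.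
move=> n8 p12 L20 mu0 Rp0 SP scf xstarP x0R.
have p0 : p%:R != 0 :> R.
  by move: p12; rewrite pnatr_eq0 !inE => /orP[] /eqP ->.
have muL : mu <= 2 * L2.
  by apply: (strongly_convex_smooth L20 SP mu0 scf xstarP) => //; exact: leq_trans n8.
have accuracy (Dz De : R) (zeta eta : 'rV[R]_n -> X -> 'rV[R]_n -> R)
    (d' : measure_display) (T : measurableType d') (Pr : probability T R)
    (e : nat -> nat -> {RV Pr >-> 'rV[R]_n})
    (xi : nat -> nat -> nat -> {RV Pr >-> X}) (K : nat) :
   oracle_noise P zeta eta Dz De -> random_draws P e xi -> (1 <= K)%N ->
   ('E_Pr[(fun w => f (run Dz De zeta eta
                        (fun k j => e k j w) (fun k j i => xi k j i w) K))%R]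
      - (f xstar)%:E
    <= (mu * Rp ^+ 2 / 2 * 2 ^- K + 2 * Delta Dz De)%:E)%E.
  move=> ON RD K1.
  exact: (outer_expectation_le n8 p12 L20 mu0 Rp0 SP scf xstarP x0R RD ON K1).
split; first exact: accuracy.
move=> eps eps0.
have y0 : 0 < mu * Rp ^+ 2 / eps by apply: divr_gt0 => //; apply: mulr_gt0 => //; exact: exprn_gt0.
have [K [K1 yK Kle]] := accuracy_iterations y0.
(* [2 ^ K >= mu Rp^2 / eps] makes the geometric term at most [eps / 2]; the noise is allowed the
   other half. *)
exists K; split => //.
- move=> epsR; have y2 : 2 <= mu * Rp ^+ 2 / eps by rewrite ler_pdivlMr.
  have [K2 Klog] := Kle y2.
  exact: oracle_calls_rate.
- exact: noise_level_small.
- move=> Dz De zeta eta d' T Pr e xi DeltaE ON RD.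
  apply: le_trans (accuracy _ _ _ _ _ _ _ _ _ _ ON RD K1) _; rewrite lee_fin.
  have h : mu * Rp ^+ 2 / 2 * 2 ^- K <= eps / 2.
    rewrite mulrAC; apply: ler_wpM2r => //.
    rewrite ler_pdivrMr ?exprn_gt0//.
    by move: yK; rewrite ler_pdivrMr// [X in _ <= X]mulrC.
  by rewrite [leRHS](splitr eps); exact: lerD.
Qed.
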